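(* Let $V$ be a DVR with quotient field $K$ and perfect residue field, and let $W$ be a DVR with quotient field $K(X)$ which extends $V$ (that is, $W\cap K=V$) and is residually algebraic over $V$. Denote by $k_w$ and $k_v$ the residue fields of $W$ and of $V$, and by $\Gamma_w$ and $\Gamma_v$ their value groups. Then: (1) there exists $\alpha\in\mathbb{K}$, transcendental over $K$, such that $W=V_{\alpha}$; (2) for every such $\alpha$ (i.e. every $\alpha\in\mathbb{K}$ transcendental over $K$ with $W=V_\alpha$), one has $\alpha\in\overline{\widehat K}\iff[k_w:k_v]<\infty$; (3) when $[k_w:k_v]=\infty$, every such $\alpha$ is the limit of a Cauchy sequence $\{s_n\}_{n\in\mathbb{N}}\subset\overline{\widehat K}$ with $e_{s_n}=[\Gamma_w:\Gamma_v]$ for all large $n$.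
   Context: A DVR is a discrete valuation domain of rank one (value group isomorphic to $\mathbb{Z}$). $V$ is a DVR with quotient field $K$, associated valuation $v$, value group $\Gamma_v$ and residue field $k_v$; $X$ is an indeterminate over $K$. $\widehat K$ is the $v$-adic completion of $K$, $\overline{\widehat K}$ an algebraic closure of $\widehat K$, and $v$ also denotes its unique extension to $\overline{\widehat K}$; $\mathbb{K}$ is the completion of $\overline{\widehat K}$ with respect to $v$, with the extended valuation again denoted $v$ (and $v(0)=\infty$). A valuation domain $W$ of $K(X)$ with $W\cap K=V$ is residually algebraic over $V$ if its residue field is algebraic over $k_v$; in that case $\Gamma_v$ is viewed as a subgroup of $\Gamma_w$ and $k_v$ as a subfield of $k_w$. For $\alpha\in\mathbb{K}$ transcendental over $K$, put $V_\alpha=\{\phi\in K(X)\mid v(\phi(\alpha))\ge 0\}$, a valuation domain of $K(X)$. For $s\in\mathbb{K}$, $e_s=e(\widehat K(s)\mid\widehat K)$ is the ramification index, i.e. the index of $v(\widehat K^\times)=\Gamma_v$ in $v(\widehat K(s)^\times)$, an element of $\mathbb{N}\cup\{\infty\}$. *)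

(* Defs.v *)
From HB Require Import structures.
From mathcomp Require Import all_boot all_order all_algebra all_field.
From mathcomp Require Import finmap mathcomp_extra boolp classical_sets functions.
From mathcomp Require Import cardinality constructive_ereal.
From mathcomp Require Import generic_quotient ring_quotient fraction.

Set Implicit Arguments.
Unset Strict Implicit.
Unset Printing Implicit Defensive.

Import Order.TTheory GRing.Theory Num.Theory.

Local Open Scope ring_scope.
Local Open Scope classical_set_scope.

(* Only valuations with values in a subgroup of the rationals are needed: a    *)
(* discrete valuation has value group Z, its extensions to algebraic           *)
(* extensions take values in the divisible hull Q of Z, and passing to a       *)
(* completion does not change the value group. Valuations need not be          *)
(* normalized. That v 1 = 0 follows from multiplicativity.                     *)
Record valuation (L : fieldType) := Valuation {
  val_fun :> L -> \bar rat;
  val_eqy : forall x, (val_fun x == +oo%E) = (x == 0);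
  val_neqNy : forall x, val_fun x != -oo%E;
  valM : forall x y, val_fun (x * y) = (val_fun x + val_fun y)%E;
  val_geD : forall x y, (mine (val_fun x) (val_fun y) <= val_fun (x + y)%R)%E }.

(* v(S \ {0}); for a subfield S of L this is the value group of S.             *)
Definition value_group (L : fieldType) (v : valuation L) (S : set L) :
  set rat := [set g | exists2 x, S x & v x = g%:E].

(* A subgroup of Q is isomorphic to Z iff it is infinite cyclic.               *)
Definition discrete (L : fieldType) (v : valuation L) : Prop :=
  exists2 g : rat, g != 0 & value_group v setT = [set g *~ n | n in setT].

(* The index of the subgroup H of G, where None stands for infinity.           *)
Definition cosets (H G : set rat) : set (set rat) :=
  [set [set g + h | h in H] | g in G].

Definition group_index (H G : set rat) : option nat :=
  if `[< finite_set (cosets H G) >] then Some (#|` fset_set (cosets H G)|)%fset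
  else None.

Section ValuationRing.
Variables (L : fieldType) (v : valuation L).

Lemma val0 : v 0 = +oo%E.
Proof. by apply/eqP; rewrite val_eqy. Qed.

Lemma val_fin x : x != 0 -> exists r : rat, v x = r%:E.
Proof.
move=> x0; case E : (v x) => [r| |]; first by exists r.
- by move/eqP: E; rewrite val_eqy (negPf x0).
- by have := val_neqNy v x; rewrite E.
Qed.

Lemma val1 : v 1 = 0%E.
Proof.
have [r Er] := val_fin (oner_neq0 L).
have := valM v 1 1; rewrite mulr1 Er -EFinD => -[] /eqP.
by rewrite -subr_eq0 opprD addNKr oppr_eq0 => /eqP ->.
Qed.

Lemma valN x : v (- x) = v x.
Proof.
have [r Er] : exists r : rat, v (- 1) = r%:E.
  by apply: val_fin; rewrite oppr_eq0 oner_neq0.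
suff r0 : r = 0 by rewrite -mulN1r valM Er r0 add0e.
have := valM v (-1) (-1); rewrite mulrNN mulr1 val1 Er -EFinD => -[] /eqP.
by rewrite eq_sym -mulr2n mulrn_eq0 /= => /eqP.
Qed.

Lemma valV x : x != 0 -> v (x^-1) = (- v x)%E.
Proof.
move=> x0; have [r Er] := val_fin x0.
have [s Es] : exists s : rat, v x^-1 = s%:E by apply: val_fin; rewrite invr_eq0.
have := valM v x x^-1; rewrite mulfV // val1 Er Es -EFinD => -[] /eqP.
by rewrite eq_sym addrC addr_eq0 => /eqP ->.
Qed.

Definition valuation_ring : {pred L} := [pred x | (0 <= v x)%E].

Fact valuation_ring_subring : subring_closed valuation_ring.
Proof.
split=> [|x y|x y]; rewrite !inE; first by rewrite val1.
- move=> hx hy; apply: le_trans (val_geD v x (- y)).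
  by rewrite le_min hx valN.
- by move=> hx hy; rewrite valM adde_ge0.
Qed.
HB.instance Definition _ :=
  GRing.isSubringClosed.Build L valuation_ring valuation_ring_subring.

Record vring := Vring { vring_val :> L; _ : vring_val \in valuation_ring }.
HB.instance Definition _ := [isSub for vring_val].
HB.instance Definition _ := [Choice of vring by <:].
HB.instance Definition _ := [SubChoice_isSubComNzRing of vring by <:].

Definition vmax : {pred vring} := [pred x : vring | (0 < v (val x)%R)%E].

Fact vmax_ideal : idealr_closed vmax.
Proof.
split=> [||a x y]; rewrite ?inE /=.
- by rewrite val0.
- by rewrite val1 ltxx.
- move=> hx hy.
  change (0 < v (vring_val a * vring_val x + vring_val y)%R)%E.
  apply: lt_le_trans (val_geD v _ _); rewrite lt_min hy andbT valM.
  have : (0 <= v (val a))%E by exact: (valP a).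
  by move=> ha; apply: (lt_le_trans hx); rewrite leeDr.
Qed.
HB.instance Definition _ := isIdealr.Build vring vmax vmax_ideal.

Definition residue_field := {ideal_quot vmax}.
HB.instance Definition _ := GRing.ComNzRing.on residue_field.

(* The residue class of x; junk value 0 when x is outside the valuation ring.  *)
Definition residue (x : L) : residue_field :=
  \pi_{ideal_quot vmax}%qT (insubd (0 : vring) x).

Lemma residue_val (a : vring) :
  residue (val a) = \pi_{ideal_quot vmax}%qT a.
Proof. by rewrite /residue valKd. Qed.

Definition residue_lift (c : residue_field) : L := val (repr c : vring).

Lemma residue_liftK : cancel residue_lift residue.
Proof. by move=> c; rewrite /residue /residue_lift valKd reprK. Qed.

Lemma residue_eq x y : x \in valuation_ring -> y \in valuation_ring ->
  (residue x == residue y) = (0 < v (x - y)%R)%E.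
Proof.
move=> hx hy; rewrite /residue -(@Quotient.idealrBE _ vmax).
by rewrite inE /= !insubdK.
Qed.

Definition residue_inv (c : residue_field) : residue_field :=
  if c == 0 then 0 else residue (residue_lift c)^-1.

Fact residue_mulVf c : c != 0 -> residue_inv c * c = 1.
Proof.
move=> c0; rewrite /residue_inv (negPf c0).
set x := residue_lift c.
have hx : x \in valuation_ring by exact: valP.
have r0 : residue 0 = 0.
  by rewrite -[0 in LHS]/(val (0 : vring)) residue_val piE.
have r1 : residue 1 = 1.
  by rewrite -[1 in LHS]/(val (1 : vring)) residue_val piE.
have h0 : 0 \in valuation_ring by rewrite inE val0.
have vx0 : v x = 0%E.
  move: c0; rewrite -[c]residue_liftK -/x -r0 (residue_eq hx h0) subr0 -leNgt.
  by move=> vx; apply/eqP; rewrite eq_le vx.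
have x0 : x != 0 by apply/eqP => x0; move: vx0; rewrite x0 val0.
have hV : x^-1 \in valuation_ring by rewrite inE valV // vx0 oppe0.
rewrite -[c in _ * c]residue_liftK -/x -r1 -(mulVf x0).
pose a := Vring hx; pose b := Vring hV.
have -> : residue (x^-1 * x) = residue (val (b * a)) by [].
by rewrite -[x]/(val a) -[X in X * _]/(residue (val b)) !residue_val rmorphM.
Qed.

Fact residue_inv0 : residue_inv 0 = 0.
Proof. by rewrite /residue_inv eqxx. Qed.

HB.instance Definition _ :=
  GRing.ComNzRing_isField.Build residue_field residue_mulVf residue_inv0.

End ValuationRing.

(* The map of residue fields induced by a field embedding i of K in L such     *)
(* that the valuation ring of w contracts to that of v.                        *)
Definition residue_map (K L : fieldType) (v : valuation K) (w : valuation L)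
    (i : K -> L) (c : residue_field v) : residue_field w :=
  residue w (i (residue_lift c)).

Lemma residue_mapE (K L : fieldType) (v : valuation K) (w : valuation L)
    (i : {rmorphism K -> L}) x :
  (forall y, (i y \in valuation_ring w) = (y \in valuation_ring v)) ->
  x \in valuation_ring v -> residue_map w i (residue v x) = residue w (i x).
Proof.
move=> h hx; have hl : residue_lift (residue v x) \in valuation_ring v.
  exact: valP.
apply/eqP; rewrite residue_eq ?h // -rmorphB.
have : (0 < v (residue_lift (residue v x) - x)%R)%E.
  by rewrite -residue_eq // residue_liftK.
set z := _ - x => vz.
have [->|z0] := eqVneq z 0; first by rewrite rmorph0 val0.
have iz0 : i z != 0 by rewrite fmorph_eq0.
rewrite ltNge; apply/negP => wz.
have := h z^-1; rewrite !inE fmorphV !valV // !oppe_ge0 wz.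
by rewrite leNgt vz.
Qed.

Definition perfect_field (F : fieldType) : Prop :=
  forall p : {poly F}, irreducible_poly p -> separable_poly p.

Definition algebraic_ext (F E : fieldType) (f : F -> E) : Prop :=
  forall y : E, algebraicOver f y.

Definition finite_ext (F E : fieldType) (f : F -> E) : Prop :=
  exists n (b : 'I_n -> E), forall y : E,
    exists c : 'I_n -> F, y = \sum_i f (c i) * b i.

Definition val_cvg (L : fieldType) (v : valuation L) (s : nat -> L) (l : L) :
    Prop :=
  forall r : rat, exists N, forall n, (N <= n)%N -> (r%:E < v (s n - l)%R)%E.

Definition val_cauchy (L : fieldType) (v : valuation L) (s : nat -> L) : Prop :=
  forall r : rat, exists N, forall m n, (N <= m)%N -> (N <= n)%N ->
    (r%:E < v (s m - s n)%R)%E.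

Definition val_extends (K L : fieldType) (v : valuation K) (w : valuation L)
    (i : K -> L) : Prop :=
  forall x, w (i x) = v x.

Record is_completion (K L : fieldType) (v : valuation K) (w : valuation L)
    (i : {rmorphism K -> L}) : Prop := IsCompletion {
  completion_extends : val_extends v w i;
  completion_dense : forall (y : L) (r : rat),
    exists x : K, (r%:E < w (y - i x)%R)%E;
  completion_complete : forall s : nat -> L,
    val_cauchy w s -> exists l, val_cvg w s l }.

(* The subfield F(s) of L; quotients with q.[s] = 0 contribute only 0.         *)
Definition adjoin (F L : fieldType) (i : {rmorphism F -> L}) (s : L) : set L :=
  [set y | exists p q : {poly F}, y = (map_poly i p).[s] / (map_poly i q).[s]].

Definition ramification_index (F L : fieldType) (v : valuation L)
    (i : {rmorphism F -> L}) (s : L) : option nat :=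
  group_index (value_group v (range i)) (value_group v (adjoin i s)).

Notation ratfun K := {fraction {poly K}}.

Definition ratfun_const (K : fieldType) : K -> ratfun K :=
  @FracField.tofrac {poly K} \o polyC.
HB.instance Definition _ (K : fieldType) :=
  GRing.RMorphism.copy (@ratfun_const K) (@FracField.tofrac {poly K} \o polyC).

(* phi(a), for a transcendental over K.                                        *)
Definition ratfun_eval (K L : fieldType) (i : {rmorphism K -> L}) (a : L)
    (phi : ratfun K) : L :=
  (map_poly i (frac (repr phi)).1).[a] / (map_poly i (frac (repr phi)).2).[a].

Lemma ratfun_evalE (K L : fieldType) (i : {rmorphism K -> L}) (a : L)
    (p q : {poly K}) : ~ algebraicOver i a -> q != 0 ->
  ratfun_eval i a (FracField.tofrac p / FracField.tofrac q) =
  (map_poly i p).[a] / (map_poly i q).[a].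
Proof.
move=> tr q0; have nz (u : {poly K}) : u != 0 -> (map_poly i u).[a] != 0.
  by move=> u0; apply/negP => ru; apply: tr; exists u.
rewrite /ratfun_eval; set phi := FracField.tofrac p / _.
set x := repr phi; have d0 : (frac x).2 != 0 by exact: denom_ratioP.
suff E : (frac x).1 * q = p * (frac x).2.
  apply/eqP; rewrite eqr_div ?nz //; apply/eqP.
  by rewrite -!hornerM -!rmorphM E.
apply/eqP; rewrite -(@tofrac_eq {poly K}) !tofracM; apply/eqP.
have Ephi : phi * FracField.tofrac (frac x).2 = FracField.tofrac (frac x).1.
  rewrite -[phi]reprK -/x; unlock FracField.tofrac.
  rewrite !piE; apply/eqP; rewrite /FracField.mulf.
  rewrite piE /= FracField.equivfE.
  by rewrite !numden_Ratio ?mulr1 ?mul1r ?oner_neq0 // mulrC.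
by rewrite -Ephi mulrAC /phi divfK ?tofrac_eq0.
Qed.

(* V_a = {phi in K(X) | v(phi(a)) >= 0}                                        *)
Definition ring_at (K L : fieldType) (v : valuation L)
    (i : {rmorphism K -> L}) (a : L) : {pred ratfun K} :=
  [pred phi | (0 <= v (ratfun_eval i a phi))%E].

(* W = V_a, with a transcendental over K.                                      *)
Definition represents (K L : fieldType) (v : valuation L)
    (i : {rmorphism K -> L}) (w : valuation (ratfun K)) (a : L) : Prop :=
  ~ algebraicOver i a /\ valuation_ring w =i ring_at v i a.

(* Main.v *)
From HB Require Import structures.
From mathcomp Require Import all_boot all_order all_algebra all_field.
From mathcomp Require Import finmap boolp classical_sets functions.
From mathcomp Require Import cardinality constructive_ereal.
From mathcomp Require Import generic_quotient ring_quotient fraction.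
From mathcomp Require Import ring lra zify.
Require Import Defs.

(** Scale w so that it extends v, and let L be the completion of K(X) for w. It is
    a complete discretely valued field whose residue field k_w is algebraic, hence
    separable, over the perfect field k_v.

    The main tool is [isometric_embedding]: a partial isometric isomorphism over K
    between subrings of L and of the complete, algebraically closed field KK
    extends to an isometric embedding of L into KK. A maximal such isomorphism has
    a closed subfield E of L as domain. By Hensel's lemma E has the whole residue
    field of L: the minimal polynomial of a new residue class has a root in L and
    one in KK, and either root generates the same unramified extension of E
    ([maximal_graph_residue]). So L is totally ramified of some finite degree e
    over E, generated by a uniformizer that is a root of an Eisenstein polynomial,
    and such a polynomial has a root of the same value in KK
    ([maximal_graph_total]).

    (1) Starting from the identity of K, the image alpha of X under the embedding
    satisfies w(phi) = v(phi(alpha)) for all phi.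

    Conversely, if W = V_alpha, then evaluation at alpha preserves values, as a
    valuation with values in the rationals is determined by its ring and one
    nonzero value. So it extends to an isometric embedding of L into KK, and
    properties of alpha become properties of X in L.

    (2) If k_w is finite over k_v, then L is finite over the closure of K, by
    successive approximation ([discrete_span]), so that alpha is algebraic over the
    completion of K. If alpha is algebraic of degree d over that completion, then
    d + 1 elements of k_w are linearly dependent over k_v, as a linear relation
    between lifts can be reduced.

    (3) The elements of L whose images in KK are algebraic over the completion of K
    have residue field k_w, by Hensel's lemma. Let S be their closure. Then alpha is
    a polynomial of degree less than e over S in a uniformizer pi with an
    Eisenstein equation of degree e over S. Approximating all coefficients by
    algebraic elements gives a root r of the new equation near pi, and a
    polynomial s in r near alpha. Since the value of r is that of pi, powers of r
    below e separate values, so the values on the field generated by s are values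
    of w; as v(phi(s)) = w(phi) for s near alpha, all values of w occur
    ([algebraic_approximation]). *)

Set Implicit Arguments.
Unset Strict Implicit.
Unset Printing Implicit Defensive.

Import Order.TTheory GRing.Theory Num.Theory.

Local Open Scope ring_scope.
Local Open Scope classical_set_scope.

(** * Values and limits *)

Section Values.
Variables (L : fieldType) (v : valuation L).
Implicit Types (x y : L) (r s : rat).

Lemma val_ltD r x y : (r%:E < v x)%E -> (r%:E < v y)%E -> (r%:E < v (x + y)%R)%E.
Proof.
by move=> hx hy; apply: lt_le_trans (val_geD v x y); rewrite lt_min hx.
Qed.

Lemma val_leD r x y :
  (r%:E <= v x)%E -> (r%:E <= v y)%E -> (r%:E <= v (x + y)%R)%E.
Proof.
by move=> hx hy; apply: le_trans (val_geD v x y); rewrite le_min hx.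
Qed.

Lemma val_ltB r x y : (r%:E < v x)%E -> (r%:E < v y)%E -> (r%:E < v (x - y)%R)%E.
Proof. by move=> hx hy; apply: val_ltD; rewrite ?valN. Qed.

Lemma val_leB r x y :
  (r%:E <= v x)%E -> (r%:E <= v y)%E -> (r%:E <= v (x - y)%R)%E.
Proof. by move=> hx hy; apply: val_leD; rewrite ?valN. Qed.

Lemma val_subC x y : v (x - y) = v (y - x).
Proof. by rewrite -valN opprB. Qed.

Lemma val_leM r s x y : (r%:E <= v x)%E -> (s%:E <= v y)%E ->
  ((r + s)%:E <= v (x * y)%R)%E.
Proof. by move=> hx hy; rewrite valM EFinD leeD. Qed.

Lemma val_ltM r s x y : (r%:E < v x)%E -> (s%:E <= v y)%E ->
  ((r + s)%:E < v (x * y)%R)%E.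
Proof.
move=> hx hy; rewrite valM; case: (v x) hx (val_neqNy v x) => [a| |] //;
case: (v y) hy (val_neqNy v y) => [b| |] //; rewrite ?lee_fin ?lte_fin.
- by move=> sb _ ra _; rewrite ltr_leD.
- by rewrite addey ?ltry.
- by rewrite addye ?ltry.
- by rewrite addye ?ltry.
Qed.

Lemma val_neq0 x r : v x = r%:E -> x != 0.
Proof. by move=> h; apply/eqP => x0; move: h; rewrite x0 val0. Qed.

Lemma valX x r n : v x = r%:E -> v (x ^+ n) = (r *+ n)%:E.
Proof.
move=> h; elim: n => [|n IH]; first by rewrite val1.
by rewrite exprS valM h IH mulrS EFinD.
Qed.

Lemma valXz x r (z : int) : v x = r%:E -> v (x ^ z) = (r *~ z)%:E.
Proof.
move=> h; case: z => n; first exact: valX.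
have /valX h' := h; rewrite NegzE -exprnN valV ?(val_neq0 (h' _)) // h'.
by rewrite mulrNz pmulrn.
Qed.

Lemma val_ge0X x n : (0 <= v x)%E -> (0 <= v (x ^+ n)%R)%E.
Proof.
move=> h; elim: n => [|n IH]; first by rewrite val1.
by rewrite exprS valM adde_ge0.
Qed.

Lemma val_ge0M x y : (0 <= v x)%E -> (0 <= v y)%E -> (0 <= v (x * y)%R)%E.
Proof. by move=> hx hy; rewrite valM adde_ge0. Qed.

Lemma val_gt0M x y : (0 < v x)%E -> (0 <= v y)%E -> (0 < v (x * y)%R)%E.
Proof. by move=> hx hy; have := @val_ltM 0 0 x y hx hy; rewrite addr0. Qed.

Lemma val_ge0Mn x n : (0 <= v x)%E -> (0 <= v (x *+ n)%R)%E.
Proof.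
move=> hx; elim: n => [|n IH]; first by rewrite val0 leey.
by rewrite mulrS; apply: val_leD.
Qed.

Lemma val_gt0Mn x n : (0 < v x)%E -> (0 < v (x *+ n)%R)%E.
Proof.
move=> hx; elim: n => [|n IH]; first by rewrite val0 ltry.
by rewrite mulrS; apply: val_ltD.
Qed.

Lemma val_eqD x y : (v x < v y)%E -> v (x + y) = v x.
Proof.
move=> h; apply/eqP; rewrite eq_le; apply/andP; split; last first.
  by apply: le_trans (val_geD v x y); rewrite le_min lexx ltW.
rewrite leNgt; apply/negP => h'.
have : (mine (v (x + y)%R) (v (- y)%R) <= v x)%E.
  by apply: le_trans (val_geD v (x + y) (- y)) _; rewrite addrK.
by rewrite valN ge_min !leNgt h' h.
Qed.

Lemma val_eqB x y : (v x < v (x - y)%R)%E -> v y = v x.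
Proof.
move=> h; rewrite [in LHS](_ : y = x + - (x - y)); last by ring.
by rewrite val_eqD ?valN.
Qed.

Lemma val_lt_sum (I : Type) (r : seq I) (P : pred I) (F : I -> L) a :
  (forall i, P i -> (a%:E < v (F i))%E) -> (a%:E < v (\sum_(i <- r | P i) F i)%R)%E.
Proof.
move=> h; elim/big_ind: _ => //; first by rewrite val0 ltry.
by move=> x y; apply: val_ltD.
Qed.

Lemma val_le_sum (I : Type) (r : seq I) (P : pred I) (F : I -> L) a :
  (forall i, P i -> (a%:E <= v (F i))%E) ->
  (a%:E <= v (\sum_(i <- r | P i) F i)%R)%E.
Proof.
move=> h; elim/big_ind: _ => //; first by rewrite val0 leey.
by move=> x y; apply: val_leD.
Qed.

Lemma val_unbounded x : (forall r, (r%:E <= v x)%E) -> x = 0.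
Proof.
move=> h; apply/eqP; apply: contraT => /(val_fin v) [r e].
by have := h (r + 1); rewrite e lee_fin gerDl ler10.
Qed.

Lemma val_unbounded_lt x : (forall r, (r%:E < v x)%E) -> x = 0.
Proof. by move=> h; apply: val_unbounded => r; apply: ltW. Qed.

Lemma val_argmin n (F : 'I_n.+1 -> L) : exists i, forall j, (v (F i) <= v (F j))%E.
Proof.
elim: n F => [|n IH] F.
  by exists ord0 => j; rewrite (ord1 j).
have [i hi] := IH (fun j => F (lift ord0 j)).
have [h|h] := leP (v (F ord0)) (v (F (lift ord0 i))).
  exists ord0 => j; have [k ->|->] := unliftP ord0 j => //.
  exact: le_trans h (hi k).
exists (lift ord0 i) => j; have [k ->|->] := unliftP ord0 j => //.
exact: ltW.
Qed.

(** When the nonzero terms have pairwise distinct values, no cancellation is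
    possible and the sum has the least of these values. *)
Lemma val_sum_distinct n (F : 'I_n.+1 -> L) :
  (forall i j, i != j -> F i != 0 -> v (F i) != v (F j)) ->
  exists i, v (\sum_j F j) = v (F i) /\ forall j, (v (F i) <= v (F j))%E.
Proof.
move=> hd; have [i hi] := val_argmin F; exists i; split=> //.
have [F0|F0] := eqVneq (F i) 0.
  rewrite big1 ?F0 // => j _; apply/eqP; rewrite -(val_eqy v).
  by have := hi j; rewrite F0 val0 leye_eq.
rewrite (bigD1 i) //= val_eqD //.
have [r er] := val_fin v F0; rewrite er.
apply: val_lt_sum => j ji; rewrite -er lt_neqAle hi andbT.
by apply: hd => //; rewrite eq_sym.
Qed.

End Values.

Section Limits.
Variables (L : fieldType) (v : valuation L).
Implicit Types (s t : nat -> L) (x y l m : L).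

Lemma val_cvg_cst x : val_cvg v (fun=> x) x.
Proof. by move=> r; exists 0%N => n _; rewrite subrr val0 ltry. Qed.

Lemma val_cvgD s t l m :
  val_cvg v s l -> val_cvg v t m -> val_cvg v (fun n => s n + t n) (l + m).
Proof.
move=> hs ht r; have [N hN] := hs r; have [M hM] := ht r.
exists (maxn N M) => n; rewrite geq_max => /andP[nN nM].
by rewrite opprD addrACA; apply: val_ltD; [apply: hN|apply: hM].
Qed.

Lemma val_cvgN s l : val_cvg v s l -> val_cvg v (fun n => - s n) (- l).
Proof.
by move=> hs r; have [N hN] := hs r; exists N => n /hN; rewrite -opprD valN.
Qed.

Lemma val_cvgB s t l m :
  val_cvg v s l -> val_cvg v t m -> val_cvg v (fun n => s n - t n) (l - m).
Proof. by move=> hs ht; apply/val_cvgD/val_cvgN. Qed.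

Lemma val_bound x : exists r : rat, (r%:E <= v x)%E.
Proof.
have [->|/(val_fin v)[r ->]] := eqVneq x 0; last by exists r.
by exists 0; rewrite val0 leey.
Qed.

Lemma val_cvg_bound s l : val_cvg v s l ->
  exists (r : rat) N, forall n, (N <= n)%N -> (r%:E <= v (s n))%E.
Proof.
move=> hs; have [r hr] := val_bound l; have [N hN] := hs r.
exists r, N => n /hN h; rewrite -(subrK l (s n)); apply: val_leD => //.
exact: ltW.
Qed.

Lemma val_cvgM s t l m :
  val_cvg v s l -> val_cvg v t m -> val_cvg v (fun n => s n * t n) (l * m).
Proof.
move=> hs ht r; have [a [N hN]] := val_cvg_bound hs.
have [b hb] := val_bound m.
have [N1 hN1] := hs (r - b); have [N2 hN2] := ht (r - a).
exists (maxn N (maxn N1 N2)) => n; rewrite !geq_max => /and3P[h h1 h2].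
have -> : s n * t n - l * m = (t n - m) * s n + (s n - l) * m by ring.
apply: val_ltD; [rewrite -(subrK a r)|rewrite -(subrK b r)]; apply: val_ltM => //.
- exact: hN2.
- exact: hN.
- exact: hN1.
Qed.

Lemma val_cvg_uniq s l m : val_cvg v s l -> val_cvg v s m -> l = m.
Proof.
move=> hl hm; apply/eqP; rewrite -subr_eq0; apply/eqP.
apply: (@val_unbounded_lt _ v) => r.
have [N hN] := hl r; have [M hM] := hm r.
have -> : l - m = (s (N + M)%N - m) - (s (N + M)%N - l) by ring.
by apply: val_ltB; [apply: hM; rewrite leq_addl|apply: hN; rewrite leq_addr].
Qed.

Lemma val_cvg_eq s t l : (forall n, s n = t n) -> val_cvg v s l -> val_cvg v t l.
Proof. by move=> h hs r; have [N hN] := hs r; exists N => n /hN; rewrite h. Qed.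

Lemma val_cvg_sum (I : Type) (e : seq I) (P : pred I) (s : nat -> I -> L)
    (l : I -> L) : (forall i, val_cvg v (s ^~ i) (l i)) ->
  val_cvg v (fun n => \sum_(i <- e | P i) s n i) (\sum_(i <- e | P i) l i).
Proof.
move=> h; elim: e => [|i e IH].
  by apply: (@val_cvg_eq (fun=> 0)); [move=> n|]; rewrite !big_nil //; exact: val_cvg_cst.
apply: (@val_cvg_eq (fun n => (if P i then s n i else 0) + \sum_(i <- e | P i) s n i)).
  by move=> n; rewrite big_cons; case: ifP; rewrite ?add0r.
rewrite big_cons; case: (P i); first exact: val_cvgD.
rewrite -[X in val_cvg _ _ X]add0r; apply: val_cvgD => //; exact: val_cvg_cst.
Qed.

Lemma val_cvg_horner (p : {poly L}) s l :
  val_cvg v s l -> val_cvg v (fun n => p.[s n]) p.[l].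
Proof.
move=> hs; elim/poly_ind: p => [|p c IH].
  by apply: (@val_cvg_eq (fun=> 0)); [move=> n|]; rewrite horner0 //; exact: val_cvg_cst.
apply: (@val_cvg_eq (fun n => p.[s n] * s n + c)).
  by move=> n; rewrite hornerMXaddC.
rewrite hornerMXaddC; apply: val_cvgD; [exact: val_cvgM|exact: val_cvg_cst].
Qed.

Lemma val_cvg_val s l : val_cvg v s l -> l != 0 ->
  exists N, forall n, (N <= n)%N -> v (s n) = v l.
Proof.
move=> hs /(val_fin v)[r er]; have [N hN] := hs r; exists N => n /hN h.
by apply: val_eqB; rewrite val_subC er.
Qed.

Lemma val_cvg0 s : val_cvg v s 0 ->
  forall r : rat, exists N, forall n, (N <= n)%N -> (r%:E < v (s n))%E.
Proof. by move=> hs r; have [N hN] := hs r; exists N => n /hN; rewrite subr0. Qed.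

Lemma val_cvg_ge (r : rat) s l : val_cvg v s l ->
  (forall n, (r%:E <= v (s n))%E) -> (r%:E <= v l)%E.
Proof.
move=> hs h; have [N hN] := hs r.
have -> : l = s N - (s N - l) by ring.
by apply: val_leB => //; apply/ltW/hN.
Qed.

Lemma val_cauchy_bound s : val_cauchy v s ->
  exists (r : rat) N, forall n, (N <= n)%N -> (r%:E <= v (s n))%E.
Proof.
move=> hs; have [N hN] := hs 0; have [a ha] := val_bound (s N).
exists (Num.min 0 a), N => n hn; rewrite -(subrK (s N) (s n)); apply: val_leD.
  by apply/ltW/(le_lt_trans _ (hN _ _ hn (leqnn N))); rewrite lee_fin ge_min lexx.
by apply: le_trans ha; rewrite lee_fin ge_min lexx orbT.
Qed.

Lemma val_cvg_cauchy s l : val_cvg v s l -> val_cauchy v s.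
Proof.
move=> hs r; have [N hN] := hs r; exists N => m n /hN hm /hN hn.
have -> : s m - s n = (s m - l) - (s n - l) by ring.
exact: val_ltB.
Qed.

(** By the ultrametric inequality, increments tending to 0 suffice. *)
Lemma val_cauchy_incr s :
  (forall r : rat, exists N, forall n, (N <= n)%N -> (r%:E < v (s n.+1 - s n)%R)%E) ->
  val_cauchy v s.
Proof.
move=> h r; have [N hN] := h r; exists N.
suff H n : (N <= n)%N -> (r%:E < v (s n - s N)%R)%E.
  move=> m n /H hm /H hn; have -> : s m - s n = (s m - s N) - (s n - s N) by ring.
  exact: val_ltB.
elim: n => [|n IH]; first by rewrite leqn0 => /eqP->; rewrite subrr val0 ltry.
rewrite leq_eqVlt => /predU1P[<-|]; first by rewrite subrr val0 ltry.
rewrite ltnS => hn; have -> : s n.+1 - s N = (s n.+1 - s n) + (s n - s N) by ring.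
by apply: val_ltD; [apply: hN|apply: IH].
Qed.

Lemma natmul_unbounded (g r b : rat) : 0 < g ->
  exists N, forall n, (N <= n)%N -> r < b + g *+ n.
Proof.
move=> g0; exists (Num.bound `|(r - b) / g|) => n hn.
rewrite -ltrBlDl -mulr_natr -ltr_pdivrMl // mulrC.
apply: le_lt_trans (ler_norm _) _.
apply: lt_le_trans (archi_boundP (normr_ge0 _)) _.
by rewrite ler_nat.
Qed.

Lemma val_cvg_approx s l :
  (forall n : nat, ((n%:R : rat)%:E < v (l - s n)%R)%E) -> val_cvg v s l.
Proof.
move=> h r; have [N hN] := @natmul_unbounded 1 r 0 ltr01.
exists N => n /hN; rewrite add0r => hn; rewrite val_subC.
by apply: lt_trans (h n); rewrite lte_fin.
Qed.

End Limits.

(** * The completion of a valued field *)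

Section Completion.
Variables (F : fieldType) (w : valuation F).

Definition cauchy_seq : {pred nat -> F} := [pred s | `[< val_cauchy w s >]].

Fact cauchy_seq_subring : subring_closed cauchy_seq.
Proof.
split=> [|s t|s t]; rewrite !inE.
- by move=> r; exists 0%N => m n _ _; rewrite subrr val0 ltry.
- move=> hs ht r; have [N hN] := hs r; have [M hM] := ht r.
  exists (maxn N M) => m n; rewrite !geq_max => /andP[m1 m2] /andP[n1 n2].
  have -> : (s - t) m - (s - t) n = (s m - s n) - (t m - t n).
    by rewrite !fctE; ring.
  by apply: val_ltB; [apply: hN|apply: hM].
- move=> hs ht.
  have [a [N hN]] := val_cauchy_bound hs; have [b [M hM]] := val_cauchy_bound ht.
  move=> r; have [N' hN'] := hs (r - b); have [M' hM'] := ht (r - a).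
  exists (maxn (maxn N M) (maxn N' M')) => m n.
  rewrite !geq_max => /andP[/andP[m1 m2] /andP[m3 m4]].
  move=> /andP[/andP[n1 n2] /andP[n3 n4]].
  have -> : (s * t) m - (s * t) n = (s m - s n) * t m + (t m - t n) * s n.
    by rewrite !fctE; ring.
  apply: val_ltD; [rewrite -(subrK b r)|rewrite -(subrK a r)]; apply: val_ltM.
  - exact: hN'.
  - exact: hM.
  - exact: hM'.
  - exact: hN.
Qed.
HB.instance Definition _ :=
  GRing.isSubringClosed.Build (nat -> F) cauchy_seq cauchy_seq_subring.

Record cseq := Cseq { cseq_val :> nat -> F; _ : cseq_val \in cauchy_seq }.
HB.instance Definition _ := [isSub for cseq_val].
HB.instance Definition _ := [Choice of cseq by <:].
HB.instance Definition _ := [SubChoice_isSubComNzRing of cseq by <:].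

Lemma cseqP (s : cseq) : val_cauchy w s.
Proof. by case: s => s /=; rewrite inE. Qed.

Definition null_seq : {pred cseq} := [pred s : cseq | `[< val_cvg w s 0 >]].

Fact null_seq_ideal : idealr_closed null_seq.
Proof.
split=> [||a x y]; rewrite !inE.
- exact: (val_cvg_cst w 0).
- apply/negP; rewrite inE => h; have [N hN] := h 0.
  have := hN N (leqnn N).
  have -> : (1 : cseq) N - 0 = 1 by rewrite subr0.
  by rewrite val1 ltxx.
- move=> hx hy; change (val_cvg w (fun n => a n * x n + y n) 0).
  have [b [N hN]] := val_cauchy_bound (cseqP a).
  move=> r; have [M hM] := val_cvg0 hx (r - b); have [M' hM'] := val_cvg0 hy r.
  exists (maxn N (maxn M M')) => n; rewrite !geq_max => /and3P[h h1 h2].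
  rewrite subr0; apply: val_ltD; last exact: hM'.
  by rewrite -(subrK b r) mulrC; apply: val_ltM; [apply: hM|apply: hN].
Qed.
HB.instance Definition _ := isIdealr.Build cseq null_seq null_seq_ideal.

Definition completion := {ideal_quot null_seq}.
HB.instance Definition _ := GRing.ComNzRing.on completion.

Definition cpi (s : cseq) : completion := \pi_{ideal_quot null_seq}%qT s.

Lemma cpi_eq (s t : cseq) : cpi s = cpi t <-> val_cvg w (fun n => s n - t n) 0.
Proof.
have E : (cpi s == cpi t) = (s - t \in null_seq) by rewrite (@Quotient.idealrBE _ null_seq).
split=> [/eqP|h]; first by rewrite E inE.
by apply/eqP; rewrite E inE.
Qed.

Lemma cpiM s t : cpi (s * t) = cpi s * cpi t.
Proof. by rewrite /cpi rmorphM. Qed.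
Lemma cpiD s t : cpi (s + t) = cpi s + cpi t.
Proof. by rewrite /cpi rmorphD. Qed.
Lemma cpiN s : cpi (- s) = - cpi s.
Proof. by rewrite /cpi rmorphN. Qed.
Lemma cpi1 : cpi 1 = 1.
Proof. by rewrite /cpi rmorph1. Qed.
Lemma cpi0 : cpi 0 = 0.
Proof. by rewrite /cpi rmorph0. Qed.
Lemma cpi_repr (c : completion) : cpi (repr c) = c.
Proof. exact: reprK. Qed.

Lemma cpi_eq0 (s : cseq) : cpi s = 0 <-> val_cvg w s 0.
Proof.
rewrite -cpi0 cpi_eq; split; apply: val_cvg_eq => n; [exact: subr0|].
exact/esym/subr0.
Qed.

(** Two terms close to each other relative to the value of one of them have the
    same value, and the values of a sequence that does not tend to 0 are
    infinitely often below some bound. *)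
Lemma cseq_val_stable (s : cseq) : ~ val_cvg w s 0 ->
  exists (r : rat) N, forall n, (N <= n)%N -> w (s n) = r%:E.
Proof.
move=> /asboolPn hs; have : exists r : rat, forall N, exists2 n, (N <= n)%N & ~ (r%:E < w (s n))%E.
  apply: contrapT => h; apply: (negP hs); apply/asboolP => r.
  apply: contrapT => h'; apply: h; exists r => N; apply: contrapT => h''.
  apply: h'; exists N => n hn; rewrite subr0; apply: contrapT => h3.
  by apply: h''; exists n.
move=> [r hr]; have [N hN] := cseqP s r; have [m hm /negP] := hr N.
rewrite -leNgt => hmr; have m0 : s m != 0.
  by apply/eqP => e; move: hmr; rewrite e val0.
have [a ea] := val_fin w m0; exists a, N => n hn; rewrite -ea.
apply: val_eqB; rewrite val_subC; apply: le_lt_trans hmr _; exact: hN.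
Qed.

Lemma cpi_neq0 (s : cseq) : cpi s != 0 ->
  exists (r : rat) N, forall n, (N <= n)%N -> w (s n) = r%:E.
Proof.
by move=> /eqP h; apply: cseq_val_stable => /cpi_eq0.
Qed.

(* For a sequence tending to 0 the inverse is the junk value 0; for the others
   the terms equal to 0 are finitely many, so 0^-1 = 0 is harmless. *)
Fact cinv_subproof (s : cseq) :
  (if cpi s == 0 then 0 else (fun n => (s n)^-1)) \in cauchy_seq.
Proof.
case: ifPn => [_|/cpi_neq0 [r [N hN]]].
  by rewrite inE => r; exists 0%N => m n _ _; rewrite subrr val0 ltry.
rewrite inE => a; have [M hM] := cseqP s (a + (r + r)).
exists (maxn N M) => m n; rewrite !geq_max => /andP[m1 m2] /andP[n1 n2].
have /val_neq0 m0 := hN _ m1; have /val_neq0 n0 := hN _ n1.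
have -> : (s m)^-1 - (s n)^-1 = (s n - s m) * ((s m)^-1 * (s n)^-1).
  by field; rewrite m0 n0.
have -> : a = (a + (r + r)) + (- r - r) by ring.
apply: val_ltM; first exact: hM.
by apply: val_leM; rewrite valV // hN.
Qed.
Definition cinv (s : cseq) : cseq := Cseq (cinv_subproof s).

Definition completion_inv (c : completion) : completion := cpi (cinv (repr c)).

Fact completion_mulVf c : c != 0 -> completion_inv c * c = 1.
Proof.
rewrite /completion_inv; have := cpi_repr c; move: (repr c) => s <- s0.
rewrite -cpi1 -cpiM; apply/cpi_eq => r.
have [a [N hN]] := cpi_neq0 s0; exists N => n hn.
change (r%:E < w ((if cpi s == 0 then 0 else fun n => (s n)^-1) n * s n - 1 - 0)%R)%E.
by rewrite (negPf s0) mulVf ?(val_neq0 (hN _ hn)) // subr0 subrr val0 ltry.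
Qed.

Fact completion_inv0 : completion_inv 0 = 0.
Proof.
apply/cpi_eq0; rewrite /cinv /= cpi_repr eqxx; exact: val_cvg_cst.
Qed.

HB.instance Definition _ :=
  GRing.ComNzRing_isField.Build completion completion_mulVf completion_inv0.

(** The eventual value of w along s. Along a sequence tending to 0 there is no
    eventual finite value, and the default is the right answer. *)
Definition cval (s : cseq) : \bar rat :=
  xget +oo%E [set a | exists N, forall n, (N <= n)%N -> w (s n) = a].

Lemma cvalE (s : cseq) a N : (forall n, (N <= n)%N -> w (s n) = a) -> cval s = a.
Proof.
move=> h; apply: xget_unique; first by exists N.
move=> b [M hM]; rewrite -(h (maxn N M)) ?leq_maxl // hM //; exact: leq_maxr.
Qed.

Lemma cval_null (s : cseq) : val_cvg w s 0 -> cval s = +oo%E.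
Proof.
move=> hs; rewrite /cval; case: xgetP => // -[r| |] _ [N hN] //.
  have [M hM] := hs r; have := hM (maxn N M) (leq_maxr _ _).
  by rewrite subr0 hN ?leq_maxl // ltxx.
by have := val_neqNy w (s N); rewrite hN.
Qed.

Lemma cval_fin (s : cseq) : cpi s != 0 ->
  exists r : rat, cval s = r%:E /\ exists N, forall n, (N <= n)%N -> w (s n) = r%:E.
Proof.
move=> /cpi_neq0[r [N hN]]; exists r; split; last by exists N.
exact: cvalE hN.
Qed.

Definition completion_val (c : completion) : \bar rat := cval (repr c).

Lemma cval_cpi (s : cseq) : completion_val (cpi s) = cval s.
Proof.
have E : cpi (repr (cpi s)) = cpi s by rewrite cpi_repr.
rewrite /completion_val; have [s0|s0] := eqVneq (cpi s) 0.
  by rewrite !cval_null //; apply/cpi_eq0; rewrite // E.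
have [r [-> [N hN]]] := cval_fin s0.
have /cpi_eq h := esym E; have [M hM] := val_cvg0 h r.
apply: (@cvalE _ _ (maxn N M)) => n; rewrite geq_max => /andP[n1 n2].
by rewrite -(hN _ n1); apply: val_eqB; rewrite (hN _ n1); apply: hM.
Qed.

Fact completion_val_eqy c : (completion_val c == +oo%E) = (c == 0).
Proof.
rewrite -[c]cpi_repr cval_cpi; apply/eqP/eqP => [h|/cpi_eq0/cval_null//].
by apply/eqP; apply: contraT => /cval_fin[r [e _]]; move: h; rewrite e.
Qed.

Fact completion_val_neqNy c : completion_val c != -oo%E.
Proof.
rewrite -[c]cpi_repr cval_cpi.
have [/cpi_eq0/cval_null->//|/cval_fin[r [-> _]] //] := eqVneq (cpi (repr c)) 0.
Qed.

Fact completion_valM c d :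
  completion_val (c * d) = (completion_val c + completion_val d)%E.
Proof.
have [->|c0] := eqVneq c 0.
  rewrite mul0r; have /eqP-> : completion_val 0 == +oo%E by rewrite completion_val_eqy.
  by rewrite addye // completion_val_neqNy.
have [->|d0] := eqVneq d 0.
  rewrite mulr0; have /eqP-> : completion_val 0 == +oo%E by rewrite completion_val_eqy.
  by rewrite addey // completion_val_neqNy.
rewrite -[c]cpi_repr -[d]cpi_repr in c0 d0 *; rewrite -cpiM !cval_cpi.
have [r [-> [N hN]]] := cval_fin c0; have [s [-> [M hM]]] := cval_fin d0.
apply: (@cvalE _ _ (maxn N M)) => n; rewrite geq_max => /andP[n1 n2].
by rewrite -(hN _ n1) -(hM _ n2) -valM.
Qed.

Lemma completion_val_ge (r : rat) (s : cseq) N :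
  (forall n, (N <= n)%N -> (r%:E <= w (s n))%E) -> (r%:E <= completion_val (cpi s))%E.
Proof.
move=> h; rewrite cval_cpi.
have [/cpi_eq0/cval_null->|/cval_fin[a [-> [M hM]]]] := eqVneq (cpi s) 0.
  by rewrite leey.
by rewrite -(hM (maxn N M)) ?leq_maxr // h ?leq_maxl.
Qed.

Lemma completion_val_gt (r : rat) (s : cseq) N :
  (forall n, (N <= n)%N -> (r%:E < w (s n))%E) -> (r%:E < completion_val (cpi s))%E.
Proof.
move=> h; rewrite cval_cpi.
have [/cpi_eq0/cval_null->|/cval_fin[a [-> [M hM]]]] := eqVneq (cpi s) 0.
  by rewrite ltry.
by rewrite -(hM (maxn N M)) ?leq_maxr // h ?leq_maxl.
Qed.

Fact completion_val_geD c d :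
  (mine (completion_val c) (completion_val d) <= completion_val (c + d)%R)%E.
Proof.
have [->|c0] := eqVneq c 0; first by rewrite add0r ge_min lexx orbT.
have [->|d0] := eqVneq d 0; first by rewrite addr0 ge_min lexx.
rewrite -[c]cpi_repr -[d]cpi_repr in c0 d0 *; rewrite -cpiD 2!cval_cpi.
have [r [-> [N hN]]] := cval_fin c0; have [s [-> [M hM]]] := cval_fin d0.
rewrite -EFin_min; apply: (@completion_val_ge _ _ (maxn N M)) => n.
rewrite geq_max => /andP[n1 n2].
by rewrite EFin_min -(hN _ n1) -(hM _ n2); apply: val_geD.
Qed.

Definition completion_valuation : valuation completion :=
  Valuation completion_val_eqy completion_val_neqNy completion_valM
    completion_val_geD.

Fact cst_cauchy (x : F) : (fun=> x) \in cauchy_seq.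
Proof. by rewrite inE; apply/val_cvg_cauchy/val_cvg_cst. Qed.
Definition cembed (x : F) : completion := cpi (Cseq (cst_cauchy x)).

Fact cembed_nmod : nmod_morphism cembed.
Proof.
split=> [|x y]; first by apply/cpi_eq0/val_cvg_cst.
by rewrite /cembed -cpiD; congr cpi; apply/val_inj.
Qed.
Fact cembed_monoid : monoid_morphism cembed.
Proof.
split=> [|x y]; first by rewrite -cpi1; congr cpi; apply/val_inj.
by rewrite /cembed -cpiM; congr cpi; apply/val_inj.
Qed.
HB.instance Definition _ := GRing.isNmodMorphism.Build F completion cembed cembed_nmod.
HB.instance Definition _ := GRing.isMonoidMorphism.Build F completion cembed cembed_monoid.

Lemma cembed_val x : completion_valuation (cembed x) = w x.
Proof. by rewrite /= cval_cpi; apply: (@cvalE _ _ 0%N). Qed.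

Lemma cembed_approx (s : cseq) (r : rat) :
  exists N, forall n, (N <= n)%N -> (r%:E < completion_valuation (cpi s - cembed (s n))%R)%E.
Proof.
have [N hN] := cseqP s r; exists N => n hn.
rewrite /cembed -cpiN -cpiD; apply: (@completion_val_gt _ _ N) => m hm.
exact: hN.
Qed.

Lemma cembed_dense (c : completion) (r : rat) :
  exists x, (r%:E < completion_valuation (c - cembed x)%R)%E.
Proof.
rewrite -[c]cpi_repr; have [N hN] := cembed_approx (repr c) r.
by exists ((repr c : cseq) N); apply: hN.
Qed.

Lemma completion_cauchy_cvg (s : nat -> completion) :
  val_cauchy completion_valuation s -> exists l, val_cvg completion_valuation s l.
Proof.
move=> hs.
have /choice[a ha] : forall n, exists x,
    ((n%:R : rat)%:E < completion_valuation (s n - cembed x)%R)%E.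
  by move=> n; apply: cembed_dense.
have h r : exists N, forall n, (N <= n)%N -> (r%:E < completion_valuation (s n - cembed (a n))%R)%E.
  have [N hN] := @natmul_unbounded 1 r 0 ltr01; exists N => n /hN; rewrite add0r => hn.
  by apply: lt_trans (ha n); rewrite lte_fin.
have ca : val_cauchy w a.
  move=> r; have [N hN] := hs r; have [M hM] := h r.
  exists (maxn N M) => m n; rewrite !geq_max => /andP[m1 m2] /andP[n1 n2].
  rewrite -cembed_val rmorphB.
  have -> : cembed (a m) - cembed (a n) =
    (s m - s n) - (s m - cembed (a m)) + (s n - cembed (a n)) by ring.
  by apply: val_ltD; [apply: val_ltB; [apply: hN|apply: hM]|apply: hM].
have ca' : a \in cauchy_seq by rewrite inE.
exists (cpi (Cseq ca')) => r.
have [N hN] := cembed_approx (Cseq ca') r; have [M hM] := h r.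
exists (maxn N M) => n; rewrite !geq_max => /andP[n1 n2].
have -> : s n - cpi (Cseq ca') =
   (s n - cembed (a n)) - (cpi (Cseq ca') - cembed (a n)) by ring.
by apply: val_ltB; [apply: hM|apply: hN].
Qed.

End Completion.

Theorem completion_exists (F : fieldType) (w : valuation F) :
  exists (L : fieldType) (wL : valuation L) (i : {rmorphism F -> L}),
    is_completion w wL i.
Proof.
exists (completion w), (completion_valuation w), (@cembed F w); split.
- exact: cembed_val.
- exact: cembed_dense.
- exact: completion_cauchy_cvg.
Qed.

(** * Polynomials with coefficients in a valuation ring *)

Section MonicMinusLow.
Variables (R : comNzRingType) (e : nat).
Implicit Types (q : {poly R}) (c : 'I_e -> R).

Lemma size_sum_low c : (size (\sum_(i < e) (c i)%:P * 'X^i)%R <= e)%N.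
Proof.
apply: (leq_trans (size_sum _ _ _)); apply/bigmax_leqP => i _.
apply: leq_trans (ltn_ord i); rewrite mul_polyC.
by rewrite (leq_trans (size_scale_leq _ _)) // size_polyXn.
Qed.

Lemma horner_sum_low c x : (\sum_(i < e) (c i)%:P * 'X^i).[x] = \sum_(i < e) c i * x ^+ i.
Proof.
by rewrite horner_sum; apply: eq_bigr => i _; rewrite hornerM hornerC hornerXn.
Qed.

Lemma map_sum_low (S : comNzRingType) (f : {rmorphism R -> S}) c :
  map_poly f (\sum_(i < e) (c i)%:P * 'X^i) = \sum_(i < e) (f (c i))%:P * 'X^i.
Proof.
rewrite rmorph_sum; apply: eq_bigr => i _.
by rewrite rmorphM /= map_polyC map_polyXn.
Qed.

Lemma size_XnBlow q : (size q <= e)%N -> size ('X^e - q) = e.+1.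
Proof. by move=> sq; rewrite size_polyDl size_polyXn // size_polyN ltnS. Qed.

Lemma monic_XnBlow q : (size q <= e)%N -> 'X^e - q \is monic.
Proof.
by move=> sq; rewrite monicE lead_coefDl ?lead_coefXn // size_polyXn size_polyN ltnS.
Qed.

End MonicMinusLow.

Section IntegralPolynomials.
Variables (L : fieldType) (v : valuation L).
Implicit Types (p q : {poly L}) (x y h : L).

Definition integral_poly p := forall i, (0 <= v p`_i)%E.

Lemma poly_val_gt (r : rat) p x :
  (forall i, (r%:E < v p`_i)%E) -> (0 <= v x)%E -> (r%:E < v p.[x])%E.
Proof.
move=> hp hx; rewrite horner_coef; apply: val_lt_sum => i _.
by rewrite -[r]addr0; apply: val_ltM => //; apply: val_ge0X.
Qed.

Lemma integral_poly_horner p x : integral_poly p -> (0 <= v x)%E -> (0 <= v p.[x])%E.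
Proof.
move=> hp hx; rewrite horner_coef; apply: val_le_sum => i _.
by apply: val_ge0M => //; apply: val_ge0X.
Qed.

Lemma integral_poly_deriv p : integral_poly p -> integral_poly p^`().
Proof. by move=> hp i; rewrite coef_deriv; apply: val_ge0Mn. Qed.

Lemma integral_polyMXaddC p c : integral_poly (p * 'X + c%:P) -> integral_poly p /\ (0 <= v c)%E.
Proof.
move=> h; split; last by have := h 0%N; rewrite coefD coefMX coefC /= add0r.
by move=> i; have := h i.+1; rewrite coefD coefMX coefC /= addr0.
Qed.

(** The error term is quadratic in h, which makes Newton iteration converge. *)
Lemma integral_poly_taylor p x h : integral_poly p -> (0 <= v x)%E -> (0 <= v h)%E ->
  exists q : L, (0 <= v q)%E /\ p.[x + h] = p.[x] + h * p^`().[x] + h ^+ 2 * q.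
Proof.
move=> hp hx hh; elim/poly_ind: p hp => [|p c IH] hp.
  by exists 0; rewrite deriv0 !horner0 val0 leey; split=> //; ring.
have [ip _] := integral_polyMXaddC hp; have [q [q0 e]] := IH ip.
exists (p^`().[x] + q * (x + h)); split.
  apply: val_leD; last by apply: val_ge0M => //; apply: val_leD.
  by apply: integral_poly_horner => //; exact: integral_poly_deriv.
rewrite derivD derivM derivX derivC !hornerE e; ring.
Qed.

Lemma integral_poly_sub p x y (r : rat) : integral_poly p -> (0 <= v x)%E -> (0 <= v y)%E ->
  (r%:E < v (x - y)%R)%E -> (r%:E < v (p.[x] - p.[y])%R)%E.
Proof.
move=> hp hx hy h; elim/poly_ind: p hp => [|p c IH] hp.
  by rewrite !horner0 subrr val0 ltry.
have [ip _] := integral_polyMXaddC hp.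
rewrite !hornerMXaddC.
have -> : p.[x] * x + c - (p.[y] * y + c) = (p.[x] - p.[y]) * x + (x - y) * p.[y].
  by ring.
by apply: val_ltD; rewrite -[r]addr0; apply: val_ltM; rewrite ?IH ?integral_poly_horner.
Qed.

(** Valuation rings are integrally closed: at an x of negative value the leading
    term would dominate. *)
Lemma integral_poly_root_ge0 p x : p \is monic -> integral_poly p -> root p x -> (0 <= v x)%E.
Proof.
move=> mp ip rx; rewrite leNgt; apply/negP => hx.
have x0 : x != 0 by apply/eqP => e; move: hx; rewrite e val0.
have [r er] := val_fin v x0; move: hx; rewrite er lte_fin => r0.
have sp : (0 < size p)%N by rewrite size_poly_gt0 monic_neq0.
have : v (x ^+ (size p).-1) = v (- (\sum_(i < (size p).-1) p`_i * x ^+ i)).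
  congr (v _); apply/eqP; rewrite -addr_eq0 addrC.
  move: rx (monicP mp); rewrite rootE lead_coefE horner_coef; case: (size p) sp => // n _ /=.
  by rewrite big_ord_recr /= => /[swap] ->; rewrite mul1r.
apply/eqP; rewrite eq_sym gt_eqF // valN (valX _ er).
apply: val_lt_sum => i _.
rewrite valM (valX _ er); have [->|/(val_fin v)[a ea]] := eqVneq (p`_i) 0.
  by rewrite val0 addye // ltry.
rewrite ea lte_fin; have := ip i; rewrite ea lee_fin => a0.
have hlt : r *+ (size p).-1 < r *+ i.
  by rewrite -!(mulr_natr r) ltr_nM2l // ltr_nat.
by apply: lt_le_trans hlt _; rewrite lerDr.
Qed.

Lemma integral_poly_map (K : fieldType) (vK : valuation K) (i : {rmorphism K -> L}) :
  val_extends vK v i -> forall p : {poly K}, (forall j, (0 <= vK p`_j)%E) ->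
  integral_poly (map_poly i p).
Proof. by move=> h p hp j; rewrite coef_map /= h. Qed.

Hypothesis complete : forall s, val_cauchy v s -> exists l, val_cvg v s l.

(** Newton iteration. The values of p at the iterates double at each step, but
    linear growth is enough for convergence and easier to carry through. *)
Lemma hensel p x : integral_poly p -> (0 <= v x)%E -> (0 < v p.[x])%E ->
  v p^`().[x] = 0%E -> exists y, p.[y] = 0 /\ (0 < v (y - x)%R)%E.
Proof.
move=> ip hx hpx hdx; have [p0|p0] := eqVneq p.[x] 0.
  by exists x; rewrite p0 subrr val0.
have [d ed] := val_fin v p0; move: hpx; rewrite ed lte_fin => d0.
have idp := integral_poly_deriv ip.
pose step y := y - p.[y] / p^`().[y]; pose s n := iter n step x.
have H n : [/\ (0 <= v (s n))%E, v p^`().[s n] = 0%E,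
    ((d *+ n.+1)%:E <= v p.[s n])%E & (d%:E <= v (s n - x)%R)%E].
  elim: n => [|n [h1 h2 h3 h4]].
    by split=> //=; rewrite ?mulr1n ?ed // subrr val0 leey.
  set y := s n in h1 h2 h3 h4.
  have y0 : p^`().[y] != 0 by apply: val_neq0 h2.
  pose h := - (p.[y] / p^`().[y]).
  have hh : ((d *+ n.+1)%:E <= v h)%E by rewrite /h valN valM valV // h2 oppe0 adde0.
  have hd : (d%:E <= v h)%E.
    by apply: le_trans hh; rewrite lee_fin mulrS lerDl mulrn_wge0 // ltW.
  have hh0 : (0 <= v h)%E by apply: le_trans hd; rewrite lee_fin ltW.
  have es : s n.+1 = y + h by [].
  have hs : (0 <= v (s n.+1))%E by rewrite es; apply: val_leD.
  split=> //.
  - have := @integral_poly_sub _ (s n.+1) y 0 idp hs h1; rewrite es addrAC subrr add0r.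
    move=> /(_ (lt_le_trans _ hd)); rewrite lte_fin d0 => /(_ isT) hlt.
    have <- : v p^`().[y] = v p^`().[y + h]; last by [].
    by apply/esym/val_eqB; rewrite h2 val_subC.
  - have [q [q0 ->]] := integral_poly_taylor ip h1 hh0.
    have -> : p.[y] + h * p^`().[y] = 0 by rewrite /h; field.
    rewrite add0r expr2 -mulrA [_ *+ n.+2]mulrS.
    apply: val_leM => //; rewrite -[d *+ _]addr0; exact: val_leM.
  - by rewrite es addrAC; apply: val_leD.
have [y hy] : exists y, val_cvg v s y.
  apply/complete/val_cauchy_incr => r.
  have [N hN] := @natmul_unbounded d r d d0; exists N => n /hN hn.
  have [h1 h2 h3 _] := H n.
  rewrite /s iterS -/(s n) /step addrAC subrr add0r valN valM valV ?(val_neq0 h2) //.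
  rewrite h2 oppe0 adde0; apply: lt_le_trans h3; rewrite lte_fin mulrS //.
exists y; split.
  apply: (@val_unbounded _ v) => r.
  apply: (@val_cvg_ge _ v r (fun n => p.[s (n + Num.bound `|r / d|)%N])).
    move=> r'; have [N hN] := val_cvg_horner p hy r'.
    by exists N => n hn; apply: hN; apply: leq_trans hn (leq_addr _ _).
  move=> n; have [_ _ h3 _] := H (n + Num.bound `|r / d|)%N; apply: le_trans h3.
  rewrite lee_fin -[d *+ _]mulr_natr -ler_pdivrMl // mulrC.
  apply: le_trans (ler_norm _) _; apply: ltW.
  apply: lt_le_trans (archi_boundP (normr_ge0 _)) _.
  by rewrite ler_nat -addSn leq_addl.
apply: (@lt_le_trans _ _ (d%:E)); first by rewrite lte_fin.
apply: (@val_cvg_ge _ v d (fun n => s n - x)).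
  by apply: val_cvgB => //; apply: val_cvg_cst.
by move=> n; have [] := H n.
Qed.

(** Successive approximation: subtracting from y a combination of the B i that
    agrees with it up to one more step of the value group, and repeating with
    the difference, gives coefficients whose increments tend to 0; their sums
    stay in the closed set S. *)
Lemma complete_span (g : rat) (S : set L) (I : finType) (B : I -> L) : 0 < g ->
  S 0 -> (forall x y, S x -> S y -> S (x + y)) ->
  (forall s l, (forall n, S (s n)) -> val_cvg v s l -> S l) ->
  (forall i, B i != 0) ->
  (forall y, exists c : I -> L, [/\ forall i, S (c i),
     forall i (r : rat), (r%:E <= v y)%E -> (r%:E <= v (c i * B i)%R)%E &
     forall r : rat, (r%:E <= v y)%E ->
       ((r + g)%:E <= v (y - \sum_i c i * B i)%R)%E]) ->
  forall y, exists c : I -> L, [/\ forall i, S (c i),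
     forall i (r : rat), (r%:E <= v y)%E -> (r%:E <= v (c i * B i)%R)%E &
     y = \sum_i c i * B i].
Proof.
move=> g0 S0 SD Scl B0 /choice[c hc] y.
pose f n := iter n (fun z => z - \sum_i c z i * B i) y.
pose C n i := \sum_(k < n) c (f k) i.
have hf n r : (r%:E <= v y)%E -> ((r + g *+ n)%:E <= v (f n))%E.
  move=> h; elim: n => [|n IH]; first by rewrite addr0.
  by rewrite mulrSr addrA; have [_ _] := hc (f n); apply.
have hC n : y - \sum_i C n i * B i = f n.
  elim: n => [|n IH].
    by rewrite big1 ?subr0 // => i _; rewrite /C big_ord0 mul0r.
  rewrite /f iterS -/(f n) -{1}IH -addrA -opprD -big_split /=; congr (_ - _).
  by apply: eq_bigr => i _; rewrite /C big_ord_recr /= mulrDl.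
have [b hb] := val_bound v y.
have hcv i n r : (r%:E <= v y)%E -> ((r + g *+ n)%:E <= v (c (f n) i * B i)%R)%E.
  by move=> h; have [_ + _] := hc (f n); apply; apply: hf.
have /choice[l hl] : forall i, exists l, val_cvg v (C ^~ i) l.
  move=> i; apply/complete/val_cauchy_incr => r.
  have [a ea] := val_fin v (B0 i).
  have [N hN] := @natmul_unbounded g r (b - a) g0; exists N => n /hN hn.
  rewrite /C big_ord_recr /= addrAC subrr add0r.
  have -> : c (f n) i = (c (f n) i * B i) / B i by rewrite mulfK.
  apply: (@lt_le_trans _ _ ((b + g *+ n) - a)%:E).
    by rewrite lte_fin addrAC.
  by apply: val_leM; [apply: hcv|rewrite valV // ea].
have SC n i : S (C n i).
  by rewrite /C; elim/big_ind: _ => // k _; have [] := hc (f k).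
exists l; split.
- by move=> i; apply: (Scl (C ^~ i)).
- move=> i r hr; apply: (@val_cvg_ge _ v r (fun n => C n i * B i)).
    by apply: val_cvgM => //; apply: val_cvg_cst.
  move=> n; rewrite /C big_distrl /=; apply: val_le_sum => k _.
  by apply: le_trans (hcv i k r hr); rewrite lee_fin lerDl mulrn_wge0 // ltW.
- apply/eqP; rewrite -subr_eq0; apply/eqP.
  apply: (@val_cvg_uniq _ v f); last first.
    move=> r; have [N hN] := @natmul_unbounded g r b g0; exists N => n /hN hn.
    by rewrite subr0; apply: lt_le_trans (hf _ _ hb); rewrite lte_fin.
  apply: (val_cvg_eq hC); apply: val_cvgB; first exact: val_cvg_cst.
  apply: val_cvg_sum => i; apply: val_cvgM => //; exact: val_cvg_cst.
Qed.

End IntegralPolynomials.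

(** The residue class of x is separable algebraic over the residue field of v;
    phrased with lifts, the notion makes sense for the various fields below
    without maps between their residue fields. *)
Definition residue_separable (K L : fieldType) (v : valuation K) (w : valuation L)
    (i : {rmorphism K -> L}) (x : L) := exists p : {poly K},
  [/\ p \is monic, integral_poly v p, (0 < w (map_poly i p).[x])%E &
      w (map_poly i p)^`().[x] = 0%E].

Section ClosedField.
Variables (Kb : closedFieldType) (vb : valuation Kb).
Variables (KK : fieldType) (vk : valuation KK) (ik : {rmorphism Kb -> KK}).

Lemma prod_near (rs : seq Kb) x (r : rat) :
  ((r *+ size rs)%:E < vk (\prod_(z <- rs) (x - ik z))%R)%E ->
  exists2 z, z \in rs & (r%:E < vk (x - ik z)%R)%E.
Proof.
elim: rs => [|z rs IH]; first by rewrite big_nil val1 ltxx.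
rewrite big_cons; have [h|h] := ltP (r%:E) (vk (x - ik z)).
  by exists z => //; rewrite mem_head.
move=> h'; suff /IH[y yr hy] : ((r *+ size rs)%:E < vk (\prod_(z <- rs) (x - ik z))%R)%E.
  by exists y => //; rewrite inE yr orbT.
have [P0|P0] := eqVneq (\prod_(z <- rs) (x - ik z)) 0; first by rewrite P0 val0 ltry.
have [a ea] := val_fin vk P0; move: h'.
have z0 : x - ik z != 0 by apply/eqP => e; move: h; rewrite e val0.
have [b eb] := val_fin vk z0.
move: h; rewrite valM ea eb /= lee_fin !lte_fin mulrS => h h'.
lra.
Qed.

(** Continuity of roots: if the product of the x - z over the roots z is small,
    then so is one of the factors. *)
Lemma near_root (p : {poly Kb}) x (r : rat) : p \is monic ->
  ((r *+ (size p).-1)%:E < vk (map_poly ik p).[x])%E ->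
  exists2 z, root p z & (r%:E < vk (x - ik z)%R)%E.
Proof.
move=> mp; have [rs] := closed_field_poly_normal p.
rewrite (monicP mp) scale1r => ep; rewrite ep size_prod_XsubC /=.
rewrite rmorph_prod horner_prod => h.
have [|z zr hz] := @prod_near rs x r.
  by move: h; congr (_ < vk _)%E; apply: eq_bigr => z _; rewrite /= map_polyXsubC hornerXsubC.
by exists z => //; rewrite root_prod_XsubC.
Qed.

Hypothesis KKc : is_completion vb vk ik.

(** The completion of an algebraically closed field is algebraically closed:
    approximate g by polynomials over Kb and choose, for each of them, a root
    near the root chosen for the previous one. *)
Lemma closed_completion_root (g : {poly KK}) : g \is monic -> integral_poly vk g ->
  (1 < size g)%N -> exists x, root g x.
Proof.
move=> mg ig sg; have [hE hD hC] := KKc; pose d := (size g).-1.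
have sgE : size g = d.+1 by rewrite /d prednK // ltnW.
have d0 : (0 < d)%N by rewrite /d -subn1 subn_gt0.
have /choice[G hG] : forall n : nat, exists G : {poly Kb}, [/\ G \is monic, size G = d.+1 &
    forall i, ((n%:R : rat)%:E < vk (g`_i - ik G`_i)%R)%E].
  move=> n; have /choice[c hc] := fun i => hD g`_i (n%:R : rat).
  pose G := \poly_(i < d) c i.
  exists ('X^d + G); split.
  - by rewrite monicE lead_coefDl ?lead_coefXn // size_polyXn ltnS size_poly.
  - by rewrite size_polyDl size_polyXn // ltnS size_poly.
  - move=> i; rewrite coefD coefXn coef_poly.
    case: ltngtP => [id|di|->]; last 1 first.
    + rewrite addr0 rmorph1 /d -lead_coefE (monicP mg) subrr val0 ltry //.
    + by rewrite add0r.
    + by rewrite addr0 rmorph0 subr0 nth_default ?val0 ?ltry // sgE.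
have iG n : integral_poly vb (G n).
  move=> i; have [_ _ h] := hG n; rewrite -hE.
  have -> : ik (G n)`_i = g`_i - (g`_i - ik (G n)`_i) by ring.
  by apply: val_leB => //; apply: ltW; apply: le_lt_trans (h i); rewrite lee_fin ler0n.
have step n x : exists y, root (G n) x ->
    root (G n.+1) y /\ ((n%:R / d%:R : rat)%:E < vk (ik x - ik y)%R)%E.
  have [rx|nrx] := boolP (root (G n) x); last by exists 0.
  have [m1 s1 h1] := hG n; have [m2 s2 h2] := hG n.+1.
  have x0 := integral_poly_root_ge0 m1 (iG n) rx.
  have [|y ry hy] := @near_root (G n.+1) (ik x) (n%:R / d%:R) m2; last by exists y.
  rewrite s2 /= -(mulr_natr (_ / _)) divfK ?pnatr_eq0 -?lt0n //.
  have -> : (map_poly ik (G n.+1)).[ik x] = (map_poly ik (G n.+1 - G n)).[ik x].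
    by rewrite rmorphB !hornerE !horner_map (rootP rx) rmorph0 subr0.
  apply: poly_val_gt; last by rewrite hE.
  move=> i; rewrite coef_map coefB /= rmorphB.
  have -> : ik (G n.+1)`_i - ik (G n)`_i =
     (g`_i - ik (G n)`_i) - (g`_i - ik (G n.+1)`_i) by ring.
  apply: val_ltB => //; apply: lt_trans (h2 i); by rewrite lte_fin ltr_nat.
have /choice[f hf] : forall n, exists f : Kb -> Kb, forall x, root (G n) x ->
    root (G n.+1) (f x) /\ ((n%:R / d%:R : rat)%:E < vk (ik x - ik (f x))%R)%E.
  by move=> n; have /choice[f hf] := step n; exists f.
have [x0 rx0] : exists x0, root (G 0) x0.
  apply/closed_rootP; have [_ -> _] := hG 0%N; by rewrite eqSS -lt0n.
pose s := nat_rect (fun=> Kb) x0 f.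
have rs n : root (G n) (s n) by elim: n => //= n /hf[].
have s0 n : (0 <= vk (ik (s n)))%E.
  by have [m1 _ _] := hG n; rewrite hE (integral_poly_root_ge0 m1 (iG n)).
have [y hy] : exists y, val_cvg vk (ik \o s) y.
  apply/hC/val_cauchy_incr => r.
  have d1 : 0 < (d%:R^-1 : rat) by rewrite invr_gt0 ltr0n.
  have [N hN] := natmul_unbounded r 0 d1.
  exists N => n /= /hN; rewrite add0r => hn; rewrite val_subC.
  have [|_ h] := hf n (s n); first exact: rs.
  by apply: lt_trans h; rewrite lte_fin mulrC mulr_natr.
exists y; apply/eqP; apply: (val_cvg_uniq (val_cvg_horner g hy)) => r.
have [N hN] := @natmul_unbounded 1 r 0 ltr01.
exists N => n /hN; rewrite add0r => hn; rewrite subr0 /=.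
have -> : g.[ik (s n)] = (g - map_poly ik (G n)).[ik (s n)].
  by rewrite !hornerE horner_map (rootP (rs n)) rmorph0 subr0.
apply: poly_val_gt => // i; rewrite coefB coef_map.
by have [_ _ h] := hG n; apply: lt_trans (h i); rewrite lte_fin.
Qed.

End ClosedField.

(** * Polynomials over a subring, isometric graphs *)

Section PolynomialsOverSubring.
Variables (R : comNzRingType) (G : set R).
Implicit Types (p q : {poly R}).

Definition subring_set := [/\ G 1, forall x y, G x -> G y -> G (x - y) &
  forall x y, G x -> G y -> G (x * y)].

Definition poly_over p := forall i, G p`_i.

Hypothesis hG : subring_set.

Lemma subring1 : G 1. Proof. by have [] := hG. Qed.
Lemma subringB x y : G x -> G y -> G (x - y). Proof. by have [_ h _] := hG; apply: h. Qed.
Lemma subringM x y : G x -> G y -> G (x * y). Proof. by have [_ _ h] := hG; apply: h. Qed.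
Lemma subring0 : G 0. Proof. by rewrite -(subrr 1); apply: subringB; exact: subring1. Qed.
Lemma subringN x : G x -> G (- x).
Proof. by move=> h; rewrite -[- x]add0r; apply: subringB => //; exact: subring0. Qed.
Lemma subringD x y : G x -> G y -> G (x + y).
Proof. by move=> hx hy; rewrite -[y]opprK; apply: subringB => //; exact: subringN. Qed.
Lemma subring_sum (I : Type) (r : seq I) (P : pred I) (F : I -> R) :
  (forall i, P i -> G (F i)) -> G (\sum_(i <- r | P i) F i).
Proof. by move=> h; elim/big_ind: _ => //; [exact: subring0|exact: subringD]. Qed.
Lemma subringMn x n : G x -> G (x *+ n).
Proof.
by move=> h; elim: n => [|n IH]; rewrite ?mulr0n ?mulrS; [exact: subring0|exact: subringD].
Qed.
Lemma subringX x n : G x -> G (x ^+ n).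
Proof.
by move=> h; elim: n => [|n IH]; rewrite ?expr0 ?exprS; [exact: subring1|exact: subringM].
Qed.

Lemma poly_over0 : poly_over 0.
Proof. by move=> i; rewrite coef0; exact: subring0. Qed.
Lemma poly_overD p q : poly_over p -> poly_over q -> poly_over (p + q).
Proof. by move=> hp hq i; rewrite coefD; exact: subringD. Qed.
Lemma poly_overB p q : poly_over p -> poly_over q -> poly_over (p - q).
Proof. by move=> hp hq i; rewrite coefB; exact: subringB. Qed.
Lemma poly_overM p q : poly_over p -> poly_over q -> poly_over (p * q).
Proof. by move=> hp hq i; rewrite coefM; apply: subring_sum => j _; exact: subringM. Qed.
Lemma poly_overC c : G c -> poly_over c%:P.
Proof. by move=> hc i; rewrite coefC; case: ifP => // _; exact: subring0. Qed.
Lemma poly_overX : poly_over 'X.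
Proof.
by move=> i; rewrite coefX; case: eqP => _ /=; [exact: subring1|exact: subring0].
Qed.
Lemma poly_overXn n : poly_over 'X^n.
Proof.
by move=> i; rewrite coefXn; case: eqP => _ /=; [exact: subring1|exact: subring0].
Qed.
Lemma poly_over_deriv p : poly_over p -> poly_over p^`().
Proof.
by move=> hp i; rewrite coef_deriv; apply: subringMn; exact: hp.
Qed.
Lemma poly_over_horner p x : poly_over p -> G x -> G p.[x].
Proof.
move=> hp hx; rewrite horner_coef; apply: subring_sum => i _.
by apply: subringM => //; exact: subringX.
Qed.
Lemma poly_over_sum (I : Type) (r : seq I) (P : pred I) (F : I -> {poly R}) :
  (forall i, P i -> poly_over (F i)) -> poly_over (\sum_(i <- r | P i) F i).
Proof. by move=> h; elim/big_ind: _ => //; [exact: poly_over0|exact: poly_overD]. Qed.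
Lemma poly_over_comp p q : poly_over p -> poly_over q -> poly_over (p \Po q).
Proof.
move=> hp hq; rewrite comp_polyE; apply: poly_over_sum => i _.
rewrite -mul_polyC; apply: poly_overM; first exact: poly_overC.
elim: (i : nat) => [|n IH]; first by rewrite expr0; apply: poly_overC; exact: subring1.
by rewrite exprS; exact: poly_overM.
Qed.

Lemma monic_division P p : P \is monic -> poly_over P -> poly_over p ->
  exists s t, [/\ poly_over s, poly_over t, p = s * P + t & (size t < size P)%N].
Proof.
move=> mP oP; have [n] := ubnP (size p); elim: n p => // n IH p; rewrite ltnS => sp op.
have [spP|sPp] := ltnP (size p) (size P).
  by exists 0, p; split=> //; [exact: poly_over0|rewrite mul0r add0r].
pose a := lead_coef p; pose k := (size p - size P)%N.
have P0 : (0 < size P)%N by rewrite size_poly_gt0 monic_neq0.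
have p0 : (0 < size p)%N by apply: leq_trans sPp.
pose u := a%:P * 'X^k.
have ou : poly_over u by apply: poly_overM; [apply: poly_overC; apply: op|exact: poly_overXn].
have [||s [t [os ot e st]]] := IH (p - u * P).
- apply: leq_trans sp; rewrite -(prednK p0) ltnS; apply/leq_sizeP => j hj.
  rewrite coefB /u -mulrA coefCM coefXnM.
  have kj : (k <= j)%N.
    by rewrite /k; move: (size p) (size P) sPp P0 p0 hj => b c; clear; lia.
  rewrite ltnNge kj /=; move: hj; rewrite leq_eqVlt => /predU1P[<-|hj].
    have -> : ((size p).-1 - k = (size P).-1)%N.
      by rewrite /k; move: (size p) (size P) sPp P0 p0 => b c; clear; lia.
    by rewrite -!lead_coefE (monicP mP) mulr1 subrr.
  rewrite !nth_default ?mulr0 ?subrr // /k;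
    move: (size p) (size P) sPp P0 p0 hj => b c; clear; lia.
- by apply: poly_overB => //; exact: poly_overM.
exists (s + u), t; split=> //; first exact: poly_overD.
by rewrite mulrDl addrAC -e subrK.
Qed.

End PolynomialsOverSubring.

Section Isometries.
Variables (K L M : fieldType) (v : valuation K) (vL : valuation L) (vM : valuation M).
Variables (iL : {rmorphism K -> L}) (iM : {rmorphism K -> M}).

(** Isometric isomorphisms over K between subrings of L and M, given by their
    graphs. A graph is a subring of the product ring, so one polynomial over it
    stands for a pair of corresponding polynomials over L and over M. *)
Definition isometric_graph (G : set (L * M)) :=
  [/\ subring_set G, forall z, G z -> vL z.1 = vM z.2 & forall a, G (iL a, iM a)].

Definition adjoin_pair (G : set (L * M)) z : set (L * M) :=
  [set y | exists2 p, poly_over G p & y = p.[z]].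

(** Zorn's lemma. A maximal graph G is used through the last clause only: if
    polynomials over G take equal values at the two components of z, then the
    polynomials in z over G form an isometric graph again. *)
Lemma maximal_isometric_graph G0 : isometric_graph G0 ->
  exists G, [/\ isometric_graph G, G0 `<=` G &
    forall z, (forall p, poly_over G p -> vL p.[z].1 = vM p.[z].2) -> G z].
Proof.
move=> iG0.
pose P (A : set (L * M)) := A = set0 \/ isometric_graph A /\ G0 `<=` A.
have [F FP tF|G [PG mG]] := @Zorn_bigcup _ P.
  have [[A [FA A0]]|h] := pselect (exists A, F A /\ A !=set0); last first.
    left; apply/seteqP; split=> // x [A FA Ax]; apply: h; exists A; split=> //.
    by exists x.
  right; have good B : F B -> B !=set0 -> isometric_graph B /\ G0 `<=` B.
    by move=> /FP[->|//] [x].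
  have [iA sA] := good _ FA A0.
  have two x y : (\bigcup_(X in F) X) x -> (\bigcup_(X in F) X) y ->
      exists B, [/\ F B, isometric_graph B, B x & B y].
    move=> [B FB Bx] [C FC Cy]; have [BC|CB] := tF B C FB FC.
    - by exists C; split=> //; [have [] := good _ FC (ex_intro _ _ Cy)|exact: BC].
    - by exists B; split=> //; [have [] := good _ FB (ex_intro _ _ Bx)|exact: CB].
  split; last by move=> x /sA Ax; exists A.
  split; first split.
  - by exists A => //; have [[]] := iA.
  - move=> x y hx hy; have [B [FB [[_ h _] _ _] Bx By]] := two x y hx hy.
    by exists B => //; apply: h.
  - move=> x y hx hy; have [B [FB [[_ _ h] _ _] Bx By]] := two x y hx hy.
    by exists B => //; apply: h.
  - by move=> z [B FB Bz]; have [[_ h _] _] := good _ FB (ex_intro _ _ Bz); apply: h.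
  - by move=> a; exists A => //; have [_ _ h] := iA; apply: h.
have [iG sG] : isometric_graph G /\ G0 `<=` G.
  case: PG => // G_0; exfalso; apply: (mG G0); last by right; split.
  split; first by rewrite G_0.
  by move=> h; have [[/h]] := iG0; rewrite G_0.
exists G; split=> // z hz; apply: contrapT => nGz.
have [hG vG kG] := iG; have [G1 GB GM] := hG.
apply: (mG (adjoin_pair G z)).
  split=> [y Gy|h]; first by exists y%:P; [exact: poly_overC|rewrite hornerC].
  by apply/nGz/h; exists 'X; [exact: poly_overX|rewrite hornerX].
right; split; last first.
  by move=> y /sG Gy; exists y%:P; [exact: poly_overC|rewrite hornerC].
split; first split.
- by exists 1%:P; [exact: poly_overC|rewrite hornerC].
- move=> _ _ [p op ->] [q oq ->]; exists (p - q); last by rewrite !hornerE.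
  exact: poly_overB.
- move=> _ _ [p op ->] [q oq ->]; exists (p * q); last by rewrite !hornerE.
  exact: poly_overM.
- by move=> _ [p op ->]; exact: hz.
- by move=> a; exists (iL a, iM a)%:P; [exact: poly_overC|rewrite hornerC].
Qed.

End Isometries.

(** * Discretely valued fields *)

Section DiscreteSpan.
Variables (L : fieldType) (v : valuation L).
Hypothesis complete : forall s, val_cauchy v s -> exists l, val_cvg v s l.
Variables (g : rat) (pi : L).
Hypothesis g0 : 0 < g.
Hypothesis vpi : v pi = g%:E.
Hypothesis vdisc : forall x, x != 0 -> exists n : int, v x = (g *~ n)%:E.

Lemma discrete_gt0 x : (0 < v x)%E -> (g%:E <= v x)%E.
Proof.
have [->|/vdisc[n ->]] := eqVneq x 0; first by rewrite val0 leey.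
rewrite lte_fin lee_fin pmulrz_rgt0 // => n0.
by rewrite -[X in X <= _](mulr1z g) ler_pMz2l.
Qed.

Definition subfield_set (S : set L) := subring_set S /\ forall x, S x -> S x^-1.

Definition limit_closed (S : set L) :=
  forall s l, (forall n, S (s n)) -> val_cvg v s l -> S l.

Lemma subfieldXz (S : set L) x (n : int) : subfield_set S -> S x -> S (x ^ n).
Proof.
move=> [rS iS] Sx; case: n => n; first exact: subringX.
by rewrite NegzE -exprnN; apply: iS; exact: subringX.
Qed.

(** Two terms of equal value would give an element of S of value k * g with
    0 < k < e, namely the quotient of their coefficients. *)
Lemma distinct_terms (S : set L) e (c : 'I_e -> L) z :
  subfield_set S ->
  (forall k a, S a -> v a = (g *+ k)%:E -> (0 < k < e)%N -> False) ->
  (forall i, S (c i)) -> v z = g%:E ->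
  forall i j, i != j -> c i * z ^+ i != 0 -> v (c i * z ^+ i) != v (c j * z ^+ j).
Proof.
move=> [[_ _ hM] hV] mine Sc vz i j.
wlog ij : i j / (i < j)%N => [W|] nij n0.
  have [ij|ij|ij] := ltngtP i j; first exact: W.
    have [zj|zj] := eqVneq (c j * z ^+ j) 0; first by rewrite zj val0 val_eqy.
    by rewrite eq_sym; apply: W => //; rewrite eq_sym.
  by rewrite (ord_inj ij) eqxx in nij.
apply/eqP => h.
have ci0 : c i != 0 by apply: contra_neq n0 => ->; rewrite mul0r.
have [r er] := val_fin v ci0.
move: h; rewrite !valM !(valX _ vz) er => h.
have cj0 : c j != 0 by apply/eqP => b0; move: h; rewrite b0 val0.
have [s es] := val_fin v cj0; move: h; rewrite es => -[] h.
apply: (mine (j - i)%N (c i / c j)).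
- by apply: hM => //; apply: hV.
- by rewrite valM valV // er es -EFinB mulrnBr ?(ltnW ij) //; congr (_%:E); lra.
- by rewrite subn_gt0 ij /= (leq_ltn_trans (leq_subr _ _)).
Qed.

(** If y has value n * g with n = q * e + i and i < e, then so has
    a0 ^ q * pi ^+ i; the quotient of the two is a unit, whose residue class is
    a combination of those of the b k. *)
Lemma discrete_span (S : set L) n (b : 'I_n -> L) e a0 :
  subfield_set S -> limit_closed S ->
  (forall k, b k != 0) -> (forall k, (0 <= v (b k))%E) ->
  (forall u, (0 <= v u)%E -> exists c : 'I_n -> L,
     [/\ forall k, S (c k), forall k, (0 <= v (c k))%E &
      (0 < v (u - \sum_k c k * b k)%R)%E]) ->
  (0 < e)%N -> S a0 -> v a0 = (g *+ e)%:E ->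
  forall y, exists c : 'I_n * 'I_e -> L, [/\ forall p, S (c p),
    forall p (r : rat), (r%:E <= v y)%E ->
      (r%:E <= v (c p * (b p.1 * pi ^+ p.2))%R)%E &
    y = \sum_p c p * (b p.1 * pi ^+ p.2)].
Proof.
move=> fS lS b0 vb res e0 Sa0 va0; have [rS iS] := fS.
have pi0 : pi != 0 by apply: val_neq0 vpi.
apply: (complete_span complete g0) => //.
- exact: subring0.
- by move=> x y; apply: subringD.
- by move=> p; rewrite mulf_neq0 // expf_neq0.
move=> y; have [y0|/vdisc[z vy]] := eqVneq y 0.
  exists (fun=> 0); split=> [p|p r _|r _].
  - exact: subring0.
  - by rewrite mul0r val0 leey.
  - by rewrite y0 big1 ?subr0 ?val0 ?leey // => p _; rewrite mul0r.
pose q := (z %/ e%:Z)%Z; pose i := `|(z %% e%:Z)%Z|%N.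
have ie : (i < e)%N.
  by rewrite -ltz_nat /i gez0_abs ?modz_ge0 ?ltz_pmod // -?lt0n // eqz_nat -lt0n.
have zE : z = e%:Z * q + i%:Z.
  by rewrite /i gez0_abs ?modz_ge0 ?eqz_nat -?lt0n // mulrC -divz_eq.
have vu : v (a0 ^ q * pi ^+ i) = (g *~ z)%:E.
  by rewrite valM (valXz _ va0) (valX _ vpi) -EFinD zE mulrzDr mulrzA.
have u0 := val_neq0 vu; set u := a0 ^ q * pi ^+ i in vu u0.
have [c [Sc vc hc]] : exists c : 'I_n -> L,
     [/\ forall k, S (c k), forall k, (0 <= v (c k))%E &
      (0 < v (y / u - \sum_k c k * b k)%R)%E].
  by apply: res; rewrite valM valV // vy vu -EFinN -EFinD subrr.
have Saq : S (a0 ^ q) by apply: subfieldXz.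
exists (fun p => if p.2 == Ordinal ie then a0 ^ q * c p.1 else 0); split.
- move=> p; case: ifP => _; [exact: subringM|exact: subring0].
- move=> [k j] r hr /=; case: eqP => [->|_] /=; last by rewrite mul0r val0 leey.
  have -> : a0 ^ q * c k * (b k * pi ^+ i) = u * (c k * b k) by rewrite /u; ring.
  by rewrite -[r]addr0; apply: val_leM; rewrite ?vu -?vy // val_ge0M.
- move=> r hr.
  have -> : \sum_p (if p.2 == Ordinal ie then a0 ^ q * c p.1 else 0) * (b p.1 * pi ^+ p.2)
      = u * \sum_k c k * b k.
    rewrite -(pair_bigA _ (fun k j => (if j == Ordinal ie then a0 ^ q * c k else 0)
      * (b k * pi ^+ j))) /= big_distrr /=; apply: eq_bigr => k _.
    rewrite (bigD1 (Ordinal ie)) //= eqxx big1 ?addr0; first by rewrite /u; ring.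
    by move=> j /negPf->; rewrite mul0r.
  rewrite -[y in (y - _)%R](divfK u0) mulrC -mulrBr.
  by apply: val_leM; [rewrite vu -vy|apply: discrete_gt0].
Qed.

Lemma totally_ramified_span (S : set L) e a0 :
  subfield_set S -> limit_closed S ->
  (forall u, (0 <= v u)%E -> exists2 c, S c & (0 < v (u - c)%R)%E) ->
  (0 < e)%N -> S a0 -> v a0 = (g *+ e)%:E ->
  forall y, exists c : 'I_e -> L, [/\ forall i, S (c i),
    forall i (r : rat), (r%:E <= v y)%E -> (r%:E <= v (c i * pi ^+ i)%R)%E &
    y = \sum_i c i * pi ^+ i].
Proof.
move=> fS lS res e0 Sa0 va0 y.
have [||u hu|c [Sc vc yE]] := @discrete_span S 1 (fun=> 1) e a0 fS lS _ _ _ e0 Sa0 va0 y.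
- by move=> _; rewrite oner_neq0.
- by move=> _; rewrite val1.
- have [c Sc hc] := res u hu; exists (fun=> c); split=> //.
  + move=> _; have -> : c = u - (u - c) by ring.
    by apply: val_leB => //; apply: ltW.
  + by rewrite big_ord1 mulr1.
exists (fun i => c (ord0, i)); split=> //.
- by move=> i r hr; have := vc (ord0, i) r hr; rewrite mul1r.
- rewrite {1}yE.
  have -> : \sum_p c p * (1 * pi ^+ p.2) = \sum_k \sum_j c (k, j) * pi ^+ j.
    by rewrite pair_bigA /=; apply: eq_bigr => -[k j] _; rewrite mul1r.
  by rewrite big_ord1.
Qed.

End DiscreteSpan.

(** * Extension of isometries *)

Section Embedding.
Variables (K L M : fieldType) (v : valuation K) (vL : valuation L) (vM : valuation M).
Variables (iL : {rmorphism K -> L}) (iM : {rmorphism K -> M}).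
Hypothesis extL : val_extends v vL iL.
Hypothesis cL : forall s, val_cauchy vL s -> exists l, val_cvg vL s l.
Hypothesis cM : forall s, val_cauchy vM s -> exists l, val_cvg vM s l.
Hypothesis rootM : forall p : {poly M}, p \is monic -> integral_poly vM p ->
  (1 < size p)%N -> exists x, root p x.
Hypothesis resL : forall x, (0 <= vL x)%E -> residue_separable v vL iL x.
Variables (g : rat) (pi : L) (t : K) (m : nat).
Hypothesis g0 : 0 < g.
Hypothesis vpi : vL pi = g%:E.
Hypothesis discL : forall x, x != 0 -> exists n : int, vL x = (g *~ n)%:E.
Hypothesis m0 : (0 < m)%N.
Hypothesis vt : v t = (g *+ m)%:E.

(** Over a field, the inverse of a nonzero algebraic element y is a polynomial in
    y: divide p(y) = 0 by the constant coefficient of p, after removing factors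
    'X from p. Here this is done for the residue class of y. *)
Lemma residue_poly_inverse y : vL y = 0%E -> exists p : {poly K},
  integral_poly v p /\ (0 < vL (y * (map_poly iL p).[y] - 1)%R)%E.
Proof.
move=> vy; have y0 : (0 <= vL y)%E by rewrite vy.
have [p [mp ip hp _]] := resL y0.
have [n] := ubnP (size p); elim: n p mp ip hp => // n IH p mp ip hp; rewrite ltnS => sp.
have [q [c ep]] : exists q c, p = q * 'X + c%:P.
  exists (p %/ ('X - 0%:P)), p.[0].
  by rewrite {1}(divp_eq p ('X - 0%:P)) modp_XsubC polyC0 subr0.
have [iq c0] : integral_poly v q /\ (0 <= v c)%E by move: ip; rewrite ep => /integral_polyMXaddC.
have hpE : (map_poly iL p).[y] = (map_poly iL q).[y] * y + iL c.
  by rewrite ep rmorphD rmorphM /= map_polyX map_polyC !hornerE.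
have q0 : q != 0.
  apply/eqP => q0; move: mp hp; rewrite hpE ep q0 !mul0r rmorph0 horner0 mul0r !add0r.
  by rewrite monicE lead_coefC => /eqP->; rewrite rmorph1 val1 ltxx.
move: c0; rewrite le_eqVlt => /orP[/eqP vc|vc].
- have c0 : c != 0 by apply: (@val_neq0 _ v _ 0).
  exists (- (c^-1%:P * q)); split.
    move=> i; rewrite coefN valN coefCM; apply: val_ge0M => //.
    by rewrite valV // -vc oppe0.
  rewrite rmorphN rmorphM /= map_polyC !hornerE.
  have -> : y * - (iL c^-1 * (map_poly iL q).[y]) - 1 = - (iL c^-1 * (map_poly iL p).[y]).
    rewrite hpE mulrDr fmorphV mulVf ?fmorph_eq0 //; ring.
  rewrite valN valM extL valV // -vc oppe0 add0e //.
- have sq : (size q < size p)%N.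
    by rewrite ep size_MXaddC (negPf q0).
  have [||r [ir hr]] := IH q _ iq _ (leq_trans sq sp).
  + move: mp; rewrite ep !monicE lead_coefDl ?lead_coefMX // size_mulX //.
    by rewrite (leq_ltn_trans (size_polyC_leq1 _)) // ltnS size_poly_gt0.
  + have -> : (map_poly iL q).[y] = ((map_poly iL p).[y] - iL c) / y.
      by rewrite hpE addrK mulfK // (@val_neq0 _ vL _ 0).
    apply: val_gt0M; first by apply: val_ltB; rewrite ?extL.
    by rewrite valV ?vy ?oppe0 // (@val_neq0 _ vL _ 0).
  + by exists r.
Qed.

Let isograph := isometric_graph vL vM iL iM.

Lemma isometric_limits (z : nat -> L * M) a b :
  (forall n, vL (z n).1 = vM (z n).2) ->
  val_cvg vL (fun n => (z n).1) a -> val_cvg vM (fun n => (z n).2) b -> vL a = vM b.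
Proof.
move=> hz ha hb; have [a0|a0] := eqVneq a 0.
  suff -> : b = 0 by rewrite a0 !val0.
  apply: (val_cvg_uniq hb) => r; have [N hN] := ha r; exists N => n /hN.
  by rewrite a0 !subr0 hz.
have [b0|b0] := eqVneq b 0.
  case/eqP: a0; apply: (val_cvg_uniq ha) => r; have [N hN] := hb r; exists N => n /hN.
  by rewrite b0 !subr0 hz.
have [N1 h1] := val_cvg_val ha a0; have [N2 h2] := val_cvg_val hb b0.
by rewrite -(h1 (maxn N1 N2)) ?leq_maxl // -(h2 (maxn N1 N2)) ?leq_maxr.
Qed.

Section Maximal.
Variable G : set (L * M).
Hypothesis iG : isograph G.
Hypothesis maxG : forall z, (forall p, poly_over G p -> vL p.[z].1 = vM p.[z].2) -> G z.

Let rG : subring_set G. Proof. by have [] := iG. Qed.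
Let eG z : G z -> vL z.1 = vM z.2. Proof. by have [_ h _] := iG; apply: h. Qed.
Let kG a : G (iL a, iM a). Proof. by have [_ _ h] := iG. Qed.

Let ev1 (p : {poly L * M}) y := (map_poly fst p).[y].
Let ev2 (p : {poly L * M}) y := (map_poly snd p).[y].
Let ev1E p z : p.[z].1 = ev1 p z.1. Proof. by rewrite /ev1 horner_map. Qed.
Let ev2E p z : p.[z].2 = ev2 p z.2. Proof. by rewrite /ev2 horner_map. Qed.

Lemma graph_eq0 z : G z -> (z.1 == 0) = (z.2 == 0).
Proof. by move=> /eG h; rewrite -(val_eqy vL) h val_eqy. Qed.

(** A polynomial in z^-1 becomes an element of G after multiplication by a power
    of z. *)
Lemma maximal_graphV z : G z -> G (z.1^-1, z.2^-1).
Proof.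
move=> Gz; have [z1|z1] := eqVneq z.1 0.
  have z2 : z.2 = 0 by apply/eqP; rewrite -graph_eq0 // z1.
  by rewrite z1 z2 !invr0; exact: (subring0 rG).
have z2 : z.2 != 0 by rewrite -graph_eq0.
apply: maxG => p op; set z' := (_, _).
have zz' : z * z' = 1 by rewrite /z' {1}[z]surjective_pairing; congr (_, _) => /=; rewrite divff.
have /eG : G (z ^+ size p * p.[z']).
  rewrite horner_coef big_distrr /=; apply: subring_sum => // i _.
  rewrite mulrCA; apply: (subringM rG) => //.
  have ei : size p = (size p - i + i)%N by rewrite subnK // ltnW.
  rewrite [X in z ^+ X * _]ei exprD -mulrA -exprMn zz' expr1n mulr1.
  exact: (@subringX _ _ rG).
have E1 n : (z ^+ n).1 = z.1 ^+ n by rewrite -[LHS]/(fst _) rmorphXn.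
have E2 n : (z ^+ n).2 = z.2 ^+ n by rewrite -[LHS]/(snd _) rmorphXn.
have [r er] := val_fin vL z1; have er2 := er; rewrite eG // in er2.
rewrite /= E1 E2 !valM (valX _ er) (valX _ er2).
case: (vL _) (val_neqNy vL p.[z'].1) => [a| |//] _;
case: (vM _) (val_neqNy vM p.[z'].2) => [b| |//] _ //.
by move=> [] /addrI ->.
Qed.

(** Polynomials are continuous, and equality of values passes to the limit. *)
Lemma maximal_graph_cvg (z : nat -> L * M) a b : (forall n, G (z n)) ->
  val_cvg vL (fun n => (z n).1) a -> val_cvg vM (fun n => (z n).2) b -> G (a, b).
Proof.
move=> Gz ha hb; apply: maxG => p op.
rewrite ev1E ev2E /=; apply: (@isometric_limits (fun n => p.[z n])).
- by move=> n; apply: eG; exact: poly_over_horner.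
- apply: val_cvg_eq (val_cvg_horner (map_poly fst p) ha) => n; exact/esym/ev1E.
- apply: val_cvg_eq (val_cvg_horner (map_poly snd p) hb) => n; exact/esym/ev2E.
Qed.

Definition graph_dom : set L := [set a | exists b, G (a, b)].

Lemma graph_dom_closed : limit_closed vL graph_dom.
Proof.
move=> s l hs sl; have /choice[b hb] := hs.
have [c hc] : exists c, val_cvg vM b c.
  apply: cM => r; have [N hN] := val_cvg_cauchy sl r; exists N => i j hi hj.
  have /eG /= <- := subringB rG (hb i) (hb j); exact: hN.
by exists c; apply: (@maximal_graph_cvg (fun n => (s n, b n))).
Qed.

Lemma graph_dom_subfield : subfield_set graph_dom.
Proof.
split; first split.
- by exists 1; exact: (subring1 rG).
- by move=> x y [a ha] [b hb]; exists (a - b); exact: (subringB rG ha hb).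
- by move=> x y [a ha] [b hb]; exists (a * b); exact: (subringM rG ha hb).
- by move=> x [a ha]; exists a^-1; exact: (maximal_graphV ha).
Qed.

Let O : set (L * M) := [set z | G z /\ (0 <= vL z.1)%E].
Let rO : subring_set O.
Proof.
split.
- by split; [exact: subring1|rewrite val1].
- move=> x y [hx vx] [hy vy]; split; [exact: subringB|exact: val_leB].
- move=> x y [hx vx] [hy vy]; split; [exact: subringM|exact: val_ge0M].
Qed.
Let O_G p : poly_over O p -> poly_over G p.
Proof. by move=> h i; have [] := h i. Qed.
Let O_ip1 p : poly_over O p -> integral_poly vL (map_poly fst p).
Proof. by move=> h i; rewrite coef_map; have [] := h i. Qed.
Let O_ip2 p : poly_over O p -> integral_poly vM (map_poly snd p).
Proof. by move=> h i; rewrite coef_map /=; have [/eG <-] := h i. Qed.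

Let lift (p : {poly K}) : {poly L * M} := \poly_(i < size p) (iL p`_i, iM p`_i).
Let lift_coef p i : (lift p)`_i = (iL p`_i, iM p`_i).
Proof.
rewrite coef_poly; case: ltnP => // h; rewrite nth_default // !rmorph0 //.
Qed.
Let lift1 p : map_poly fst (lift p) = map_poly iL p.
Proof. by apply/polyP => i; rewrite !coef_map lift_coef. Qed.
Let lift_O p : integral_poly v p -> poly_over O (lift p).
Proof. by move=> h i; rewrite lift_coef; split; rewrite //= extL. Qed.
Let lift_size p : size (lift p) = size p.
Proof.
apply/eqP; rewrite eqn_leq size_poly /=.
have [->|p0] := eqVneq p 0; first by rewrite size_poly0.
rewrite -[X in (X <= _)%N](@prednK (size p)) ?size_poly_gt0 // ltnNge.
apply/negP => /leq_sizeP/(_ _ (leqnn _)); rewrite lift_coef => -[].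
by rewrite -lead_coefE => /eqP; rewrite fmorph_eq0 lead_coef_eq0 (negPf p0).
Qed.
Let lift_monic p : p \is monic -> lift p \is monic.
Proof.
rewrite !monicE !lead_coefE lift_size lift_coef -lead_coefE => /eqP->.
by rewrite !rmorph1.
Qed.

(** The domain of a maximal graph has the residue field of L. Let P be monic of
    least degree among the integral polynomials over G whose value at x is in
    the maximal ideal: it lifts the minimal polynomial of the residue class of
    x. By separability and Hensel's lemma, P has a root th near x in L; let th'
    be any root of P in M. The integral polynomials over G whose values at th
    are not units form the ideal generated by P and the non-units of G. This
    ideal is maximal and is contained in the corresponding ideal for th', so the
    two are equal. Hence a polynomial of degree less than that of P with a unit
    among its integral coefficients is a unit at th and at th', and by scaling
    and division by P all polynomials over G have equal values at th and th'. *)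
Lemma maximal_graph_residue x : (0 <= vL x)%E ->
  exists2 c, graph_dom c & (0 < vL (x - c)%R)%E.
Proof.
move=> x0; have [p0 [mp0 ip0 hp0 hdp0]] := resL x0.
pose Q n := `[< exists P, [/\ P \is monic, poly_over O P, size P = n & (0 < vL (ev1 P x))%E] >].
have exQ : exists n, Q n.
  exists (size p0); apply/asboolP; exists (lift p0); split; first exact: lift_monic.
  - exact: lift_O.
  - exact: lift_size.
  - by rewrite /ev1 lift1.
case: (ex_minnP exQ) => n /asboolP[P [mP oP sP hP]] minP.
have iP1 := O_ip1 oP.
(* Minimality of P: below its degree, only polynomials with coefficients in
   the maximal ideal have a value in the maximal ideal at x. *)
have low q : poly_over O q -> (size q < size P)%N -> (0 < vL (ev1 q x))%E ->
    forall i, (0 < vL (q`_i).1)%E.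
  have [k] := ubnP (size q); elim: k q => // k IH q; rewrite ltnS => sk oq sq hq i.
  have [->|q0] := eqVneq q 0; first by rewrite coef0 val0.
  pose a := lead_coef q; have [Ga va] : O a by apply: oq.
  have sq0 : (0 < size q)%N by rewrite size_poly_gt0.
  move: va; rewrite le_eqVlt => /orP[/eqP va|va].
    have a0 : a.1 != 0 by apply: (@val_neq0 _ vL _ 0).
    have a0' : a.2 != 0 by rewrite -graph_eq0.
    pose a' := (a.1^-1, a.2^-1).
    have Oa' : O a' by split; [exact: maximal_graphV|rewrite /= valV // -va oppe0].
    have aa' : a' * a = 1 by rewrite {1}[a]surjective_pairing; congr (_, _) => /=; rewrite mulVf.
    have lq' : (a'%:P * q)`_(size q).-1 = 1 by rewrite coefCM -lead_coefE.
    have sq' : size (a'%:P * q) = size q.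
      apply/eqP; rewrite eqn_leq; apply/andP; split.
        by rewrite mul_polyC size_scale_leq.
      rewrite -[X in (X <= _)%N](prednK sq0) ltnNge; apply/negP => /leq_sizeP/(_ _ (leqnn _)).
      by rewrite lq' => /eqP; rewrite oner_eq0.
    suff /minP : Q (size q) by rewrite -sP leqNgt sq.
    apply/asboolP; exists (a'%:P * q); split=> //.
    - by rewrite monicE lead_coefE sq' lq'.
    - by apply: poly_overM => //; exact: poly_overC.
    - rewrite /ev1 rmorphM /= map_polyC hornerM hornerC valM /=.
      by rewrite valV // -va oppe0 add0e.
  pose u := a%:P * 'X^((size q).-1).
  have ou : poly_over O u.
    by apply: poly_overM => //; [apply: poly_overC => //; exact: oq|exact: poly_overXn].
  have cu j : u`_j = if j == (size q).-1 then a else 0.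
    by rewrite /u coefCM coefXn; case: eqP => _; rewrite ?mulr1 ?mulr0.
  have hu j : (0 < vL (u`_j).1)%E by rewrite cu; case: eqP => _ //; rewrite val0.
  have sqq : (size (q - u)%R < size q)%N.
    rewrite -[X in (_ < X)%N](prednK sq0) ltnS; apply/leq_sizeP => j hj.
    rewrite coefB cu; case: eqP => [->|/eqP jn]; first by rewrite -lead_coefE subrr.
    by rewrite subr0 nth_default // -(prednK sq0) ltn_neqAle eq_sym jn.
  have h : (0 < vL (ev1 (q - u)%R x))%E.
    rewrite /ev1 rmorphB hornerD hornerN; apply: val_ltB => //.
    apply: poly_val_gt => [j|//]; rewrite coef_map; exact: hu.
  have := IH (q - u) (leq_trans sqq sk) (poly_overB rO oq ou) (ltn_trans sqq sq) h i.
  by rewrite coefB => h'; rewrite -(subrK (u`_i) q`_i); apply: val_ltD.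
have small q y : poly_over O q -> (0 <= vL y)%E -> (forall i, (0 < vL (q`_i).1)%E) ->
    (0 < vL (ev1 q y))%E.
  by move=> oq y0 hq; apply: poly_val_gt => // j; rewrite coef_map; exact: hq.
(* The separable polynomial p0 is congruent to a multiple of P, so P is
   separable as well. *)
have hdP : vL (map_poly fst P)^`().[x] = 0%E.
  have [s [r [os or e sr]]] := monic_division rO mP oP (lift_O ip0).
  have e1 : map_poly iL p0 = map_poly fst s * map_poly fst P + map_poly fst r.
    by rewrite -lift1 e rmorphD rmorphM.
  have s0 : (0 <= vL (ev1 s x))%E by apply: integral_poly_horner => //; exact: O_ip1.
  have r0 : (0 < vL (ev1 r x))%E.
    have -> : ev1 r x = (map_poly iL p0).[x] - ev1 s x * ev1 P x.
      by rewrite e1 hornerD hornerM /ev1; ring.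
    apply: val_ltB => //; rewrite mulrC; exact: val_gt0M.
  have hr := low r or sr r0.
  have dr : (0 < vL (map_poly fst r)^`().[x])%E.
    apply: poly_val_gt => // k; rewrite coef_deriv coef_map.
    by apply: val_gt0Mn; exact: hr.
  have ds : (0 <= vL (map_poly fst s)^`().[x])%E.
    rewrite deriv_map; apply: integral_poly_horner => //; apply: O_ip1; exact: poly_over_deriv.
  have dP : (0 <= vL (map_poly fst P)^`().[x])%E.
    rewrite deriv_map; apply: integral_poly_horner => //; apply: O_ip1; exact: poly_over_deriv.
  pose A := ev1 s x * (map_poly fst P)^`().[x].
  pose B := (map_poly fst s)^`().[x] * ev1 P x; pose C := (map_poly fst r)^`().[x].
  have hu : vL A = 0%E.
    have hB : (0 < vL (B + C)%R)%E.
      by apply: val_ltD => //; rewrite /B mulrC; exact: val_gt0M.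
    have h : vL (A + (B + C)) = 0%E.
      rewrite -[RHS]hdp0 e1 derivD derivM; congr (vL _).
      by rewrite /A /B /C /ev1 !hornerD !hornerM; ring.
    have eA : A + (B + C) - A = B + C by ring.
    by rewrite -h; apply: val_eqB; rewrite h eA.
  move: hu; rewrite valM => hu; apply/eqP; rewrite eq_le dP andbT -hu.
  by rewrite leeDr.
have xm := monic_neq0 mP.
have [th [rth hth]] := hensel cL iP1 x0 hP hdP.
have th0 : (0 <= vL th)%E.
  by rewrite -(subrK x th); apply: val_leD => //; apply: ltW.
have sP1 : (1 < size P)%N.
  rewrite ltnNge; apply/negP => sP1; move: hP.
  have -> : P = 1.
    move: mP; rewrite (size1_polyC sP1) monicE lead_coefC => /eqP ->.
    by [].
  by rewrite /ev1 rmorph1 hornerC val1 ltxx.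
have mP2 : map_poly snd P \is monic by apply: monic_map.
have [th' rth'] : exists y, root (map_poly snd P) y.
  by apply: rootM => //; [exact: O_ip2|rewrite size_map_poly_id0 // (monicP mP) oner_neq0].
have th'0 : (0 <= vM th')%E := integral_poly_root_ge0 mP2 (O_ip2 oP) rth'.
have evx q : poly_over O q -> (0 < vL (ev1 q th))%E -> (0 < vL (ev1 q x))%E.
  move=> oq h; rewrite -(subrK (ev1 q th) (ev1 q x)); apply: val_ltD => //.
  by apply: integral_poly_sub => //; [exact: O_ip1|rewrite val_subC].
(* Inclusion of the ideal at th in the ideal at th'. *)
have JI q : poly_over O q -> (0 < vL (ev1 q th))%E -> (0 < vM (ev2 q th'))%E.
  move=> oq hq; have [s [r [os or e sr]]] := monic_division rO mP oP oq.
  have r0 : (0 < vL (ev1 r x))%E.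
    apply: evx => //; move: hq; rewrite e /ev1 rmorphD rmorphM hornerD hornerM.
    by rewrite rth mulr0 add0r.
  have hr := low r or sr r0.
  rewrite e /ev2 rmorphD rmorphM hornerD hornerM (rootP rth') mulr0 add0r.
  by apply: poly_val_gt => // j; rewrite coef_map /= -eG //; have [] := or j.
(* Maximality of the ideal at th: q has an inverse modulo that ideal. *)
have unit2 q : poly_over O q -> vL (ev1 q th) = 0%E -> vM (ev2 q th') = 0%E.
  move=> oq hq; have [p1 [ip1 h1]] := residue_poly_inverse hq.
  pose r := lift p1 \Po q; have or : poly_over O r.
    by apply: poly_over_comp => //; exact: lift_O.
  have o1 : poly_over O (q * r - 1).
    apply: poly_overB => //; [exact: poly_overM|].
    by apply: poly_overC => //; exact: subring1.
  have er : ev1 r th = (map_poly iL p1).[ev1 q th].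
    by rewrite /ev1 /r map_comp_poly horner_comp lift1.
  have E1 : ev1 (q * r - 1) th = ev1 q th * ev1 r th - 1.
    by rewrite /ev1 rmorphB rmorphM rmorph1 hornerD hornerN hornerM hornerC.
  have E2 : ev2 (q * r - 1) th' = ev2 q th' * ev2 r th' - 1.
    by rewrite /ev2 rmorphB rmorphM rmorph1 hornerD hornerN hornerM hornerC.
  have := JI _ o1; rewrite E1 E2 er => /(_ h1) h.
  have q0 : (0 <= vM (ev2 q th'))%E := integral_poly_horner (O_ip2 oq) th'0.
  have r0 : (0 <= vM (ev2 r th'))%E := integral_poly_horner (O_ip2 or) th'0.
  have : vM (ev2 q th' * ev2 r th') = 0%E.
    have := @val_eqB _ vM 1 (ev2 q th' * ev2 r th'); rewrite val1; apply.
    by rewrite val_subC.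
  rewrite valM => hqr; apply/eqP; rewrite eq_le q0 andbT -hqr.
  by rewrite leeDl.
suff Gth : G (th, th').
  by exists th; [exists th'|rewrite val_subC].
apply: maxG => p op; rewrite ev1E ev2E /=.
have [s [r [os or e sr]]] := monic_division rG mP (O_G oP) op.
have -> : ev1 p th = ev1 r th.
  by rewrite e /ev1 rmorphD rmorphM hornerD hornerM rth mulr0 add0r.
have -> : ev2 p th' = ev2 r th'.
  by rewrite e /ev2 rmorphD rmorphM hornerD hornerM (rootP rth') mulr0 add0r.
have [->|r0] := eqVneq r 0; first by rewrite /ev1 /ev2 !rmorph0 !horner0 !val0.
(* The remainder r is c times an integral polynomial with a coefficient 1. *)
have [i hi] : exists i, forall j, (vL (r`_i).1 <= vL (r`_j).1)%E.
  case sr' : (size r) => [|k]; first by move/eqP: sr'; rewrite size_poly_eq0 (negPf r0).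
  have [i hi] := val_argmin vL (fun j : 'I_k.+1 => (r`_j).1); exists i => j.
  have [jk|jk] := ltnP j k.+1; first exact: (hi (Ordinal jk)).
  by rewrite [r`_j]nth_default ?sr' // val0 leey.
set c := r`_i in hi; have Gc : G c by exact: or.
have c1 : c.1 != 0.
  apply: contra_neq r0 => c1; apply/polyP => j; rewrite coef0.
  have rj1 : (r`_j).1 == 0 by have := hi j; rewrite c1 val0 leye_eq val_eqy.
  by move: (rj1); rewrite graph_eq0 // => rj2; rewrite [r`_j]surjective_pairing (eqP rj1) (eqP rj2).
have c2 : c.2 != 0 by rewrite -graph_eq0.
pose c' := (c.1^-1, c.2^-1); pose r1 := c'%:P * r.
have cc' : c * c' = 1 by rewrite {1}[c]surjective_pairing; congr (_, _) => /=; rewrite divff.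
have or1 : poly_over O r1.
  move=> j; rewrite coefCM; split.
    by apply: subringM => //; exact: maximal_graphV.
  by rewrite /= valM valV // addeC sube_ge0 // ?hi //; have [a ->] := val_fin vL c1.
have er : r = c%:P * r1 by rewrite /r1 mulrA -polyCM cc' mul1r.
have u1 : vL (ev1 r1 th) = 0%E.
  apply/eqP; rewrite eq_le integral_poly_horner ?andbT; [|exact: O_ip1|by []].
  rewrite leNgt; apply/negP => h.
  have sr1 : (size r1 < size P)%N.
    by apply: leq_ltn_trans sr; rewrite /r1 mul_polyC size_scale_leq.
  have := low r1 or1 sr1 (evx _ or1 h) i.
  by rewrite coefCM mulrC -/c cc' val1 ltxx.
have u2 := unit2 _ or1 u1.
have -> : ev1 r th = c.1 * ev1 r1 th.
  by rewrite {1}er /ev1 rmorphM hornerM /= map_polyC hornerC.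
have -> : ev2 r th' = c.2 * ev2 r1 th'.
  by rewrite {1}er /ev2 rmorphM hornerM /= map_polyC hornerC.
by rewrite !valM u1 u2 !adde0 eG.
Qed.

(** Below the exponent e the terms of p.[z] have distinct values, so on either
    side the value of the sum is the least value of a term. *)
Lemma graph_values_eq e (p : {poly L * M}) z :
  (forall k a, graph_dom a -> vL a = (g *+ k)%:E -> (0 < k < e)%N -> False) ->
  poly_over G p -> (size p <= e)%N -> vL z.1 = g%:E -> vM z.2 = g%:E ->
  vL p.[z].1 = vM p.[z].2.
Proof.
move=> mine op sp vz1 vz2; rewrite ev1E ev2E /ev1 /ev2.
case: e mine sp => [|e] mine sp.
  by move: sp; rewrite leqn0 size_poly_eq0 => /eqP ->; rewrite !rmorph0 !horner0 !val0.
have s1 : (size (map_poly fst p) <= e.+1)%N.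
  by apply: leq_trans sp; apply: size_poly.
have s2 : (size (map_poly snd p) <= e.+1)%N.
  by apply: leq_trans sp; apply: size_poly.
rewrite (horner_coef_wide _ s1) (horner_coef_wide _ s2).
have same i : vL ((map_poly fst p)`_i * z.1 ^+ i) = vM ((map_poly snd p)`_i * z.2 ^+ i).
  by rewrite !coef_map !valM (valX _ vz1) (valX _ vz2) eG.
have Ep (i : 'I_e.+1) : graph_dom (map_poly fst p)`_i.
  by exists (p`_i).2; rewrite coef_map -surjective_pairing; exact: op.
have dist := distinct_terms graph_dom_subfield mine Ep vz1.
have [i1 [-> h1]] := val_sum_distinct dist.
have dist2 (i j : 'I_e.+1) : i != j -> (map_poly snd p)`_i * z.2 ^+ i != 0 ->
    vM ((map_poly snd p)`_i * z.2 ^+ i) != vM ((map_poly snd p)`_j * z.2 ^+ j).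
  move=> ij n0; rewrite -!same; apply: dist => //.
  by apply: contra_neq n0 => n0; apply/eqP; rewrite -(val_eqy vM) -same n0 val0.
have [i2 [-> h2]] := val_sum_distinct dist2.
by apply/eqP; rewrite eq_le -same h1 /= !same h2.
Qed.

(** Let e be the ramification index of L over the domain E of a maximal graph.
    As E has the residue field of L, the uniformizer pi satisfies an Eisenstein
    equation pi ^+ e = \sum_i c i * pi ^+ i over E. A root pi' in M of the
    corresponding equation has the value of pi, so polynomials over G have
    equal values at pi and pi'; thus pi is in E, and then so is all of L. *)
Lemma maximal_graph_total y : graph_dom y.
Proof.
have pi0 : pi != 0 by apply: val_neq0 vpi.
have fE := graph_dom_subfield; have [rE iE] := fE; have cE := graph_dom_closed.
have span := totally_ramified_span cL g0 vpi discL fE cE maximal_graph_residue.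
suff Epi : graph_dom pi.
  have [c [Ec _ ->]] := span 1%N pi isT Epi vpi y.
  apply: subring_sum => // i _; apply: subringM => //; exact: subringX.
pose Q e := (0 < e)%N && `[< exists2 a, graph_dom a & vL a = (g *+ e)%:E >].
have exQ : exists e, Q e.
  exists m; rewrite /Q m0; apply/asboolP; exists (iL t); last by rewrite extL.
  by exists (iM t); exact: kG.
case: (ex_minnP exQ) => -[|e'] //; set e := e'.+1 => /andP[e0 /asboolP[a0 Ea0 va0]] mine.
have minE k a : graph_dom a -> vL a = (g *+ k)%:E -> (0 < k < e)%N -> False.
  move=> Ea va /andP[k0]; rewrite ltnNge mine // /Q k0; apply/asboolP; by exists a.
have [c [Ec vc eqpi]] := span e a0 e0 Ea0 va0 (pi ^+ e).
have /choice[c' Gc] := Ec.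
have vpie : vL (pi ^+ e) = (g *+ e)%:E by apply: valX.
have vc1 (i : 'I_e) : ((g *+ (e - i))%:E <= vL (c i))%E.
  have -> : c i = c i * pi ^+ i / pi ^+ i by rewrite mulfK // expf_neq0.
  have -> : g *+ (e - i) = g *+ e - g *+ i by rewrite mulrnBr // ltnW.
  apply: val_leM; first by apply: vc; rewrite vpie.
  by rewrite valV ?expf_neq0 // (valX _ vpi).
have vc2 (i : 'I_e) : ((g *+ (e - i))%:E <= vM (c' i))%E by have := eG (Gc i); rewrite /= => <-.
pose q : {poly L * M} := \sum_(i < e) (c i, c' i)%:P * 'X^i.
pose P := 'X^e - q.
have Oc (i : 'I_e) : O (c i, c' i).
  split; [exact: Gc|apply: le_trans (vc1 i)].
  by rewrite lee_fin mulrn_wge0 // ltW.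
have Oq : poly_over O q.
  apply: poly_over_sum => // i _; apply: poly_overM => //; last exact: poly_overXn.
  by apply: poly_overC => //; exact: Oc.
have sq : (size q <= e)%N by exact: size_sum_low.
have OP : poly_over O P by apply: poly_overB => //; exact: poly_overXn.
have sP : size P = e.+1 by exact: size_XnBlow.
have mP : P \is monic by exact: monic_XnBlow.
have ev1P y1 : ev1 P y1 = y1 ^+ e - \sum_(i < e) c i * y1 ^+ i.
  by rewrite /ev1 rmorphB /= map_polyXn map_sum_low hornerD hornerN hornerXn horner_sum_low.
have ev2P y1 : ev2 P y1 = y1 ^+ e - \sum_(i < e) c' i * y1 ^+ i.
  by rewrite /ev2 rmorphB /= map_polyXn map_sum_low hornerD hornerN hornerXn horner_sum_low.
have mP2 : map_poly snd P \is monic by apply: monic_map.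
have [pi' rpi'] : exists y, root (map_poly snd P) y.
  apply: rootM => //; first exact: O_ip2.
  by rewrite size_map_poly_id0 ?sP // (monicP mP) oner_neq0.
have epi' : pi' ^+ e = \sum_(i < e) c' i * pi' ^+ i.
  by apply/eqP; rewrite -subr_eq0 -ev2P.
(* If the value of pi' were less than g, then pi' ^+ e would dominate its
   equation; if it were greater, the constant term, of value e * g, would. *)
have vpi' : vM pi' = g%:E.
  have vc0 : vM (c' ord0) = (g *+ e)%:E.
    have dist := distinct_terms fE minE Ec vpi.
    have [i [hi _]] := val_sum_distinct dist.
    have ci0 : c i != 0.
      by apply/eqP => ci0; move: hi; rewrite -eqpi vpie ci0 mul0r val0.
    have [r er] := val_fin vL ci0.
    have vci : vL (c i) = (g *+ (e - i))%:E.
      move: hi; rewrite -eqpi vpie valM (valX _ vpi) er -EFinD => -[] h.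
      by rewrite mulrnBr ?(ltnW (ltn_ord i)) // h addrK.
    have i0 : i = ord0.
      apply/val_inj/eqP; rewrite /= -leqn0 leqNgt; apply/negP => i0.
      by apply: (minE _ _ (Ec i) vci); have := ltn_ord i; lia.
    by rewrite -(eG (Gc ord0)) /= -i0 vci i0 subn0.
  have [z0|z0] := eqVneq pi' 0.
    move: epi'; rewrite z0 expr0n big_ord_recl expr0 mulr1 big1 ?addr0.
      by move=> h; move: vc0; rewrite -h val0.
    by move=> i _; rewrite /= expr0n mulr0.
  have [d ed] := val_fin vM z0.
  have [dg|dg|dg] := ltgtP d g; last by rewrite ed dg.
  - have : vM (pi' ^+ e) = vM (pi' ^+ e) by [].
    rewrite {2}epi' (valX _ ed) => /eqP; rewrite eq_sym gt_eqF //.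
    apply: val_lt_sum => i _; apply: (@lt_le_trans _ _ ((g *+ (e - i) + d *+ i)%:E)).
      rewrite lte_fin -{1}(@subnK i e) ?(ltnW (ltn_ord i)) // mulrnDr ltrD2r.
      by rewrite ltr_pMn2r // subn_gt0.
    by apply: val_leM; rewrite ?(valX _ ed).
  - have : (((g *+ e)%:E) < vM (c' ord0))%E; last by rewrite vc0 ltxx.
    have -> : c' ord0 = pi' ^+ e - \sum_(i < e') c' (fintype.lift ord0 i) * pi' ^+ i.+1.
      by rewrite epi' big_ord_recl expr0 mulr1 addrK.
    apply: val_ltB; first by rewrite (valX _ ed) lte_fin ltr_pMn2r.
    apply: val_lt_sum => i _.
    apply: (@lt_le_trans _ _ ((g *+ (e - i.+1) + d *+ i.+1)%:E)).
      have -> : g *+ e = g *+ (e - i.+1) + g *+ i.+1.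
        by rewrite -mulrnDr subnK // ltnS ltnW.
      rewrite lte_fin ltrD2l.
      by rewrite ltr_pMn2r.
    by apply: val_leM; rewrite ?(valX _ ed) //; apply: vc2.
exists pi'; apply: maxG => p op.
have [s [r [os or ep sr]]] := monic_division rG mP (O_G OP) op.
have zP : P.[(pi, pi')] = 0.
  have z1 : P.[(pi, pi')].1 = 0 by rewrite ev1E ev1P -eqpi subrr.
  have z2 : P.[(pi, pi')].2 = 0 by rewrite ev2E ev2P -epi' subrr.
  by rewrite [LHS]surjective_pairing z1 z2.
rewrite ep hornerD hornerM zP mulr0 add0r.
apply: (@graph_values_eq e) => //.
by rewrite -ltnS -sP.
Qed.

End Maximal.

(** The graph of j is a maximal isometric graph containing G0; by the preceding
    lemma its domain is L. *)
Theorem isometric_embedding G0 : isograph G0 -> exists j : {rmorphism L -> M},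
  [/\ val_extends vL vM j, forall a, j (iL a) = iM a & forall z, G0 z -> j z.1 = z.2].
Proof.
move=> iG0; have [G [iG sG mG]] := maximal_isometric_graph iG0.
have /choice[j Gj] := maximal_graph_total iG mG.
have [rG eG kG] := iG; have [G1 GB GM] := rG.
have uniq x b c : G (x, b) -> G (x, c) -> b = c.
  move=> hb hc; apply/eqP; rewrite -subr_eq0 -(val_eqy vM).
  by have /eG /= <- := GB _ _ hb hc; rewrite subrr val0.
have nm : nmod_morphism j.
  split=> [|x y]; first by apply: (uniq 0) => //; exact: (subring0 rG).
  by apply: (uniq (x + y)) => //; exact: (subringD rG (Gj x) (Gj y)).
have mm : monoid_morphism j.
  split=> [|x y]; first by apply: (uniq 1).
  by apply: (uniq (x * y)) => //; exact: (subringM rG (Gj x) (Gj y)).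
pose jm := GRing.isNmodMorphism.Build L M j nm.
pose jr := GRing.isMonoidMorphism.Build L M j mm.
pose J : {rmorphism L -> M} := HB.pack j jm jr.
exists J; split.
- by move=> x; have /eG := Gj x.
- by move=> a; apply: (uniq (iL a)).
- by move=> [x y] /sG Gz; apply: (uniq x).
Qed.

End Embedding.

(** * Residue fields *)

Section Residues.
Variables (L : fieldType) (v : valuation L).
Implicit Types x y : L.

Lemma residue1 : residue v 1 = 1.
Proof. by rewrite -[1 in LHS]/(val (1 : vring v)) residue_val piE. Qed.

Lemma residue0 : residue v 0 = 0.
Proof. by rewrite -[0 in LHS]/(val (0 : vring v)) residue_val piE. Qed.

Lemma residueD x y : (0 <= v x)%E -> (0 <= v y)%E ->
  residue v (x + y) = residue v x + residue v y.
Proof.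
move=> hx hy; pose a : vring v := Vring hx; pose b : vring v := Vring hy.
by rewrite -[x]/(val a) -[y]/(val b) -[_ + _ in LHS]/(val (a + b)) !residue_val rmorphD.
Qed.

Lemma residueM x y : (0 <= v x)%E -> (0 <= v y)%E ->
  residue v (x * y) = residue v x * residue v y.
Proof.
move=> hx hy; pose a : vring v := Vring hx; pose b : vring v := Vring hy.
by rewrite -[x]/(val a) -[y]/(val b) -[_ * _ in LHS]/(val (a * b)) !residue_val rmorphM.
Qed.

Lemma residue_sum n (F : 'I_n -> L) : (forall i, (0 <= v (F i))%E) ->
  residue v (\sum_i F i) = \sum_i residue v (F i).
Proof.
move=> hF; elim: n F hF => [|n IH] F hF; first by rewrite !big_ord0 residue0.
by rewrite !big_ord_recl residueD ?IH //; apply: val_le_sum.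
Qed.

Lemma residueMn x n : (0 <= v x)%E -> residue v (x *+ n) = residue v x *+ n.
Proof.
move=> hx; rewrite -(card_ord n) -!sumr_const residue_sum //.
Qed.

Lemma residueX x n : (0 <= v x)%E -> residue v (x ^+ n) = residue v x ^+ n.
Proof.
move=> hx; elim: n => [|n IH]; first exact: residue1.
by rewrite !exprS residueM ?IH // val_ge0X.
Qed.

Lemma residue_eq0 x : (0 <= v x)%E -> (residue v x == 0) = (0 < v x)%E.
Proof. by move=> hx; rewrite -residue0 residue_eq ?subr0 // inE val0. Qed.

Lemma residue_lift_ge0 (c : residue_field v) : (0 <= v (residue_lift c))%E.
Proof. by have : residue_lift c \in valuation_ring v by exact: valP. Qed.

End Residues.

Section ResidueExtension.
Variables (K L : fieldType) (v : valuation K) (w : valuation L) (i : {rmorphism K -> L}).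
Hypothesis over : forall y, (i y \in valuation_ring w) = (y \in valuation_ring v).

Let over_ge0 y : (0 <= v y)%E -> (0 <= w (i y))%E.
Proof. by move=> h; have := over y; rewrite !inE h. Qed.

Let mapE x : (0 <= v x)%E -> residue_map w i (residue v x) = residue w (i x).
Proof. exact: residue_mapE. Qed.

Lemma residue_map_rmorphism :
  exists f : {rmorphism residue_field v -> residue_field w}, residue_map w i =1 f.
Proof.
have nm : nmod_morphism (residue_map w i : residue_field v -> residue_field w).
  split=> [|x y]; first by rewrite -residue0 mapE ?val0 ?leey // rmorph0 residue0.
  rewrite -[x]residue_liftK -[y]residue_liftK.
  have hx := residue_lift_ge0 x; have hy := residue_lift_ge0 y.
  rewrite -residueD // !mapE ?rmorphD ?residueD //; try exact: over_ge0.
  exact: val_leD.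
have mm : monoid_morphism (residue_map w i : residue_field v -> residue_field w).
  split=> [|x y]; first by rewrite -residue1 mapE ?val1 // rmorph1 residue1.
  rewrite -[x]residue_liftK -[y]residue_liftK.
  have hx := residue_lift_ge0 x; have hy := residue_lift_ge0 y.
  rewrite -residueM // !mapE ?rmorphM ?residueM //; try exact: over_ge0.
  exact: val_ge0M.
pose jm := GRing.isNmodMorphism.Build _ _ (residue_map w i) nm.
pose jr := GRing.isMonoidMorphism.Build _ _ (residue_map w i) mm.
pose f : {rmorphism residue_field v -> residue_field w} := HB.pack (residue_map w i) jm jr.
by exists f.
Qed.

Lemma residue_horner (f : {rmorphism residue_field v -> residue_field w})
    (p : {poly K}) (q : {poly residue_field v}) x :
  residue_map w i =1 f -> integral_poly v p -> (forall j, residue v p`_j = q`_j) ->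
  (0 <= w x)%E ->
  residue w (map_poly i p).[x] = (map_poly f q).[residue w x].
Proof.
move=> hf ip hq hx.
have s1 : (size (map_poly i p) <= maxn (size p) (size q))%N.
  by rewrite (leq_trans (size_poly _ _)) // leq_maxl.
have s2 : (size (map_poly f q) <= maxn (size p) (size q))%N.
  by rewrite (leq_trans (size_poly _ _)) // leq_maxr.
rewrite (horner_coef_wide _ s1) (horner_coef_wide _ s2).
have hc j : (0 <= w (map_poly i p)`_j)%E by rewrite coef_map; apply: over_ge0.
rewrite residue_sum => [|j]; last by apply: val_ge0M => //; apply: val_ge0X.
apply: eq_bigr => j _; rewrite residueM ?residueX ?val_ge0X //.
by rewrite !coef_map /= -hf -hq mapE.
Qed.

(** The minimal polynomial of an algebraic residue class over a perfect residue
    field is separable; any monic lift of it will do. *)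
Lemma residue_simple_root : perfect_field (residue_field v) ->
  algebraic_ext (residue_map (v := v) w i) ->
  forall x, (0 <= w x)%E -> residue_separable v w i x.
Proof.
move=> perf alg x hx; have [f hf] := residue_map_rmorphism.
set c := residue w x.
have mapf q : map_poly (residue_map w i) q = map_poly f q.
  by apply/polyP => j; rewrite !coef_poly; case: ifP.
pose Q n := `[< exists q : {poly residue_field v},
  [/\ q != 0, root (map_poly f q) c & size q = n] >].
have exQ : exists n, Q n.
  have [q q0 rq] := alg c; rewrite mapf in rq.
  by exists (size q); apply/asboolP; exists q; split; [exact: q0|exact: rq|].
case: (ex_minnP exQ) => n /asboolP[q [q0 rq sq]] minn.
have minq r : r != 0 -> root (map_poly f r) c -> (size q <= size r)%N.
  by move=> r0 rr; rewrite sq; apply: minn; apply/asboolP; exists r.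
have irr : irreducible_poly q.
  split.
    rewrite ltnNge; apply/negP => s1; move: rq q0; rewrite (size1_polyC s1) map_polyC rootC.
    by rewrite fmorph_eq0 => /eqP->; rewrite polyC0 eqxx.
  move=> d sd dq; have d0 : d != 0 by apply: dvdpN0 dq q0.
  have [e eq] := dvdpP _ _ dq; have e0 : e != 0.
    by apply: contra_neq q0 => e0; rewrite eq e0 mul0r.
  rewrite -dvdp_size_eqp //; rewrite eqn_leq dvdp_leq //=.
  move: rq; rewrite {1}eq rmorphM rootM => /orP[re|rd]; last exact: minq.
  have := minq _ e0 re; rewrite eq size_mul // => h; exfalso.
  move: sd d0 e0 h; rewrite -!size_poly_gt0.
  case: (size d) => [|[|k]] //; case: (size e) => // l _ _ _ h; lia.
have sepq := perf q irr.
pose q1 := (lead_coef q)^-1 *: q.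
have lq0 : (lead_coef q)^-1 != 0 by rewrite invr_eq0 lead_coef_eq0.
have mq1 : q1 \is monic by rewrite monicE lead_coefZ mulVf // lead_coef_eq0.
have rq1 : root (map_poly f q1) c.
  by rewrite map_polyZ rootZ // fmorph_eq0.
have dq1 : (map_poly f q1)^`().[c] != 0.
  rewrite map_polyZ derivZ hornerZ mulf_neq0 ?fmorph_eq0 //.
  apply: coprimep_root rq; rewrite deriv_map coprimep_map.
  by move: sepq; rewrite unlock.
have q10 := monic_neq0 mq1.
pose d := (size q1).-1; pose p := \poly_(j < d) residue_lift q1`_j + 'X^d.
have sq1 : size q1 = d.+1 by rewrite /d prednK // size_poly_gt0.
have mp : p \is monic.
  by rewrite monicE /p addrC lead_coefDl ?lead_coefXn // size_polyXn ltnS size_poly.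
have pj j : (0 <= v p`_j)%E /\ residue v p`_j = q1`_j.
  rewrite coefD coef_poly coefXn; case: ltngtP => h /=.
  - by rewrite addr0 residue_liftK; split=> //; exact: residue_lift_ge0.
  - by rewrite addr0 val0 leey residue0 nth_default // sq1.
  - by rewrite add0r val1 residue1 h -lead_coefE (monicP mq1).
have ip : integral_poly v p by move=> j; have [] := pj j.
have hrho j : residue v p`_j = q1`_j by have [] := pj j.
have ip1 : integral_poly w (map_poly i p) by move=> j; rewrite coef_map; apply: over_ge0.
have idp := integral_poly_deriv ip.
exists p; split=> //.
- rewrite -residue_eq0 ?integral_poly_horner //.
  by rewrite (residue_horner hf ip hrho hx) -/c (rootP rq1).
- have hd : (0 <= w (map_poly i p)^`().[x])%E.
    by apply: integral_poly_horner => //; exact: integral_poly_deriv.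
  apply/eqP; rewrite eq_le hd andbT leNgt -residue_eq0 //.
  rewrite deriv_map (@residue_horner f _ q1^`()) //.
    by rewrite -deriv_map.
  by move=> j; rewrite !coef_deriv residueMn ?hrho.
Qed.

Lemma finite_residue_spanP : finite_ext (residue_map (v := v) w i) <->
  exists n (b : 'I_n -> L), (forall k, (0 <= w (b k))%E) /\
    forall y, (0 <= w y)%E -> exists c : 'I_n -> K, (forall k, (0 <= v (c k))%E) /\
      (0 < w (y - \sum_k i (c k) * b k)%R)%E.
Proof.
split=> [[n [b hb]]|[n [b [b0 hb]]]].
  exists n, (fun k => residue_lift (b k)); split; first by move=> k; exact: residue_lift_ge0.
  move=> y hy; have [c hc] := hb (residue w y).
  have hs k : (0 <= w (i (residue_lift (c k)) * residue_lift (b k))%R)%E.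
    by apply: val_ge0M; [apply/over_ge0|]; exact: residue_lift_ge0.
  exists (fun k => residue_lift (c k)); split; first by move=> k; exact: residue_lift_ge0.
  rewrite -residue_eq //; last by rewrite inE; apply: val_le_sum.
  rewrite hc residue_sum //; apply/eqP/eq_bigr => k _.
  rewrite residueM ?residue_liftK //; [exact/over_ge0/residue_lift_ge0|exact: residue_lift_ge0].
exists n, (fun k => residue w (b k)) => y.
have [c [c0 hc]] := hb _ (residue_lift_ge0 y).
exists (fun k => residue v (c k)); rewrite -[LHS]residue_liftK.
have hs k : (0 <= w (i (c k) * b k)%R)%E by apply: val_ge0M => //; apply/over_ge0.
apply/eqP; rewrite (_ : \sum_k _ = residue w (\sum_k i (c k) * b k)).
  rewrite residue_eq //; first exact: residue_lift_ge0.
  by rewrite inE; apply: val_le_sum.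
rewrite residue_sum //; apply: eq_bigr => k _.
by rewrite residueM ?mapE //; exact: over_ge0.
Qed.

End ResidueExtension.

(** * Scaling of valuations *)

Section Scaling.
Variables (c : rat) (L : fieldType) (w : valuation L).
Hypothesis c0 : 0 < c.

Definition escale (x : \bar rat) : \bar rat := if x is r%:E then (c * r)%:E else x.

Fact scale_val_eqy x : (escale (w x) == +oo%E) = (x == 0).
Proof. by rewrite -(val_eqy w); case: (w x). Qed.
Fact scale_val_neqNy x : escale (w x) != -oo%E.
Proof. by have := val_neqNy w x; case: (w x). Qed.
Fact scale_valM x y : escale (w (x * y)) = (escale (w x) + escale (w y))%E.
Proof.
rewrite valM; case: (w x) (val_neqNy w x) => [a| |] // _;
  case: (w y) (val_neqNy w y) => [b| |] // _.
by rewrite /= mulrDr.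
Qed.
Lemma escale_le a b : (a <= b)%E -> (escale a <= escale b)%E.
Proof.
case: a => [a| |]; case: b => [b| |] //=; rewrite ?leey ?leNye ?lee_fin //.
by rewrite ler_pM2l.
Qed.
Fact scale_val_geD x y :
  (mine (escale (w x)) (escale (w y)) <= escale (w (x + y)%R))%E.
Proof.
have := val_geD w x y; rewrite /mine.
case: ltP => h; case: ltP => h' /escale_le // h2.
- by apply: le_trans h' h2.
- by apply: le_trans (ltW h') h2.
Qed.

Definition scale_valuation : valuation L :=
  Valuation scale_val_eqy scale_val_neqNy scale_valM scale_val_geD.

Lemma scale_valuation_ge0 x : (0 <= scale_valuation x)%E = (0 <= w x)%E.
Proof. by rewrite /=; case: (w x) => //= r; rewrite !lee_fin pmulr_rge0. Qed.

Lemma scale_valuation_gt0 x : (0 < scale_valuation x)%E = (0 < w x)%E.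
Proof. by rewrite /=; case: (w x) => //= r; rewrite !lte_fin pmulr_rgt0. Qed.

Lemma scale_value_group S : value_group scale_valuation S = [set c * x | x in value_group w S].
Proof.
apply/seteqP; split=> [r [x Sx /= h]|_ [r [x Sx h] <-]]; last first.
  by exists x => //=; rewrite h.
case E : (w x) h => [a| |] //= [<-]; exists a => //; by exists x.
Qed.

End Scaling.

Lemma group_index_scale (c : rat) (H G : set rat) : c != 0 ->
  group_index [set c * x | x in H] [set c * x | x in G] = group_index H G.
Proof.
move=> c0; pose f (A : set rat) := [set c * x | x in A].
have finj : injective f.
  move=> A B AB; apply/seteqP; split=> x hx.
    have : f B (c * x) by rewrite -AB; exists x.
    by move=> [y By /(mulfI c0) <-].
  have : f A (c * x) by rewrite AB; exists x.
  by move=> [y By /(mulfI c0) <-].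
have E : cosets [set c * x | x in H] [set c * x | x in G] = f @` cosets H G.
  apply/seteqP; split.
    move=> _ [_ [g Gg <-] <-]; exists [set g + h | h in H]; first by exists g.
    apply/seteqP; split=> y.
      by move=> [_ [h Hh <-] <-]; rewrite mulrDr; exists (c * h) => //; exists h.
    by move=> [_ [h Hh <-] <-]; rewrite -mulrDr; exists (g + h) => //; exists h.
  move=> _ [_ [g Gg <-] <-]; exists (c * g); first by exists g.
  apply/seteqP; split=> y.
    by move=> [_ [h Hh <-] <-]; rewrite -mulrDr; exists (g + h) => //; exists h.
  by move=> [_ [h Hh <-] <-]; rewrite mulrDr; exists (c * h) => //; exists h.
rewrite /group_index E.
have Ef : finite_set (f @` cosets H G) = finite_set (cosets H G).
  by apply/eq_finite_set/inj_card_eq => A B _ _; exact: finj.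
rewrite Ef; case: asboolP => // fin.
by rewrite fset_set_image // card_imfset.
Qed.

(** The values of x and t are in some ratio p / q, and then x ^ q / t ^ p is a
    unit. So the value of x can be recovered from the value of t and the
    valuation ring. *)
Lemma valuation_commensurable (L : fieldType) (v : valuation L) x t (a r : rat) :
  v t = a%:E -> a != 0 -> v x = r%:E ->
  exists p q : int, [/\ 0 < q, v (x ^ q / t ^ p) = 0%E & r * q%:~R = a * p%:~R].
Proof.
move=> vt a0 vx; pose p := numq (r / a); pose q := denq (r / a).
have e : r * q%:~R = a * p%:~R.
  have h : r / a = p%:~R / q%:~R by rewrite divq_num_den.
  have q0 : (q%:~R : rat) != 0 by rewrite intr_eq0 denq_neq0.
  by apply: (mulIf (invr_neq0 a0)); rewrite mulrAC h divfK // mulrAC divff // mul1r.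
exists p, q; split=> //; first exact: denq_gt0.
have t0 := val_neq0 vt.
have vtp := valXz p vt.
rewrite valM (valXz _ vx) valV ?(val_neq0 vtp) // vtp -EFinN -EFinD.
by rewrite -[r *~ q]mulrzr e -[a *~ p]mulrzr subrr.
Qed.

(** * Closures and rational functions *)

Section Closure.
Variables (L : fieldType) (v : valuation L).

Definition closure_set (T : set L) : set L :=
  [set a | forall r : rat, exists2 x, T x & (r%:E < v (a - x)%R)%E].

Lemma sub_closure_set T : T `<=` closure_set T.
Proof. by move=> x Tx r; exists x => //; rewrite subrr val0 ltry. Qed.

Lemma closure_set_seq T a : closure_set T a ->
  exists s, (forall n, T (s n)) /\ val_cvg v s a.
Proof.
move=> h; have /choice[s hs] : forall n : nat, exists x, T x /\ ((n%:R : rat)%:E < v (a - x)%R)%E.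
  by move=> n; have [x] := h n%:R; exists x.
exists s; split; first by move=> n; have [] := hs n.
by apply: val_cvg_approx => n; have [] := hs n.
Qed.

Lemma seq_closure_set T a s : (forall n, T (s n)) -> val_cvg v s a -> closure_set T a.
Proof.
move=> hs ha r; have [N hN] := ha r; exists (s N) => //.
by rewrite val_subC; apply: hN.
Qed.

Lemma closure_set_closed T : limit_closed v (closure_set T).
Proof.
move=> s l hs sl r; have [N hN] := sl r; have [x Tx hx] := hs N r.
exists x => //; have -> : l - x = (s N - x) - (s N - l) by ring.
by apply: val_ltB => //; apply: hN.
Qed.

Lemma val_cvgV s l : val_cvg v s l -> l != 0 -> val_cvg v (fun n => (s n)^-1) l^-1.
Proof.
move=> hs l0 r; have [a ea] := val_fin v l0.
have [N hN] := val_cvg_val hs l0; have [M hM] := hs (r + (a + a)).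
exists (maxn N M) => n; rewrite geq_max => /andP[n1 n2].
have vs : v (s n) = a%:E by rewrite hN.
have s0 := val_neq0 vs.
have -> : (s n)^-1 - l^-1 = (l - s n) * ((s n)^-1 * l^-1) by field; rewrite s0 l0.
have -> : r = r + (a + a) + (- a - a) by ring.
apply: val_ltM; first by rewrite val_subC; apply: hM.
by apply: val_leM; rewrite valV // ?vs ?ea.
Qed.

Lemma closure_set_subfield T : subfield_set T -> subfield_set (closure_set T).
Proof.
move=> [[T1 TB TM] TV]; split; first split.
- exact: sub_closure_set.
- move=> x y /closure_set_seq[s [hs sx]] /closure_set_seq[t [ht ty]].
  by apply: (seq_closure_set _ (val_cvgB sx ty)) => n; exact: TB.
- move=> x y /closure_set_seq[s [hs sx]] /closure_set_seq[t [ht ty]].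
  by apply: (seq_closure_set _ (val_cvgM sx ty)) => n; exact: TM.
- move=> x Cx; have [->|x0] := eqVneq x 0.
    by rewrite invr0; apply: sub_closure_set; rewrite -(subrr 1); apply: TB.
  have [s [hs sx]] := closure_set_seq Cx.
  by apply: (seq_closure_set _ (val_cvgV sx x0)) => n; exact: TV.
Qed.

End Closure.

Section RationalFunctions.
Variables (K L : fieldType).

Lemma ratfunE (phi : ratfun K) : exists p q : {poly K}, q != 0 /\
  phi = FracField.tofrac p / FracField.tofrac q.
Proof.
set x := repr phi; have d0 : (frac x).2 != 0 by exact: denom_ratioP.
exists (frac x).1, (frac x).2; split=> //.
have Ephi : phi * FracField.tofrac (frac x).2 = FracField.tofrac (frac x).1.
  rewrite -[phi]reprK -/x; unlock FracField.tofrac.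
  rewrite !piE; apply/eqP; rewrite /FracField.mulf.
  rewrite piE /= FracField.equivfE.
  by rewrite !numden_Ratio ?mulr1 ?mul1r ?oner_neq0 // mulrC.
by rewrite -Ephi mulfK // tofrac_eq0.
Qed.

Lemma poly_eval_morph (S : comNzRingType) (f : {rmorphism {poly K} -> S}) p :
  f p = (map_poly (f \o polyC) p).[f 'X].
Proof.
elim/poly_ind: p => [|p c IH]; first by rewrite !rmorph0 horner0.
by rewrite !rmorphD !rmorphM /= map_polyX map_polyC !hornerE -IH.
Qed.

End RationalFunctions.

Lemma linear_dependence (F : fieldType) (I : finType) N (A : 'I_N -> I -> F) :
  (#|I| < N)%N ->
  exists u : 'I_N -> F, (exists k, u k != 0) /\ forall i, \sum_k u k * A k i = 0.
Proof.
move=> hN; pose M := \matrix_(k < N, l < #|I|) A k (enum_val l).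
have kM : kermx M != 0.
  rewrite kermx_eq0 /row_free; apply: contraL hN => /eqP h.
  by rewrite -leqNgt -h; apply: rank_leq_col.
have hu := sub_kermxP (nz_row_sub (kermx M)); have un0 : nz_row (kermx M) != 0.
  by rewrite nz_row_eq0.
exists (nz_row (kermx M) 0); split.
  by have [k hk] := rV0Pn _ un0; exists k.
move=> i; have := congr1 (fun B : 'rV_ _ => B 0 (enum_rank i)) hu.
rewrite !mxE => h; rewrite -[RHS]h; apply: eq_bigr => k _.
by rewrite mxE enum_rankK.
Qed.

Lemma closed_root_range (Kb : closedFieldType) (KK : fieldType) (ik : {rmorphism Kb -> KK})
    (q : {poly Kb}) a : q != 0 -> root (map_poly ik q) a -> exists r, a = ik r.
Proof.
move=> q0; have [rs ->] := closed_field_poly_normal q.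
rewrite map_polyZ rootZ ?fmorph_eq0 ?lead_coef_eq0 // rmorph_prod.
rewrite (eq_bigr (fun z => 'X - (ik z)%:P)) => [|z _]; last by rewrite /= map_polyXsubC.
elim: rs => [|z rs IH]; first by rewrite big_nil (negPf (root1 _)).
by rewrite big_cons rootM root_XsubC => /orP[/eqP->|/IH//]; exists z.
Qed.

Lemma common_denominator (K : fieldType) n (y : 'I_n -> ratfun K) :
  exists (G : {poly K}) (F : 'I_n -> {poly K}), G != 0 /\
    forall k, y k * FracField.tofrac G = FracField.tofrac (F k).
Proof.
have /choice[p /choice[q hq]] := fun k => ratfunE (y k).
exists (\prod_k q k), (fun k => p k * \prod_(l | l != k) q l); split.
  by apply/prodf_neq0 => k _; have [] := hq k.
move=> k; have [qk0 ->] := hq k.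
rewrite (bigD1 k) //= !tofracM mulrA divfK // tofrac_eq0 //.
Qed.

(** * Extensions to the field of rational functions *)

Lemma discrete_generator (L : fieldType) (v : valuation L) : discrete v ->
  exists (g : rat) pi, [/\ 0 < g, v pi = g%:E &
    forall x, x != 0 -> exists n : int, v x = (g *~ n)%:E].
Proof.
move=> [g g0 hg].
have gen x : x != 0 -> exists n : int, v x = (g *~ n)%:E.
  move=> /(val_fin v)[r er]; have : value_group v setT r by exists x.
  by rewrite hg => -[n _ h]; exists n; rewrite er -h.
have [pi _ epi] : value_group v setT g by rewrite hg; exists 1.
have [gp|gn|gz] := ltgtP 0 g; last by rewrite -gz eqxx in g0.
  by exists g, pi.
exists (- g), pi^-1; split; first by rewrite oppr_gt0.
  by rewrite valV ?(val_neq0 epi) // epi.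
by move=> x /gen[n ->]; exists (- n); rewrite mulNrz mulrNz opprK.
Qed.

(** On K the valuations v and w have the same ring, so they differ by a positive
    factor. *)
Lemma normalise_extension (K L : fieldType) (v : valuation K) (w : valuation L)
    (i : {rmorphism K -> L}) : discrete v ->
  (forall x, (i x \in valuation_ring w) = (x \in valuation_ring v)) ->
  exists (c : rat) (c0 : 0 < c), val_extends v (scale_valuation w c0) i.
Proof.
move=> /discrete_generator[a [t [a0 vt _]]] over.
have t0 := val_neq0 vt; have it0 : i t != 0 by rewrite fmorph_eq0.
have [b eb] := val_fin w it0.
have b0 : 0 < b.
  have := over t^-1; rewrite !inE fmorphV !valV // vt eb -!EFinN !lee_fin !oppr_ge0.
  by rewrite leNgt [a <= 0]leNgt a0 => /negbFE.
have c0 : 0 < a / b by rewrite divr_gt0.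
exists (a / b), c0 => x; have [->|x0] := eqVneq x 0.
  by rewrite rmorph0 !val0.
have [r er] := val_fin v x0; have ix0 : i x != 0 by rewrite fmorph_eq0.
have [s es] := val_fin w ix0.
have [p [q [q0 hu e]]] := valuation_commensurable vt (lt0r_neq0 a0) er.
set u := x ^ q / t ^ p in hu; have u0 := val_neq0 hu.
have iu : w (i u) = 0%E.
  have h1 : (0 <= w (i u))%E by have := over u; rewrite !inE hu lexx.
  have h2 : (0 <= w (i u^-1)%R)%E by have := over u^-1; rewrite !inE valV // hu oppe0 lexx.
  rewrite fmorphV valV ?fmorph_eq0 // oppe_ge0 in h2.
  by apply/eqP; rewrite eq_le h1 h2.
have : s * q%:~R = b * p%:~R.
  have vtp := valXz p eb; move: iu.
  rewrite /u rmorphM fmorphV /= !rmorphXz ?unitfE // valM (valXz _ es).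
  rewrite valV ?(val_neq0 vtp) // vtp -EFinN -EFinD => -[] /eqP.
  by rewrite subr_eq0 -[s *~ q]mulrzr -[b *~ p]mulrzr => /eqP.
move=> e2; rewrite /= es er /=; congr (_%:E).
have qn0 : (q%:~R : rat) != 0 by rewrite intr_eq0 gt_eqF.
apply: (mulIf qn0); rewrite e.
have -> : a / b * s * q%:~R = a / b * (s * q%:~R) by rewrite mulrA.
by rewrite e2; field; exact: lt0r_neq0.
Qed.

Section ResiduallyAlgebraic.
Variables (K : fieldType) (v : valuation K).
Variables (Kh : fieldType) (vh : valuation Kh) (ih : {rmorphism K -> Kh}).
Hypothesis Kh_completion : is_completion v vh ih.
Variables (Kb : closedFieldType) (vb : valuation Kb) (ib : {rmorphism Kh -> Kb}).
Hypothesis Kb_algebraic : algebraic_ext ib.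
Hypothesis vb_extends : val_extends vh vb ib.
Variables (KK : fieldType) (vk : valuation KK) (ik : {rmorphism Kb -> KK}).
Hypothesis KK_completion : is_completion vb vk ik.
Variable w : valuation (ratfun K).
Hypothesis w_ext : val_extends v w (@ratfun_const K).
Hypothesis resw : forall x, (0 <= w x)%E -> residue_separable v w (@ratfun_const K) x.
Variables (g : rat) (pi : ratfun K) (t : K) (m : nat).
Hypothesis g0 : 0 < g.
Hypothesis wpi : w pi = g%:E.
Hypothesis discw : forall x, x != 0 -> exists n : int, w x = (g *~ n)%:E.
Hypothesis m0 : (0 < m)%N.
Hypothesis vt : v t = (g *+ m)%:E.
Variables (L : fieldType) (wL : valuation L) (iL : {rmorphism ratfun K -> L}).
Hypothesis L_completion : is_completion w wL iL.

Let iK : {rmorphism K -> KK} := ik \o ib \o ih.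
Let iKL : {rmorphism K -> L} := iL \o @ratfun_const K.
Let tofrac : {rmorphism {poly K} -> ratfun K} := @FracField.tofrac {poly K}.
Let XL := iL (tofrac 'X).

Lemma val_extends_KK : val_extends v vk iK.
Proof.
have [h1 _ _] := Kh_completion; have [h2 _ _] := KK_completion.
by move=> x; rewrite /iK /= h2 vb_extends h1.
Qed.

Lemma val_extends_L : val_extends v wL iKL.
Proof. by have [h _ _] := L_completion; move=> x; rewrite /iKL /= h w_ext. Qed.

Let wLE x : wL (iL x) = w x. Proof. by have [h _ _] := L_completion; rewrite h. Qed.

Lemma completion_val_approx x : x != 0 -> exists y, w y = wL x /\ (wL x < wL (x - iL y)%R)%E.
Proof.
move=> /(val_fin wL)[r er]; have [_ hD _] := L_completion.
have [y hy] := hD x r; exists y; rewrite er hy; split=> //.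
by rewrite -wLE -er; apply: val_eqB; rewrite er.
Qed.

Lemma completion_discrete x : x != 0 -> exists n : int, wL x = (g *~ n)%:E.
Proof.
move=> x0; have [y [h _]] := completion_val_approx x0; rewrite -h; apply: discw.
by rewrite -(val_eqy w) h val_eqy.
Qed.

Lemma completion_separable x : (0 <= wL x)%E -> residue_separable v wL iKL x.
Proof.
have [_ hD _] := L_completion; move=> hx; have [y hy] := hD x 0.
have ly : (0 <= wL (iL y))%E.
  have -> : iL y = x - (x - iL y) by ring.
  by apply: val_leB => //; exact: ltW.
have wy : (0 <= w y)%E by rewrite -wLE.
have [p [mp ip h1 h2]] := resw wy.
have mapE q : map_poly iKL q = map_poly iL (map_poly (@ratfun_const K) q).
  by rewrite -map_poly_comp.
have ipL : integral_poly wL (map_poly iKL p) by move=> i; rewrite coef_map /= wLE w_ext.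
have idL := integral_poly_deriv ipL.
have hlt : (0%:E < wL (x - iL y)%R)%E by [].
exists p; split=> //.
- rewrite -(subrK (map_poly iKL p).[iL y] (map_poly iKL p).[x]); apply: val_ltD.
    exact: integral_poly_sub.
  by rewrite mapE horner_map wLE.
- have e : wL (map_poly iKL p)^`().[iL y] = 0%E.
    by rewrite mapE deriv_map horner_map /= wLE.
  rewrite -e; apply: val_eqB; rewrite e.
  by apply: integral_poly_sub => //; rewrite val_subC.
Qed.

Let cL : forall s, val_cauchy wL s -> exists l, val_cvg wL s l.
Proof. by have [_ _ h] := L_completion. Qed.
Let cKK : forall s, val_cauchy vk s -> exists l, val_cvg vk s l.
Proof. by have [_ _ h] := KK_completion. Qed.
Let wLpi : wL (iL pi) = g%:E. Proof. by rewrite wLE. Qed.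

Lemma poly_imageE (j : {rmorphism L -> KK}) (f : {poly K}) :
  (forall a, j (iKL a) = iK a) -> j (iL (tofrac f)) = (map_poly iK f).[j XL].
Proof.
move=> hj; pose h : {rmorphism {poly K} -> KK} := j \o iL \o tofrac.
rewrite -[LHS]/(h f) poly_eval_morph; congr (_.[_]).
by apply/polyP => i; rewrite !coef_map; exact: hj.
Qed.

(** The image of 'X under an embedding over K of the completion of K(X). *)
Lemma exists_representation : exists alpha, represents vk iK w alpha.
Proof.
pose G0 : set (L * KK) := [set (iKL a, iK a) | a in setT].
have iG0 : isometric_graph wL vk iKL iK G0.
  split; [split| |].
  - by exists 1 => //; rewrite !rmorph1.
  - by move=> _ _ [a _ <-] [b _ <-]; exists (a - b) => //; rewrite !rmorphB.
  - by move=> _ _ [a _ <-] [b _ <-]; exists (a * b) => //; rewrite !rmorphM.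
  - by move=> _ [a _ <-] /=; rewrite val_extends_L val_extends_KK.
  - by move=> a; exists a.
have rootKK := closed_completion_root KK_completion.
have [j [vj kj _]] := isometric_embedding val_extends_L cL cKK rootKK
  completion_separable g0 wLpi completion_discrete m0 vt iG0.
exists (j XL).
have E f : j (iL (tofrac f)) = (map_poly iK f).[j XL] by apply: poly_imageE.
have tr : ~ algebraicOver iK (j XL).
  move=> [p p0 /rootP]; rewrite -E => /eqP; rewrite !fmorph_eq0.
  by rewrite tofrac_eq0 (negPf p0).
split=> // phi; rewrite !inE; have [p [q [q0 e]]] := ratfunE phi.
rewrite e ratfun_evalE // -!E -fmorphV -rmorphM -fmorphV -rmorphM.
by rewrite vj wLE.
Qed.

Section Representation.
Variable alpha : KK.
Hypothesis rep : represents vk iK w alpha.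

(** The hypothesis on alpha only concerns valuation rings; the values agree
    because they agree on K. *)
Lemma representation_val f : vk (map_poly iK f).[alpha] = w (tofrac f).
Proof.
have [tr h] := rep; have [->|f0] := eqVneq f 0.
  by rewrite !rmorph0 horner0 !val0.
have tf0 : tofrac f != 0 by rewrite tofrac_eq0.
have [r er] := val_fin w tf0.
have vt' : w (ratfun_const t) = (g *+ m)%:E by rewrite w_ext.
have gm0 : g *+ m != 0 by rewrite mulrn_eq0 negb_or -lt0n m0 gt_eqF.
have [p [q [q0 hu e]]] := valuation_commensurable vt' gm0 er.
have t0 := val_neq0 vt.
pose T : {poly K} := (t ^ p)%:P.
have T0 : T != 0 by rewrite polyC_eq0 expfz_neq0.
have [n en] : exists n : nat, q = n%:Z by exists `|q|%N; rewrite gez0_abs // ltW.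
have uE : (tofrac f) ^ q / (ratfun_const t) ^ p = tofrac (f ^+ n) / tofrac T.
  by rewrite en /T -[tofrac _%:P]/(ratfun_const _) rmorphXz ?unitfE // rmorphXn.
have u0 := val_neq0 hu.
set u := _ / _ in hu uE u0.
have f1 : (map_poly iK f).[alpha] != 0.
  by apply/negP => rf; apply: tr; exists f.
have [s es] := val_fin vk f1.
have vT : vk (map_poly iK T).[alpha] = (g *+ m *~ p)%:E.
  by rewrite map_polyC hornerC /= val_extends_KK (valXz _ vt).
have h1 : (0 <= vk ((map_poly iK (f ^+ n)).[alpha] / (map_poly iK T).[alpha])%R)%E.
  by have := h u; rewrite !inE hu lexx uE ratfun_evalE.
have h2 : (0 <= vk ((map_poly iK T).[alpha] / (map_poly iK (f ^+ n)).[alpha])%R)%E.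
  have := h u^-1; rewrite !inE valV // hu oppe0 lexx uE invf_div ratfun_evalE //.
  by rewrite expf_neq0.
have vfn : vk (map_poly iK (f ^+ n)).[alpha] = (s *+ n)%:E.
  by rewrite rmorphXn horner_exp (valX _ es).
have nz1 := val_neq0 vfn; have nz2 := val_neq0 vT.
move: h1 h2; rewrite !valM !valV // vfn vT -!EFinN -!EFinD !lee_fin => h1 h2.
have e2 : s * q%:~R = g *+ m * p%:~R.
  rewrite mulrzr en mulrzr; apply/eqP; rewrite eq_le.
  by rewrite -subr_ge0 h2 -subr_ge0 h1.
rewrite es er; congr (_%:E).
have qn0 : (q%:~R : rat) != 0 by rewrite intr_eq0 gt_eqF.
by apply: (mulIf qn0); rewrite e2 e.
Qed.

(** Evaluation of polynomials at alpha is an isometric graph, which extends to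
    the completion. *)
Lemma representation_embedding : exists j : {rmorphism L -> KK},
  [/\ val_extends wL vk j, forall a, j (iKL a) = iK a & j XL = alpha].
Proof.
pose G0 : set (L * KK) := [set (iL (tofrac f), (map_poly iK f).[alpha]) | f in setT].
have iG0 : isometric_graph wL vk iKL iK G0.
  split; [split| |].
  - by exists 1 => //; rewrite !rmorph1 hornerC.
  - by move=> _ _ [a _ <-] [b _ <-]; exists (a - b) => //; rewrite !rmorphB hornerD hornerN.
  - by move=> _ _ [a _ <-] [b _ <-]; exists (a * b) => //; rewrite !rmorphM hornerM.
  - by move=> _ [a _ <-] /=; rewrite wLE representation_val.
  - by move=> a; exists a%:P => //; rewrite map_polyC hornerC.
have rootKK := closed_completion_root KK_completion.
have [j [vj kj hj]] := isometric_embedding val_extends_L cL cKK rootKK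
  completion_separable g0 wLpi completion_discrete m0 vt iG0.
exists j; split=> //; have := hj (XL, alpha); apply.
by exists 'X => //; rewrite map_polyX hornerX.
Qed.

(** A sequence of elements of K that converges in L also converges in the
    completion Kh, and j preserves limits. *)
Let closure_K a : closure_set wL (range iKL) a -> forall j : {rmorphism L -> KK},
  val_extends wL vk j -> (forall x, j (iKL x) = iK x) -> exists h, j a = ik (ib h).
Proof.
have [eh _ ch] := Kh_completion; have [eb _ _] := KK_completion.
move=> /closure_set_seq[s [hs sa]] j vj kj.
have /choice[x hx] : forall n, exists x, s n = iKL x.
  move=> n; have [x _ h] := hs n; exists x; exact: esym h.
have [h hh] : exists h, val_cvg vh (ih \o x) h.
  apply: ch => r; have [N hN] := val_cvg_cauchy sa r; exists N => n k hn hk.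
  by rewrite /= -rmorphB eh -val_extends_L rmorphB -!hx; apply: hN.
exists h; apply: (@val_cvg_uniq _ vk (j \o s)) => r.
  by have [N hN] := sa r; exists N => n /hN; rewrite /= -rmorphB vj.
have [N hN] := hh r; exists N => n /hN.
by rewrite /= hx kj /iK /= -!rmorphB eb vb_extends.
Qed.

Let range_subfield : subfield_set (range iKL).
Proof.
split; [split|].
- by exists 1 => //; rewrite rmorph1.
- by move=> _ _ [x _ <-] [y _ <-]; exists (x - y) => //; rewrite rmorphB.
- by move=> _ _ [x _ <-] [y _ <-]; exists (x * y) => //; rewrite rmorphM.
- by move=> _ [x _ <-]; exists x^-1 => //; rewrite fmorphV.
Qed.

Definition finite_residue_span := exists n (b : 'I_n -> ratfun K),
  (forall k, (0 <= w (b k))%E) /\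
  forall y, (0 <= w y)%E -> exists c : 'I_n -> K, (forall k, (0 <= v (c k))%E) /\
    (0 < w (y - \sum_k ratfun_const (c k) * b k)%R)%E.

(** If the residue fields form a finite extension, then L is finite-dimensional
    over the closure of K, spanned by the products of lifts of residue classes
    and of powers of pi; linear dependence of the powers of alpha gives an
    equation over the completion of K. *)
Lemma finite_residue_range : finite_residue_span -> range ik alpha.
Proof.
move=> [n [b [b0 hb]]]; have [j [vj kj jX]] := representation_embedding.
pose S := closure_set wL (range iKL).
have fS : subfield_set S by exact: closure_set_subfield range_subfield.
have lS : limit_closed wL S by exact: closure_set_closed.
pose b' k := if b k == 0 then 1 else iL (b k).
have b'0 k : b' k != 0 by rewrite /b'; case: ifPn => h; rewrite ?oner_neq0 // fmorph_eq0.
have vb' k : (0 <= wL (b' k))%E by rewrite /b'; case: eqP => _; rewrite ?val1 ?wLE.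
have res u : (0 <= wL u)%E -> exists c : 'I_n -> L,
   [/\ forall k, S (c k), forall k, (0 <= wL (c k))%E &
       (0 < wL (u - \sum_k c k * b' k)%R)%E].
  move=> hu; have [_ hD _] := L_completion; have [y hy] := hD u 0.
  have wy : (0 <= w y)%E.
    rewrite -wLE; have -> : iL y = u - (u - iL y) by ring.
    by apply: val_leB => //; exact: ltW.
  have [c [c0 hc]] := hb y wy.
  exists (fun k => if b k == 0 then 0 else iKL (c k)); split.
  - move=> k; apply: sub_closure_set; case: eqP => _; last by exists (c k).
    by exists 0 => //; rewrite rmorph0.
  - by move=> k; case: eqP => _; rewrite ?val0 ?leey // val_extends_L.
  - have -> : \sum_k (if b k == 0 then 0 else iKL (c k)) * b' k =
        iL (\sum_k ratfun_const (c k) * b k).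
      rewrite rmorph_sum; apply: eq_bigr => k _; rewrite rmorphM /b'.
      by case: eqP => [->|_] //; rewrite rmorph0 mul0r mulr0.
    rewrite -(subrK (iL y) u) -addrA -rmorphB; apply: val_ltD => //.
    by rewrite wLE.
have St : S (iKL t) by apply: sub_closure_set; exists t.
have vtL : wL (iKL t) = (g *+ m)%:E by rewrite val_extends_L.
have span := discrete_span cL g0 wLpi completion_discrete fS lS b'0 vb' res m0 St vtL.
have /choice[h hh] : forall k : nat, exists h : 'I_n * 'I_m -> Kh,
    alpha ^+ k = \sum_p ik (ib (h p)) * j (b' p.1 * iL pi ^+ p.2).
  move=> k; have [c [Sc _ e]] := span (XL ^+ k).
  have /choice[h hh] := fun p => closure_K (Sc p) vj kj.
  exists h; rewrite -jX -rmorphXn e rmorph_sum; apply: eq_bigr => p _.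
  by rewrite rmorphM hh.
pose N := #|{: 'I_n * 'I_m}|.+1.
have [u [[k0 uk0] hu]] := @linear_dependence Kh _ N (fun k p => h k p) (leqnn _).
pose Q := \poly_(k < N) u (inord k).
have Q0 : map_poly ib Q != 0.
  rewrite map_poly_eq0; apply: contra_neq uk0 => /(congr1 (fun q : {poly Kh} => q`_k0)).
  by rewrite coef_poly coef0 ltn_ord inord_val.
have [|r ->] := @closed_root_range Kb KK ik _ alpha Q0; last by exists r.
rewrite -map_poly_comp; apply/rootP.
have sQ : (size (map_poly (ik \o ib) Q) <= N)%N.
  by rewrite (leq_trans (size_poly _ _)) // size_poly.
rewrite (horner_coef_wide _ sQ).
transitivity (\sum_(k < N) \sum_p ik (ib (u k)) * (ik (ib (h k p)) * j (b' p.1 * iL pi ^+ p.2))).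
  apply: eq_bigr => k _; rewrite coef_map coef_poly ltn_ord inord_val hh big_distrr //.
rewrite exchange_big big1 //= => p _.
under eq_bigr do rewrite mulrA -!rmorphM.
by rewrite -big_distrl /= -!rmorph_sum hu !rmorph0 mul0r.
Qed.

(** The residue degree is at most the degree: if a is a root of a polynomial q,
    then elements of K(a) satisfy a linear relation over Kh as soon as their
    number is at least size q. The relation is scaled to have integral coefficients, one
    of them a unit, and these are approximated by elements of K. *)
Lemma residue_dependence a : alpha = ik a -> exists D, forall N (y : 'I_N -> ratfun K),
  (D <= N)%N -> (forall k, (0 <= w (y k))%E) ->
  exists c : 'I_N -> K, [/\ forall k, (0 <= v (c k))%E, exists k, v (c k) = 0%E &
    (0 < w (\sum_k ratfun_const (c k) * y k)%R)%E].
Proof.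
move=> ea; have [q q0 rq] := Kb_algebraic a; exists (size q) => -[|N] y sN y0.
  by move: sN; rewrite leqn0 size_poly_eq0 (negPf q0).
have [eh dh _] := Kh_completion; have [eb _ _] := KK_completion.
have sq0 : (0 < size q)%N by rewrite size_poly_gt0.
have [j [vj kj jX]] := representation_embedding.
have [G [F [G0 hF]]] := common_denominator y.
pose r k := map_poly ih (F k) %% q.
have sr k : (size (r k) <= (size q).-1)%N by rewrite -ltnS prednK // ltn_modp.
have evr k : (map_poly ib (map_poly ih (F k))).[a] = (map_poly ib (r k)).[a].
  rewrite {1}(divp_eq (map_poly ih (F k)) q) rmorphD rmorphM hornerD hornerM.
  by rewrite (rootP rq) mulr0 add0r.
have [|u [[k1 uk1] hu]] := @linear_dependence Kh 'I_(size q).-1 N.+1 (fun k i => (r k)`_i).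
  by rewrite card_ord prednK.
have su : \sum_k ib (u k) * (map_poly ib (map_poly ih (F k))).[a] = 0.
  transitivity (map_poly ib (\sum_k u k *: r k)).[a].
    rewrite rmorph_sum horner_sum; apply: eq_bigr => k _.
    by rewrite evr /= map_polyZ hornerZ.
  rewrite (_ : \sum_k _ = 0) ?rmorph0 ?horner0 //; apply/polyP => i.
  rewrite coef0 coef_sum; have [iq|iq] := ltnP i (size q).-1.
    by rewrite -[RHS](hu (Ordinal iq)); apply: eq_bigr => k _; rewrite coefZ.
  rewrite big1 // => k _; rewrite coefZ nth_default ?mulr0 //.
  exact: leq_trans (sr k) iq.
have jy k : j (iL (y k)) * j (iL (tofrac G)) = ik (map_poly ib (map_poly ih (F k))).[a].
  rewrite -!rmorphM hF (poly_imageE _ kj) jX ea.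
  have -> : map_poly iK (F k) = map_poly ik (map_poly ib (map_poly ih (F k))).
    by apply/polyP => i; rewrite !coef_map.
  exact: horner_map.
have sy : \sum_k ik (ib (u k)) * j (iL (y k)) = 0.
  have jG : j (iL (tofrac G)) != 0 by rewrite !fmorph_eq0 tofrac_eq0.
  apply: (mulIf jG); rewrite mul0r big_distrl /= -[RHS](rmorph0 ik) -su rmorph_sum.
  by apply: eq_bigr => k _; rewrite -mulrA jy rmorphM.
have [k0 hk0] := val_argmin vh u.
have u0 : u k0 != 0.
  apply: contra_neq uk1 => e; apply/eqP; have := hk0 k1.
  by rewrite e val0 leye_eq val_eqy.
have [s es] := val_fin vh u0.
pose u' k := u k / u k0.
have u'0 k : (0 <= vh (u' k))%E.
  by rewrite valM valV // sube_ge0 ?es // -es.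
have /choice[c hc] : forall k, exists x, (0%:E < vh (u' k - ih x)%R)%E by move=> k; apply: dh.
have c0 k : (0 <= v (c k))%E.
  rewrite -eh; have -> : ih (c k) = u' k - (u' k - ih (c k)) by ring.
  by apply: val_leB => //; apply: ltW.
exists c; split=> //.
  exists k0; rewrite -eh -[RHS](val1 vh).
  have e1 : u' k0 = 1 by rewrite /u' divff.
  by apply: val_eqB; rewrite val1 -e1.
rewrite -wLE -vj !rmorph_sum.
have -> : \sum_k j (iL (ratfun_const (c k) * y k)) =
    - \sum_k (ik (ib (u' k - ih (c k)))) * j (iL (y k)).
  have s0 : \sum_k ik (ib (u' k)) * j (iL (y k)) = 0.
    transitivity ((ik (ib (u k0)))^-1 * \sum_k ik (ib (u k)) * j (iL (y k))); 
      last by rewrite sy mulr0.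
    rewrite big_distrr /=; apply: eq_bigr => k _.
    by rewrite /u' !rmorphM !fmorphV; ring.
  apply/eqP; rewrite -subr_eq0 opprK -big_split /= -[X in _ == X]s0; apply/eqP/eq_bigr => k _.
  by rewrite !rmorphB !rmorphM -[j (iL (ratfun_const _))]/(j (iKL _)) kj /iK /=; ring.
rewrite valN; apply: val_lt_sum => k _.
apply: val_gt0M; first by rewrite eb vb_extends; apply: hc.
by rewrite vj wLE.
Qed.

(** A maximal family of integral elements with linearly independent residue
    classes spans. *)
Lemma range_finite_residue : range ik alpha -> finite_residue_span.
Proof.
move=> [a _ /esym ea]; have [D hD] := residue_dependence ea.
pose indep n (b : 'I_n -> ratfun K) := (forall k, (0 <= w (b k))%E) /\
  forall c : 'I_n -> K, (forall k, (0 <= v (c k))%E) ->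
   (0 < w (\sum_k ratfun_const (c k) * b k)%R)%E -> forall k, (0 < v (c k))%E.
pose P n := `[< exists b, @indep n b >].
have exP : exists n, P n.
  exists 0%N; apply/asboolP; exists (fun=> 0); split; first by case.
  by move=> c _ _ [].
have PD n : P n -> (n <= D)%N.
  move=> /asboolP[b [b0 hb]]; rewrite leqNgt; apply/negP => Dn.
  have [c [c0 [k ck] hc]] := hD n b (ltnW Dn) b0.
  by have := hb c c0 hc k; rewrite ck ltxx.
case: (ex_maxnP exP PD) => n /asboolP[b [b0 hb]] maxn.
exists n, b; split=> // y y0.
pose b' k := if unlift ord0 k is Some k' then b k' else y.
have b'0 k : (0 <= w (b' k))%E by rewrite /b'; case: unliftP.
have [c [c0 hc [k hk]]] : exists c : 'I_n.+1 -> K, [/\ forall k, (0 <= v (c k))%E,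
    (0 < w (\sum_k ratfun_const (c k) * b' k)%R)%E & exists k, ~ (0 < v (c k))%E].
  apply: contrapT => h; have := maxn n.+1; rewrite ltnn => /(_ _)/notF; apply.
  apply/asboolP; exists b'; split=> // c c0 hc k; apply: contrapT => hk.
  by apply: h; exists c; split=> //; exists k.
rewrite big_ord_recl {1}/b' unlift_none in hc.
have hc' : (0 < w (ratfun_const (c ord0) * y +
    \sum_(i < n) ratfun_const (c (lift ord0 i)) * b i)%R)%E.
  by move: hc; congr (_ < w (_ + _)%R)%E; apply: eq_bigr => i _; rewrite /b' liftK.
have vc0 : v (c ord0) = 0%E.
  apply/eqP; rewrite eq_le c0 andbT leNgt; apply/negP => vc0; apply: hk.
  have hs : (0 < w (\sum_(i < n) ratfun_const (c (lift ord0 i)) * b i)%R)%E.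
    set A := ratfun_const _ * y in hc'; set B := \sum_(i < n) _ in hc' *.
    have -> : B = (A + B) - A by ring.
    by apply: val_ltB => //; apply: val_gt0M; rewrite ?w_ext.
  have := hb (fun i => c (lift ord0 i)) (fun i => c0 _) hs.
  by case: (unliftP ord0 k) => [k' ->|->].
have cn0 := val_neq0 vc0; have ccn0 : ratfun_const (c ord0) != 0 by rewrite fmorph_eq0.
exists (fun i => - (c (lift ord0 i) / c ord0)); split.
  by move=> i; rewrite valN; apply: val_ge0M => //; rewrite valV // vc0 oppe0.
have -> : y - \sum_(i < n) ratfun_const (- (c (lift ord0 i) / c ord0)) * b i =
   (ratfun_const (c ord0) * y + \sum_(i < n) ratfun_const (c (lift ord0 i)) * b i)
     * (ratfun_const (c ord0))^-1.
  rewrite mulrDl mulrAC divff // mul1r; congr (_ + _).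
  rewrite -sumrN big_distrl; apply: eq_bigr => i _ /=.
  by rewrite rmorphN rmorphM fmorphV; ring.
by apply: val_gt0M => //; rewrite valV // w_ext vc0 oppe0.
Qed.

Lemma value_group_base :
  value_group vk (range (ik \o ib)) = value_group w (range (@ratfun_const K)).
Proof.
have [eh dh _] := Kh_completion; have [eb _ _] := KK_completion.
apply/seteqP; split=> [r [_ [h _ <-] e]|r [_ [x _ <-] e]]; last first.
  exists (ik (ib (ih x))); first by exists (ih x).
  by rewrite eb vb_extends eh -w_ext.
rewrite /= eb vb_extends in e; have [x hx] := dh h r.
exists (ratfun_const x); first by exists x.
by rewrite w_ext -eh -e; apply: val_eqB; rewrite e.
Qed.

Section Approximation.
Variable j : {rmorphism L -> KK}.
Hypothesis vj : val_extends wL vk j.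
Hypothesis kj : forall x, j (iKL x) = iK x.
Hypothesis jX : j XL = alpha.

(** The elements of the closure of K(alpha) that are algebraic over the
    completion of K. *)
Let V : set KK := [set y | (exists l, j l = y) /\ exists x, ik x = y].

Let V_subfield : subfield_set V.
Proof.
split; [split|].
- by split; exists 1; rewrite rmorph1.
- move=> _ _ [[x <-] [x' hx]] [[y <-] [y' hy]].
  by split; [exists (x - y)|exists (x' - y')]; rewrite rmorphB // hx hy.
- move=> _ _ [[x <-] [x' hx]] [[y <-] [y' hy]].
  by split; [exists (x * y)|exists (x' * y')]; rewrite rmorphM // hx hy.
- move=> _ [[x <-] [x' hx]].
  by split; [exists x^-1|exists x'^-1]; rewrite fmorphV // hx.
Qed.

Let U : set L := [set x | V (j x)].

Let U_subfield : subfield_set U.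
Proof.
have [[V1 VB VM] VV] := V_subfield; split; [split|].
- by rewrite /U /= rmorph1.
- by move=> x y hx hy; rewrite /U /= rmorphB; apply: VB.
- by move=> x y hx hy; rewrite /U /= rmorphM; apply: VM.
- by move=> x hx; rewrite /U /= fmorphV; apply: VV.
Qed.

Let U_const x : U (iKL x).
Proof. by split; [exists (iKL x)|exists (ib (ih x)); rewrite kj]. Qed.

Let V_Kh h : V (ik (ib h)).
Proof.
have [eh dh _] := Kh_completion; have [eb _ _] := KK_completion.
split; last by exists (ib h).
have /choice[x hx] : forall n : nat, exists x, ((n%:R : rat)%:E < vh (h - ih x)%R)%E.
  by move=> n; apply: dh.
have xh : val_cvg vh (ih \o x) h by exact: val_cvg_approx.
have [l hl] : exists l, val_cvg wL (iKL \o x) l.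
  apply: cL => r; have [N hN] := val_cvg_cauchy xh r; exists N => n k hn hk.
  rewrite -[X in wL X]/(iKL (x n) - iKL (x k)) -rmorphB val_extends_L -eh rmorphB.
  exact: hN.
exists l; apply: (@val_cvg_uniq _ vk (j \o (iKL \o x))) => r.
  by have [N hN] := hl r; exists N => n /hN; rewrite /= -rmorphB vj.
have [N hN] := xh r; exists N => n /hN.
have -> : (j \o (iKL \o x)) n = ik (ib (ih (x n))) by rewrite /= -/(iKL _) kj.
by rewrite -!rmorphB eb vb_extends.
Qed.

(** Every residue class of L is separable over that of K, so Hensel's lemma
    lifts it to an element algebraic over K. *)
Let U_residue u : (0 <= wL u)%E -> exists2 c, U c & (0 < wL (u - c)%R)%E.
Proof.
move=> u0; have [p [mp ip h1 h2]] := completion_separable u0.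
have ipL := integral_poly_map val_extends_L ip.
have [th [rth hth]] := hensel cL ipL u0 h1 h2.
exists th; last by rewrite val_subC.
split; first by exists th.
have q0 : map_poly ib (map_poly ih p) != 0 by rewrite !map_poly_eq0 monic_neq0.
have [|r ->] := @closed_root_range Kb KK ik _ (j th) q0; last by exists r.
have -> : map_poly ik (map_poly ib (map_poly ih p)) = map_poly j (map_poly iKL p).
  by apply/polyP => i; rewrite !coef_map /= -[LHS]/(iK _) -kj.
by rewrite /root horner_map rth rmorph0.
Qed.

Let S := closure_set wL U.

Let S_approx a (r : rat) : S a -> exists x, V (ik x) /\ (r%:E < vk (j a - ik x)%R)%E.
Proof.
move=> Sa; have [l Ul hl] := Sa r; have [_ [x hx]] := Ul.
by exists x; rewrite hx; split=> //; rewrite -rmorphB vj.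
Qed.

(** Over the closure S of the algebraic elements, alpha is a polynomial in the
    uniformizer pi, which satisfies an Eisenstein equation of degree e.
    Approximate the coefficients of both by algebraic elements: the roots r n of
    the approximate equations tend to pi, and the approximate polynomials in
    r n tend to alpha. As in the ramified step of the embedding, a polynomial
    in r n over V has the least of the values of its terms, which is a multiple
    of g. Conversely the generator g of the value group is the value of a
    rational function at alpha, hence also at nearby points. *)
Lemma algebraic_approximation : exists s : nat -> Kb, [/\ val_cauchy vb s,
   val_cvg vk (ik \o s) alpha &
   exists N, forall n, (N <= n)%N ->
     value_group vk (adjoin (ik \o ib) (ik (s n))) = value_group w setT].
Proof.
have [eb _ _] := KK_completion; have [rV VV] := V_subfield.
have fS : subfield_set S by exact: closure_set_subfield U_subfield.
have lS : limit_closed wL S by exact: closure_set_closed.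
have US : U `<=` S by exact: sub_closure_set.
have resS u : (0 <= wL u)%E -> exists2 c, S c & (0 < wL (u - c)%R)%E.
  by move=> /U_residue[c Uc hc]; exists c => //; apply: US.
pose Q e := (0 < e)%N && `[< exists2 a, S a & wL a = (g *+ e)%:E >].
have exQ : exists e, Q e.
  exists m; rewrite /Q m0; apply/asboolP; exists (iKL t); last by rewrite val_extends_L.
  exact/US/U_const.
case: (ex_minnP exQ) => -[|e'] //; set e := e'.+1 => /andP[e0 /asboolP[a0 Sa0 va0]] mine.
have minV k y : V y -> vk y = (g *+ k)%:E -> (0 < k < e)%N -> False.
  move=> Vy vy /andP[k0]; rewrite ltnNge mine // /Q k0; apply/asboolP.
  have [[l hl] _] := Vy; exists l; first by apply: US; rewrite /U /= hl.
  by rewrite -vj hl.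
have span := totally_ramified_span cL g0 wLpi completion_discrete fS lS resS e0 Sa0 va0.
have [a [Sa _ ea]] := span (iL pi ^+ e).
have [b [Sb _ eX]] := span XL.
have /choice[A hA] : forall n : nat, exists A : 'I_e -> Kb, forall i,
    V (ik (A i)) /\ ((n%:R : rat)%:E < vk (j (a i) - ik (A i))%R)%E.
  by move=> n; have /choice[A hA] := fun i => S_approx n%:R (Sa i); exists A.
have /choice[B hB] : forall n : nat, exists B : 'I_e -> Kb, forall i,
    V (ik (B i)) /\ ((n%:R : rat)%:E < vk (j (b i) - ik (B i))%R)%E.
  by move=> n; have /choice[B hB] := fun i => S_approx n%:R (Sb i); exists B.
pose q n : {poly Kb} := \sum_(i < e) (A n i)%:P * 'X^i.
pose P n := 'X^e - q n.
have sq n : (size (q n) <= e)%N by exact: size_sum_low.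
have sP n : size (P n) = e.+1 by exact: size_XnBlow.
have mP n : P n \is monic by exact: monic_XnBlow.
have mapP n : map_poly ik (P n) = 'X^e - \sum_(i < e) (ik (A n i))%:P * 'X^i.
  by rewrite rmorphB /= map_polyXn map_sum_low.
have vjpi : vk (j (iL pi)) = g%:E by rewrite vj.
have jpi0 : (0 <= vk (j (iL pi)))%E by rewrite vjpi lee_fin ltW.
have e1 : 0 < (e%:R^-1 : rat) by rewrite invr_gt0 ltr0n.
have /choice[r hr] : forall n : nat, exists r, root (P n) r /\
    ((n%:R / e%:R : rat)%:E < vk (j (iL pi) - ik r)%R)%E.
  move=> n; have [|r rr hr] := @near_root Kb KK vk ik (P n) (j (iL pi)) (n%:R / e%:R) (mP n);
    last by exists r.
  rewrite sP /= -(mulr_natr (_ / _)) divfK ?pnatr_eq0 -?lt0n // mapP.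
  rewrite hornerD hornerN hornerXn horner_sum_low -rmorphXn ea rmorph_sum -sumrB.
  apply: val_lt_sum => i _; rewrite rmorphM rmorphXn -mulrBl.
  rewrite -[n%:R]addr0; apply: val_ltM; last exact: val_ge0X.
  by have [_] := hA n i.
have rcv : val_cvg vk (ik \o r) (j (iL pi)).
  move=> d; have [N hN] := natmul_unbounded d 0 e1; exists N => n /hN.
  rewrite add0r => hn; rewrite val_subC /=; have [_] := hr n; apply: lt_trans.
  by rewrite lte_fin mulrC mulr_natr.
pose s n := \sum_(i < e) B n i * r n ^+ i.
have scv : val_cvg vk (ik \o s) alpha.
  rewrite -jX eX rmorph_sum.
  apply: (@val_cvg_eq _ _ (fun n => \sum_(i < e) ik (B n i) * ik (r n) ^+ i)).
    by move=> n; rewrite /= rmorph_sum; apply: eq_bigr => i _; rewrite rmorphM rmorphXn.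
  apply: val_cvg_sum => i; rewrite rmorphM; apply: val_cvgM.
    by apply: val_cvg_approx => n; have [_] := hB n i.
  rewrite rmorphXn -[j _ ^+ i]hornerXn.
  by apply: val_cvg_eq (val_cvg_horner 'X^i rcv) => n; rewrite hornerXn.
exists s; split=> //.
  move=> d; have [N hN] := val_cvg_cauchy scv d; exists N => n k hn hk.
  by rewrite -eb rmorphB; apply: hN.
have jpin0 : j (iL pi) != 0 := val_neq0 vjpi.
have [N1 hN1] := val_cvg_val rcv jpin0.
have polyV n T : (N1 <= n)%N -> poly_over V T -> T.[ik (r n)] != 0 ->
    exists z : int, vk T.[ik (r n)] = (g *~ z)%:E.
  move=> hn oT; have vr : vk (ik (r n)) = g%:E by rewrite hN1.
  have oP : poly_over V (map_poly ik (P n)).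
    rewrite mapP; apply: poly_overB => //; first exact: poly_overXn.
    apply: poly_over_sum => // i _; apply: poly_overM => //; last exact: poly_overXn.
    by apply: poly_overC => //; have [] := hA n i.
  have mP' : map_poly ik (P n) \is monic by apply: monic_map.
  have [u [d [_ od -> sd]]] := monic_division rV mP' oP oT.
  have [rn _] := hr n.
  rewrite hornerD hornerM horner_map (rootP rn) rmorph0 mulr0 add0r.
  have sd' : (size d <= e)%N by move: sd; rewrite size_map_poly sP ltnS.
  rewrite (horner_coef_wide _ sd').
  have dist := distinct_terms V_subfield (minV) (fun i => od i : V _) vr.
  have [i [ei _]] := val_sum_distinct dist.
  rewrite ei => nz; have [[l hl] _] : V d`_i by apply: od.
  have di0 : d`_i != 0.
    by apply: contra_neq nz => di0; apply/eqP; rewrite -(val_eqy vk) ei di0 mul0r val0.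
  have l0 : l != 0 by rewrite -(fmorph_eq0 j) hl.
  have [z hz] := completion_discrete l0; exists (z + i%:Z).
  by rewrite valM (valX _ vr) -hl vj hz -EFinD mulrzDr.
pose T n : {poly KK} := \sum_(i < e) (ik (B n i))%:P * 'X^i.
have TE n : (T n).[ik (r n)] = ik (s n).
  rewrite horner_sum_low rmorph_sum; apply: eq_bigr => i _.
  by rewrite rmorphM rmorphXn.
have oT n : poly_over V (T n).
  apply: poly_over_sum => // i _; apply: poly_overM => //; last exact: poly_overXn.
  by apply: poly_overC => //; have [] := hB n i.
have polyKh n (p : {poly Kh}) : (N1 <= n)%N -> (map_poly (ik \o ib) p).[ik (s n)] != 0 ->
    exists z : int, vk (map_poly (ik \o ib) p).[ik (s n)] = (g *~ z)%:E.
  move=> hn; rewrite -TE -horner_comp; apply: polyV => //.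
  apply: poly_over_comp => // i; rewrite coef_map; exact: V_Kh.
have [f [h [h0 efh]]] := ratfunE pi.
have pi0 : pi != 0 := val_neq0 wpi.
have f0 : f != 0 by apply: contra_neq pi0 => f0; rewrite efh f0 rmorph0 mul0r.
have mapKh (p : {poly K}) : map_poly (ik \o ib) (map_poly ih p) = map_poly iK p.
  by apply/polyP => i; rewrite !coef_map.
have near (p : {poly K}) : p != 0 -> exists N, forall n, (N <= n)%N ->
    vk (map_poly iK p).[ik (s n)] = w (tofrac p).
  move=> p0; rewrite -representation_val; apply: (val_cvg_val (val_cvg_horner _ scv)).
  by rewrite -(val_eqy vk) representation_val val_eqy tofrac_eq0.
have [N2 hN2] := near f f0; have [N3 hN3] := near h h0.
exists (maxn N1 (maxn N2 N3)) => n; rewrite !geq_max => /and3P[n1 n2 n3].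
apply/seteqP; split=> [rho [y [p1 [p2 ey]] vy]|rho [x _ wx]].
  have y0 := val_neq0 vy; move: (y0); rewrite ey mulf_eq0 invr_eq0 negb_or => /andP[p10 p20].
  have [z1 hz1] := polyKh n p1 n1 p10; have [z2 hz2] := polyKh n p2 n1 p20.
  exists (pi ^ (z1 - z2)) => //; rewrite (valXz _ wpi) -vy ey valM valV // hz1 hz2.
  by rewrite mulrzBr EFinB.
have [z hz] := discw (val_neq0 wx).
pose y := (map_poly iK f).[ik (s n)] / (map_poly iK h).[ik (s n)].
have vf := hN2 n n2; have vh' := hN3 n n3.
have h10 : (map_poly iK h).[ik (s n)] != 0.
  by rewrite -(val_eqy vk) vh' val_eqy tofrac_eq0.
have vy : vk y = g%:E.
  have th0 : tofrac h != 0 by rewrite tofrac_eq0.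
  have eg : g%:E = (w (tofrac f) + - w (tofrac h))%E.
    by rewrite -wpi efh valM (valV _ th0).
  by rewrite eg /y valM (valV _ h10) vf vh'.
exists (y ^ z); last by rewrite (valXz _ vy) -hz.
have hom (p p' : {poly K}) k : ((map_poly iK p).[ik (s n)] / (map_poly iK p').[ik (s n)]) ^+ k =
    (map_poly (ik \o ib) (map_poly ih (p ^+ k))).[ik (s n)] /
    (map_poly (ik \o ib) (map_poly ih (p' ^+ k))).[ik (s n)].
  by rewrite !mapKh !rmorphXn !horner_exp expr_div_n.
case: z {hz} => k.
  by exists (map_poly ih (f ^+ k)), (map_poly ih (h ^+ k)); rewrite -hom.
rewrite NegzE -exprnN -exprVn /y invf_div.
by exists (map_poly ih (h ^+ k.+1)), (map_poly ih (f ^+ k.+1)); rewrite -hom.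
Qed.

End Approximation.

End Representation.
End ResiduallyAlgebraic.

Theorem theorem4p6
  (* V is the valuation ring of v *)
  (K : fieldType) (v : valuation K)
  (v_discrete : discrete v)
  (kv_perfect : perfect_field (residue_field v))
  (* the completion of K, an algebraic closure of it, and the completion of
     the latter, with the valuations extending v *)
  (Kh : fieldType) (vh : valuation Kh) (ih : {rmorphism K -> Kh})
  (Kh_completion : is_completion v vh ih)
  (Kb : closedFieldType) (vb : valuation Kb) (ib : {rmorphism Kh -> Kb})
  (Kb_algebraic : algebraic_ext ib) (vb_extends : val_extends vh vb ib)
  (KK : fieldType) (vk : valuation KK) (ik : {rmorphism Kb -> KK})
  (KK_completion : is_completion vb vk ik)
  (* W is the valuation ring of w *)
  (w : valuation (ratfun K))
  (w_discrete : discrete w)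
  (w_over_v : forall x : K,
    (ratfun_const x \in valuation_ring w) = (x \in valuation_ring v))
  (w_res_alg : algebraic_ext (@residue_map K _ v w (@ratfun_const K))) :
  let rep := represents vk (ik \o ib \o ih) w in
  let res_finite := finite_ext (@residue_map K _ v w (@ratfun_const K)) in
  let index_w_v := group_index (value_group w (range (@ratfun_const K)))
                               (value_group w setT) in
  [/\ exists alpha : KK, rep alpha,
      forall alpha : KK, rep alpha -> (range ik alpha <-> res_finite)
    & ~ res_finite -> forall alpha : KK, rep alpha ->
        exists s : nat -> Kb,
          [/\ val_cauchy vb s,
              val_cvg vk (ik \o s) alpha
            & exists N, forall n, (N <= n)%N ->
                ramification_index vk (ik \o ib) (ik (s n)) = index_w_v]].
Proof.
move=> rep res_finite index_w_v.
have [c [c0 w_ext]] := normalise_extension v_discrete w_over_v.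
pose w' := scale_valuation w c0.
have w'0 x : (0 <= w' x)%E = (0 <= w x)%E := scale_valuation_ge0 w c0 x.
have w'1 x : (0 < w' x)%E = (0 < w x)%E := scale_valuation_gt0 w c0 x.
have res' x : (0 <= w' x)%E -> residue_separable v w' (@ratfun_const K) x.
  rewrite w'0 => /(residue_simple_root w_over_v kv_perfect w_res_alg)[p [mp ip h1 h2]].
  by exists p; split; rewrite ?w'1 //= h2 /= mulr0.
have [gv [t [gv0 vt _]]] := discrete_generator v_discrete.
have [g1 [pi [g10 wpi dw]]] := discrete_generator w_discrete.
pose g := c * g1; have g0 : 0 < g by rewrite mulr_gt0.
have w'pi : w' pi = g%:E by rewrite /= wpi.
have dw' x : x != 0 -> exists n : int, w' x = (g *~ n)%:E.
  by move=> /dw[n hn]; exists n; rewrite /= hn /= mulrzAr.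
have [m [m0 vtm]] : exists m : nat, (0 < m)%N /\ v t = (g *+ m)%:E.
  have t0 := val_neq0 vt; have [|n hn] := dw' (ratfun_const t).
    by rewrite fmorph_eq0.
  move: hn; rewrite w_ext vt => -[hn].
  have n0 : 0 < n by rewrite -(pmulrz_rgt0 _ g0) -hn.
  by case: n n0 hn => // m m0 hn; exists m; split=> //; rewrite hn.
have [L [wL [iL L_completion]]] := completion_exists w'.
have repE alpha : rep alpha <-> represents vk (ik \o ib \o ih) w' alpha.
  by split=> -[tr h]; split=> // phi; have := h phi; rewrite !inE w'0.
have finE : res_finite <-> finite_residue_span v w'.
  split=> [/(finite_residue_spanP w_over_v)|] [n [b [b0 hb]]].
    exists n, b; split=> [k|y]; first by rewrite w'0.
    by rewrite w'0 => /hb[d [d0 hd]]; exists d; rewrite w'1.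
  apply/(finite_residue_spanP w_over_v); exists n, b; split=> [k|y]; first by rewrite -w'0.
  by rewrite -w'0 => /hb[d [d0 hd]]; exists d; rewrite -w'1.
split.
- have [alpha ra] := exists_representation Kh_completion vb_extends KK_completion w_ext res'
    g0 w'pi dw' m0 vtm L_completion.
  by exists alpha; apply/repE.
- move=> alpha /repE ra; split=> [ra'|/finE fin].
    apply/finE.
    exact: (range_finite_residue Kh_completion Kb_algebraic vb_extends KK_completion w_ext res'
      g0 w'pi dw' m0 vtm L_completion ra ra').
  exact: (finite_residue_range Kh_completion vb_extends KK_completion w_ext res'
    g0 w'pi dw' m0 vtm L_completion ra fin).
- move=> _ alpha /repE ra.
  have [j [vj kj jX]] := representation_embedding Kh_completion vb_extends KK_completion
    w_ext res' g0 w'pi dw' m0 vtm L_completion ra.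
  have [s [cs sa [N hN]]] := algebraic_approximation Kh_completion vb_extends KK_completion
    w_ext res' g0 w'pi dw' m0 vtm L_completion ra vj kj jX.
  exists s; split=> //; exists N => n /hN e.
  rewrite /ramification_index e /index_w_v.
  rewrite (value_group_base Kh_completion vb_extends KK_completion w_ext).
  by rewrite !scale_value_group group_index_scale // gt_eqF.
Qed.
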